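(* Let $\mathbb G=\mathbb R^d$ or $\mathbb G=\mathbb Z^d$ act on the probability space $(\Omega,\mathcal F,\mathbb P)$ by $(\theta_g)_{g\in\mathbb G}$ and on $\mathbb R^d$ by the translations $\tau_gx=x+Vg$, with $V$ an invertible $d\times d$ matrix. Assume that $\mathbb P$ is $\mathbb G$-stationary and ergodic, and that $\omega\mapsto\mu_\omega$ is a random locally finite non-negative measure on $\mathbb R^d$ with $\mu_{\theta_g\omega}=\tau_g\mu_\omega$ for all $\omega\in\Omega$, $g\in\mathbb G$. Assume in addition that $\mathbb E[\mu_\omega(\Delta)^\alpha]<+\infty$ for some $\alpha>1$. Fix a measurable function $\vartheta:\mathbb R_+\to\mathbb R_+$ that is non-increasing, is convex on $[a,+\infty)$ for some $a>0$, and satisfies $\int_0^\infty r^{d-1}\vartheta(r)\,dr<+\infty$. Then there exists a $\mathbb G$-invariant set $\mathcal A_\vartheta\subset\Omega$ with $\mathbb P(\mathcal A_\vartheta)=1$ such that, for all $\omega\in\mathcal A_\vartheta$ and all continuous functions $\varphi:\mathbb R^d\to\mathbb R$ with $|\varphi(x)|\le\vartheta(|x|)$ for all $x$, the integral $\int_{\mathbb R^d}|\varphi(x)|\,d\mu^\varepsilon_\omega(x)$ is finite (for all $\varepsilon>0$) and $$\lim_{\varepsilon\downarrow0}\int_{\mathbb R^d}\varphi(x)\,d\mu^\varepsilon_\omega(x)=m\int_{\mathbb R^d}\varphi(x)\,dx.$$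
   Context: $|x|$ is the Euclidean norm; $\mathbb R_+=[0,+\infty)$; $\mathbb E$ is expectation with respect to $\mathbb P$. $\mathbb G$ is $\mathbb R^d$ with the Euclidean topology or $\mathbb Z^d$ with the discrete topology. The action $(\theta_g)_{g\in\mathbb G}$ on $\Omega$ satisfies: $\theta_0$ is the identity, $\theta_g\circ\theta_{g'}=\theta_{g+g'}$, and $(g,\omega)\mapsto\theta_g\omega$ is measurable. A set $A\in\mathcal F$ is $\mathbb G$-invariant if $\theta_gA=A$ for all $g\in\mathbb G$. Stationary: $\mathbb P\circ\theta_g^{-1}=\mathbb P$ for all $g$; ergodic: $\mathbb P(A)\in\{0,1\}$ for every $\mathbb G$-invariant $A\in\mathcal F$. $\mathcal M$ is the space of locally finite non-negative Borel measures on $\mathbb R^d$, with the (metrizable) vague topology ($\nu_n\to\nu$ iff $\int f\,d\nu_n\to\int f\,d\nu$ for all $f\in C_c(\mathbb R^d)$) and its Borel $\sigma$-algebra. A random measure is a measurable map $\Omega\ni\omega\mapsto\mu_\omega\in\mathcal M$. For $\mathfrak m\in\mathcal M$, $\tau_g\mathfrak m(A):=\mathfrak m(\tau_gA)$ for all Borel $A$. $\Delta:=\{\sum_{i=1}^dt_iv^i:0\le t_i<1\}$, where $v^1,\dots,v^d$ are the columns of $V$. The intensity is $m:=\ell(\Delta)^{-1}\int_\Omega d\mathbb P(\omega)\,\mu_\omega(\Delta)$, with $\ell$ Lebesgue measure (finite under the moment assumption). The rescaled measure is $\mu^\varepsilon_\omega(A):=\varepsilon^d\mu_\omega(\varepsilon^{-1}A)$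 for Borel $A$, $\varepsilon>0$. *)

(* Defs.v *)
From HB Require Import structures.
From mathcomp Require Import all_boot all_order all_algebra.
From mathcomp Require Import all_classical all_reals all_analysis measurable_realfun.

Set Implicit Arguments.
Unset Strict Implicit.
Unset Printing Implicit Defensive.
Import Order.TTheory GRing.Theory Num.Theory.
Import numFieldNormedType.Exports.

Local Open Scope classical_set_scope.
Local Open Scope ring_scope.

(* R^d is 'cV[R]_d.  The library gives it the entrywise (sup-norm) topology,
   i.e. the Euclidean one; we add the Borel sigma-algebra of that topology. *)
HB.instance Definition _ (R : realType) (m n : nat) :=
  @isMeasurable.Build (sigma_display (@open 'M[R]_(m, n))) 'M[R]_(m, n)
    <<s @open 'M[R]_(m, n) >>
    (@sigma_algebra0 _ setT _) (@sigma_algebraC _ _)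
    (@sigma_algebra_bigcup _ setT _).

Section borel_cV.
Context {R : realType}.

Lemma measurable_coord m n (i : 'I_m) (j : 'I_n) :
  measurable_fun setT (fun x : 'M[R]_(m, n) => x i j).
Proof.
apply: (measurability _ (RGenOpens.measurableE R)) => //.
move=> _ [_ [a [b ->]] <-]; rewrite setTI.
apply: sub_sigma_algebra.
have /continuousP : continuous (fun x : 'M[R]_(m, n) => x i j : R).
  exact: coord_continuous.
by apply; exact: interval_open.
Qed.

Lemma measurable_fun_cV d (T : measurableType d) n (f : T -> 'cV[R]_n) :
  (forall i, measurable_fun setT (fun t => f t i 0)) -> measurable_fun setT f.
Proof.
move=> mf; apply: (measurability (@open 'cV[R]_n)) => //.
move=> _ [U oU <-]; rewrite setTI.
pose B (qk : 'cV[rat]_n * nat) : set 'cV[R]_n :=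
  [set x | forall i, `|ratr (qk.1 i 0) - x i 0| < qk.2.+1%:R^-1].
pose F qk := if pselect (B qk `<=` U) then f @^-1` B qk else set0.
have -> : f @^-1` U = \bigcup_qk F qk.
  apply/seteqP; split=> [t Uft|t [qk _]]; rewrite /F; last first.
    by case: pselect => //= BU /BU.
  have /nbhs_ballP[e /= e0 eU] : nbhs (f t) U by exact: open_nbhs_nbhs.
  have [k ke] : exists k : nat, k.+1%:R^-1 < e / 2.
    have e20 : 0 < e / 2 by rewrite divr_gt0.
    have [N _ /(_ N) /=] := near_infty_natSinv_lt (PosNum e20).
    by move=> /(_ (leqnn _)) ?; exists N.
  have /all_sig[q qP] : forall i : 'I_n,
      {q : rat | `|ratr q - f t i 0| < k.+1%:R^-1}.
    move=> i; apply: cid.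
    have [//|q] := @rat_in_itvoo R (f t i 0 - k.+1%:R^-1) (f t i 0 + k.+1%:R^-1).
      by rewrite ltrD2l gtrN.
    by rewrite in_itv/= => qi; exists q; rewrite ltr_distl.
  exists (\col_i q i, k) => //=; rewrite /F; case: pselect => /= [_ i|notBU].
    by rewrite mxE; exact: qP.
  exfalso; apply: notBU => x xB; apply: eU; split => // i j; rewrite (ord1 j).
  rewrite -ball_normE /= -(subrKA (ratr (q i))) (le_lt_trans (ler_normD _ _))//.
  rewrite [e]splitr ltrD//; first by rewrite distrC (lt_trans (qP i)).
  by have /= := xB i; rewrite mxE => /lt_trans; exact.
apply: countable_bigcupT_measurable => [|qk]; first exact: countableP.
rewrite /F; case: pselect => //= _.
rewrite (_ : f @^-1` _ = \bigcap_(i in [set: 'I_n])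
    (fun t => f t i 0) @^-1` `]ratr (qk.1 i 0) - qk.2.+1%:R^-1,
                              ratr (qk.1 i 0) + qk.2.+1%:R^-1[%classic).
  apply: fin_bigcap_measurable => // i _; rewrite -[X in measurable X]setTI.
  exact: mf.
apply/seteqP; split => [t Bt i _|t Bt i] /=.
  by rewrite in_itv/= -ltr_distlC; exact: Bt.
by have := Bt i I; rewrite /= in_itv/= -ltr_distlC.
Qed.

Lemma measurable_int : measurable [set x : R | x \is a Num.int].
Proof.
rewrite (_ : [set _ | _] = \bigcup_(z : int) [set z%:~R]); last first.
  apply/seteqP; split => [x /= /intrP[z ->]|x [z _ ->]/=]; first by exists z.
  exact: intr_int.
by apply: countable_bigcupT_measurable; first exact: countableP.
Qed.

End borel_cV.

Section lebesgue_cV.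
Context {R : realType}.

Definition cons_cV n (p : R * 'cV[R]_n) : 'cV[R]_n.+1 := col_mx p.1%:M p.2.

Definition uncons_cV n (x : 'cV[R]_n.+1) : R * 'cV[R]_n :=
  (x ord0 0, \col_i x (lift ord0 i) 0).

Lemma cons_cV0 n (p : R * 'cV[R]_n) : cons_cV p ord0 0 = p.1.
Proof.
rewrite (_ : ord0 = lshift n (ord0 : 'I_1)); last exact: val_inj.
by rewrite [LHS]col_mxEu mxE mulr1n.
Qed.

Lemma cons_cVS n (p : R * 'cV[R]_n) i : cons_cV p (lift ord0 i) 0 = p.2 i 0.
Proof.
rewrite (_ : lift ord0 i = rshift 1 i); last exact: val_inj.
by rewrite [LHS]col_mxEd.
Qed.

Lemma cons_cVK n : cancel (@cons_cV n) (@uncons_cV n).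
Proof.
move=> [x y]; rewrite /uncons_cV cons_cV0; congr pair.
by apply/colP => i; rewrite mxE cons_cVS.
Qed.

Lemma measurable_cons_cV n : measurable_fun setT (@cons_cV n).
Proof.
apply: measurable_fun_cV => i; have [j ->|->] := unliftP ord0 i.
  under eq_fun do rewrite cons_cVS.
  exact: measurableT_comp (measurable_coord j 0) measurable_snd.
under eq_fun do rewrite cons_cV0.
exact: measurable_fst.
Qed.

Lemma measurable_uncons_cV n : measurable_fun setT (@uncons_cV n).
Proof.
apply: measurable_fun_pair; first exact: measurable_coord.
apply: measurable_fun_cV => i.
by under eq_fun do rewrite mxE; exact: measurable_coord.
Qed.

Section step.
Variables (n : nat) (mu : {sigma_finite_measure set 'cV[R]_n -> \bar R}).

Definition lebesgue_cons : set 'cV[R]_n.+1 -> \bar R :=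
  pushforward (lebesgue_measure \x mu)%E (@cons_cV n).

Let lebesgue_cons0 : lebesgue_cons set0 = 0%E.
Proof. apply: measure0; exact: measurable_cons_cV. Qed.

Let lebesgue_cons_ge0 A : (0 <= lebesgue_cons A)%E.
Proof. apply: measure_ge0; exact: measurable_cons_cV. Qed.

Let lebesgue_cons_sigma_additive : semi_sigma_additive lebesgue_cons.
Proof. apply: measure_semi_sigma_additive; exact: measurable_cons_cV. Qed.

HB.instance Definition _ := isMeasure.Build _ _ _ lebesgue_cons
  lebesgue_cons0 lebesgue_cons_ge0 lebesgue_cons_sigma_additive.

Let sigma_finite_lebesgue_cons : sigma_finite setT lebesgue_cons.
Proof.
have /sigma_finiteP[F [FT ndF Foo]] := sigma_finiteT (@lebesgue_measure R).
have /sigma_finiteP[G [GT ndG Goo]] := sigma_finiteT mu.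
exists (fun k => @uncons_cV n @^-1` (F k `*` G k)).
  apply/esym; rewrite -subTset => x _.
  have [k _ Fk] : (\bigcup_k F k) (uncons_cV x).1 by rewrite -FT.
  have [l _ Gl] : (\bigcup_k G k) (uncons_cV x).2 by rewrite -GT.
  exists (maxn k l) => //; split.
    by move: Fk; exact/subsetPset/ndF/leq_maxl.
  by move: Gl; exact/subsetPset/ndG/leq_maxr.
move=> k; have [mF Fk] := Foo k; have [mG Gk] := Goo k; split.
  rewrite -[X in measurable X]setTI; apply: measurable_uncons_cV => //.
  exact: measurableX.
rewrite /lebesgue_cons /pushforward -comp_preimage.
rewrite (_ : _ \o _ = id); last by apply/funext => p; exact: cons_cVK.
by rewrite preimage_id product_measure1E// lte_mul_pinfty// ge0_fin_numE.
Qed.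

HB.instance Definition _ := Measure_isSigmaFinite.Build _ _ _ lebesgue_cons
  sigma_finite_lebesgue_cons.

End step.

(* Lebesgue measure on R^n as the n-fold product of the one on R. *)
Fixpoint lebesgue_cV n : {sigma_finite_measure set 'cV[R]_n -> \bar R} :=
  if n is n'.+1 then lebesgue_cons (lebesgue_cV n') else \d_(0 : 'cV[R]_0).

Lemma lebesgue_cV_box n (a b : 'I_n -> R) : (forall i, a i <= b i) ->
  lebesgue_cV n [set x | forall i, x i 0 \in `[a i, b i]] =
  (\prod_i (b i - a i))%:E.
Proof.
have mbox k (c e : 'I_k -> R) :
    measurable [set x : 'cV[R]_k | forall i, x i 0 \in `[c i, e i]].
  rewrite (_ : mkset _ = \bigcap_(i in [set: 'I_k])
      (fun x : 'cV[R]_k => x i 0) @^-1` `[c i, e i]%classic).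
    apply: fin_bigcap_measurable => // i _; rewrite -[X in measurable X]setTI.
    exact: measurable_coord.
  by apply/seteqP; split=> x /= xP i => [_|]; exact: xP.
elim: n a b => [|n IHn] a b ab /=.
  by rewrite big_ord0 diracE mem_set// => -[].
rewrite /lebesgue_cons /pushforward (_ : _ @^-1` _ =
    `[a ord0, b ord0]%classic `*`
    [set x : 'cV[R]_n | forall i, x i 0 \in `[a (lift ord0 i), b (lift ord0 i)]]).
  rewrite product_measure1E// IHn//= lebesgue_measure_itv/= lte_fin.
  rewrite big_ord_recl EFinM; congr (_ * _)%E.
  by case: ltgtP (ab ord0) => // ->; rewrite subrr.
apply/seteqP; split => [p /= pP|p /= [p1 p2] i].
  split; first by have := pP ord0; rewrite cons_cV0.
  by move=> i; have := pP (lift ord0 i); rewrite cons_cVS.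
by have [j ->|->] := unliftP ord0 i; rewrite ?cons_cV0 ?cons_cVS.
Qed.

End lebesgue_cV.

Arguments lebesgue_cV R n : clear implicits.

Section random_measures.
Context {R : realType} (d : nat).
Implicit Type nu : set 'cV[R]_d -> \bar R.

Definition euclidean_norm (x : 'cV[R]_d) : R := Num.sqrt (\sum_i x i 0 ^+ 2).

Definition locally_finite nu :=
  forall x : 'cV[R]_d, exists2 U, open_nbhs x U & (nu U < +oo)%E.

(* The space of locally finite Borel measures.  A measure is here a function
   on all sets, so two elements that agree on the Borel sets may differ; they
   are then indistinguishable for the vague topology and its Borel sets. *)
Record lfmeasure := LFMeasure {
  lfmeasure_val :> {measure set 'cV[R]_d -> \bar R} ;
  lfmeasureP : locally_finite lfmeasure_val }.

HB.instance Definition _ := gen_eqMixin lfmeasure.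
HB.instance Definition _ := gen_choiceMixin lfmeasure.

Lemma locally_finite_mzero : locally_finite (@mzero _ 'cV[R]_d R).
Proof.
move=> x; exists setT; last by rewrite /mzero ltry.
by split=> //; exact: openT.
Qed.

HB.instance Definition _ :=
  isPointed.Build lfmeasure (LFMeasure locally_finite_mzero).

Definition continuous_compact_support :=
  {f : 'cV[R]_d -> R | continuous f /\ compact (closure [set x | f x != 0])}.

Definition vague_eval (nu : lfmeasure) :
  prod_topology (fun _ : continuous_compact_support => R) :=
  fun f => \int[nu]_x sval f x.

(* The vague topology: the coarsest one for which nu |-> \int f dnu is
   continuous for every continuous compactly supported f. *)
HB.instance Definition _ :=
  Topological.copy lfmeasure (initial_topology vague_eval).

HB.instance Definition _ :=
  @isMeasurable.Build (sigma_display (@open lfmeasure)) lfmeasure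
    <<s @open lfmeasure >>
    (@sigma_algebra0 _ setT _) (@sigma_algebraC _ _)
    (@sigma_algebra_bigcup _ setT _).

(* Meaningful for eps > 0 only, in which case it is a measure (below). *)
Definition rescale (eps : R) nu (A : set 'cV[R]_d) : \bar R :=
  ((eps ^+ d)%:E * nu [set eps^-1 *: x | x in A])%E.

Section rescale_measure.
Variables (eps : {posnum R}) (mu : {measure set 'cV[R]_d -> \bar R}).

Let image_scale (A : set 'cV[R]_d) :
  [set eps%:num^-1 *: x | x in A] = (fun x => eps%:num *: x) @^-1` A.
Proof.
apply/seteqP; split => [_ [x Ax <-]|x Ax] /=.
  by rewrite scalerA divff// scale1r.
by exists (eps%:num *: x) => //; rewrite scalerA mulVf// scale1r.
Qed.

Let measurable_scale :
  measurable_fun setT (fun x : 'cV[R]_d => eps%:num *: x).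
Proof.
apply: measurable_fun_cV => i; under eq_fun do rewrite mxE.
by apply: measurable_funM => //; exact: measurable_coord.
Qed.

Let rescale0 : rescale eps%:num mu set0 = 0%E.
Proof. by rewrite /rescale image_set0 measure0 mule0. Qed.

Let rescale_ge0 A : (0 <= rescale eps%:num mu A)%E.
Proof. by rewrite /rescale mule_ge0// lee_fin exprn_ge0. Qed.

Let rescale_sigma_additive : semi_sigma_additive (rescale eps%:num mu).
Proof.
move=> F mF tF mUF.
under eq_fun => n.
  rewrite -ge0_sume_distrr//.
  over.
rewrite /rescale; apply: cvgeZl => //; rewrite image_bigcup.
apply: measure_semi_sigma_additive.
- move=> n; rewrite image_scale -[X in measurable X]setTI.
  exact: measurable_scale.
- apply/trivIsetP => i j _ _ ij; rewrite !image_scale -preimage_setI.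
  by move/trivIsetP : tF => /(_ _ _ I I ij) ->; rewrite preimage_set0.
- rewrite -image_bigcup image_scale -[X in measurable X]setTI.
  exact: measurable_scale.
Qed.

HB.instance Definition _ := isMeasure.Build _ _ _ (rescale eps%:num mu)
  rescale0 rescale_ge0 rescale_sigma_additive.

End rescale_measure.

(* Z^d is represented as a subset of R^d, so that both groups acting are
   subsets G of R^d, added as vectors of R^d.  For G = Z^d the trace of the Borel
   sigma-algebra is the discrete one. *)
Definition integer_vectors : set 'cV[R]_d :=
  [set g | forall i, g i 0 \is a Num.int].

Lemma measurable_integer_vectors : measurable integer_vectors.
Proof.
rewrite (_ : integer_vectors = \bigcap_(i in [set: 'I_d])
    (fun x : 'cV[R]_d => x i 0) @^-1` [set z | z \is a Num.int]).
  apply: fin_bigcap_measurable => // i _; rewrite -[X in measurable X]setTI.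
  by apply: measurable_coord => //; exact: measurable_int.
by apply/seteqP; split=> x /= xP i => [_|]; exact: xP.
Qed.

Section translations.
Variable V : 'M[R]_d.

Definition tau (g x : 'cV[R]_d) := x + V *m g.

Definition tau_measure (g : 'cV[R]_d) nu (A : set 'cV[R]_d) : \bar R :=
  nu (tau g @` A).

Definition cell : set 'cV[R]_d :=
  [set \sum_i t i *: col i V | t in
    [set t : 'I_d -> R | forall i, 0 <= t i < 1]].

End translations.

Section actions.
Context d' (Omega : measurableType d') (P : probability Omega R).
Variables (G : set 'cV[R]_d) (theta : 'cV[R]_d -> Omega -> Omega).

(* The values theta g for g outside G are unconstrained and never used. *)
Definition measurable_action :=
  [/\ theta 0 = id,
      forall g g', G g -> G g' -> theta g \o theta g' = theta (g + g') &
      measurable_fun (G `*` setT) (fun p => theta p.1 p.2)].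

Definition stationary := forall g, G g ->
  forall A, measurable A -> P (theta g @^-1` A) = P A.

Definition invariant_set (A : set Omega) :=
  measurable A /\ forall g, G g -> theta g @` A = A.

Definition ergodic := forall A, invariant_set A -> P A = 0%E \/ P A = 1%E.

Definition intensity (V : 'M[R]_d) (mu : Omega -> lfmeasure) : \bar R :=
  ((fine (lebesgue_cV R d (cell V)))^-1%:E * \int[P]_w mu w (cell V))%E.

End actions.

End random_measures.

Arguments lfmeasure R d : clear implicits.
Arguments integer_vectors R d : clear implicits.

(* Main.v *)
Require Import Defs.
From HB Require Import structures.
From mathcomp Require Import all_boot all_order all_algebra.
From mathcomp Require Import all_classical all_reals all_analysis measurable_realfun.
From mathcomp Require Import ring lra zify.

Set Implicit Arguments.
Unset Strict Implicit.
Unset Printing Implicit Defensive.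
Import Order.TTheory GRing.Theory Num.Theory.
Import numFieldNormedType.Exports.

Local Open Scope classical_set_scope.
Local Open Scope ring_scope.

(** The limit for boxes is obtained one lattice direction at a time. In lattice
   coordinates, let Q be a box with integer vertices and 0 in its interior, and
   let F(j, n) be n^-j times the mass of the box obtained from the unit cell by
   replacing its first j sides by those of n Q. Then F(j+1, n) is a combination
   of Birkhoff averages of F(j, n) along the j-th generator, of length
   proportional to n. The integral forms of Birkhoff's theorem for a single
   map, i.e. [int limsup avg <= int g] and [int g <= int liminf avg], which are
   consequences of Garsia's maximal ergodic lemma, stay true for averages of a
   moving sequence that is dominated by an integrable function. The domination
   comes from the moment assumption: tails [P (g > t) = O(t^-alpha)], alpha > 1,
   are stable under the maximal function. Hence the integrals of the limsup and
   of the liminf of F(d, n) are bounded above and below by [vol Q * E mu(cell)];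
   both functions are exactly invariant because 0 is interior to Q, so by
   ergodicity they equal this constant on an invariant set of full measure.

   On this set everything is deterministic. Inclusion-exclusion extends the
   limit from such boxes to all tiles of a grid and gives a growth bound
   [mu^eps (B(r)) <= C r^d], so Riemann sums approximate the integrals of phi
   uniformly in eps, the tail being controlled by the dyadic sum of
   [vtheta (kappa 2^j) 2^(j d)], which is finite because vtheta is monotone and
   [r^(d-1) vtheta r] is integrable. *)

(** * Ergodic averages of one measure-preserving map *)

(** The generators need not act ergodically one by one, so the Birkhoff limit along one direction is
    a random variable and pointwise limits cannot be iterated. Integral inequalities can: each
    direction passes them on to the next, and ergodicity of the whole action is called on only once,
    for functions that are monotone along it. With G = R^d only integer translations are averaged
    over, while invariance is demanded under uncountably many g; it therefore has to hold at every
    point and for every g, not almost surely for each g. The obstacle in the domination is that the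
    maximal function of an integrable function need not be integrable, and d maximal functions are
    stacked; a tail rate that every one of them preserves is what an induction over the directions
    can carry. On the deterministic side, one growth constant serves all rescaled measures with eps
    <= 1 and the limit measure together, so one grid can be chosen before eps. *)

Section limsup.
Local Open Scope ereal_scope.
Context {R : realType}.
Implicit Types (u v : (\bar R)^nat) (l : \bar R).

Lemma limn_esup_inf u : limn_esup u = ereal_inf (range (esups u)).
Proof. by rewrite limn_esup_lim; apply/cvg_lim => //; exact: cvg_esups_inf. Qed.

Lemma limn_einf_ereal_sup u : limn_einf u = ereal_sup (range (einfs u)).
Proof. by rewrite limn_einf_lim; apply/cvg_lim => //; exact: cvg_einfs_sup. Qed.

Lemma limn_esup_lt u l : limn_esup u < l -> \forall n \near \oo, u n < l.
Proof.
rewrite limn_esup_inf => /ereal_inf_lt[_ [N _ <-]] uN.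
exists N => // n /= Nn; apply: le_lt_trans uN.
by apply: ereal_sup_ubound; exists n.
Qed.

Lemma limn_einf_gt u l : l < limn_einf u -> \forall n \near \oo, l < u n.
Proof.
rewrite limn_einf_ereal_sup => /ereal_sup_gt[_ [N _ <-]] uN.
exists N => // n /= Nn; apply: (lt_le_trans uN).
by apply: ereal_inf_lbound; exists n.
Qed.

Lemma limn_esup_le_near u l : (\forall n \near \oo, u n <= l) -> limn_esup u <= l.
Proof.
move=> [N _ uN]; rewrite limn_esup_inf; apply: ge_ereal_inf.
exists (esups u N); first by exists N.
by apply: ge_ereal_sup => _ [n /= Nn <-]; exact: uN.
Qed.

Lemma limn_einf_ge_near u l : (\forall n \near \oo, l <= u n) -> l <= limn_einf u.
Proof.
move=> [N _ uN]; rewrite limn_einf_ereal_sup; apply: le_ereal_sup_tmp.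
exists (einfs u N); first by exists N.
by apply: le_ereal_inf_tmp => _ [n /= Nn <-]; exact: uN.
Qed.

(** Thresholds range over real numbers only, so later comparisons of upper limits need no case
    analysis on infinite values. *)
Lemma lee_gtP (x y : \bar R) : (forall r : R, y < r%:E -> x <= r%:E) -> x <= y.
Proof.
case: y => [y| |] H; [|by rewrite leey|].
  by apply/lee_addgt0Pr => e e0; rewrite -EFinD; apply: H; rewrite lte_fin ltrDl.
case: x H => [x| |] H //.
- by have := H (x - 1)%R (ltNyr _); rewrite lee_fin leNgt gtrBl ltr01.
- by have := H 0%R (ltNyr _).
Qed.

Lemma gee_ltP (x y : \bar R) : (forall r : R, r%:E < y -> r%:E <= x) -> y <= x.
Proof.
move=> H; rewrite -leeN2; apply: lee_gtP => r.
by rewrite lteNl leeNl -EFinN; exact: H.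
Qed.

Lemma le_limn_esup u v : (\forall n \near \oo, u n <= v n) -> limn_esup u <= limn_esup v.
Proof.
move=> uv; apply: lee_gtP => r /limn_esup_lt vr; apply: limn_esup_le_near.
by apply: filterS2 uv vr => n un /ltW; exact: le_trans.
Qed.

Lemma le_limn_einf u v : (\forall n \near \oo, u n <= v n) -> limn_einf u <= limn_einf v.
Proof.
move=> uv; apply: gee_ltP => r /limn_einf_gt vr; apply: limn_einf_ge_near.
by apply: filterS2 uv vr => n un /ltW H; exact: le_trans un.
Qed.

End limsup.

(** * Garsia's maximal ergodic lemma *)

Section maximal_lemma.
Local Open Scope ereal_scope.
Context d (T : measurableType d) (R : realType) (P : probability T R).
Variables (S : T -> T) (mS : measurable_fun setT S).
Hypothesis PS : forall A, measurable A -> P (S @^-1` A) = P A.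

Lemma measurable_iter k : measurable_fun setT (iter k S).
Proof.
elim: k => [|k IH]; first exact: measurable_id.
exact: measurableT_comp.
Qed.

Lemma ge0_integral_preserving (f : T -> \bar R) : measurable_fun setT f ->
  (forall x, 0 <= f x) -> \int[P]_x f (S x) = \int[P]_x f x.
Proof.
move=> mf f0; rewrite -[LHS](@ge0_integral_pushforward _ _ _ _ R S mS P setT)//.
apply: eq_measure_integral => A mA _; exact: PS.
Qed.

Lemma ge0_integral_preserving_iter k (f : T -> \bar R) : measurable_fun setT f ->
  (forall x, 0 <= f x) -> \int[P]_x f (iter k S x) = \int[P]_x f x.
Proof.
move=> mf f0; elim: k => // k IH; rewrite -[RHS]IH.
under eq_integral do rewrite iterSr.
apply: (ge0_integral_preserving (f := fun x => f (iter k S x))) => //.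
exact: measurableT_comp mf (measurable_iter k).
Qed.

Lemma integrable_preserving (f : T -> R) : P.-integrable setT (EFin \o f) ->
  P.-integrable setT (EFin \o (f \o S)).
Proof.
move=> /integrableP[mf fi]; apply/integrableP; split.
  exact: measurableT_comp mf mS.
rewrite (ge0_integral_preserving (f := fun x => `|(f x)%:E|))//.
exact: measurableT_comp.
Qed.

Lemma integral_preserving (f : T -> R) : P.-integrable setT (EFin \o f) ->
  \int[P]_x (f (S x))%:E = \int[P]_x (f x)%:E.
Proof.
move=> fi; rewrite -[LHS](@integral_pushforward _ _ _ _ _ S mS P setT (EFin \o f))//.
- apply: eq_measure_integral => A mA _; exact: PS.
- by case/integrableP : fi.
- exact: integrable_preserving fi.
Qed.

(** The maximum of the Birkhoff sums of [h] of length at most [N], the empty sum included. The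
    recursion is the identity on which Garsia's argument rests. *)
Fixpoint maxsum (h : T -> R) N : T -> R :=
  if N is N'.+1 then fun x => Num.max 0%R (h x + maxsum h N' (S x))%R
  else fun=> 0%R.

Lemma maxsum_ge0 h N x : (0 <= maxsum h N x)%R.
Proof. by case: N => //= N; rewrite le_max lexx. Qed.

Lemma maxsum_nd h N x : (maxsum h N x <= maxsum h N.+1 x)%R.
Proof.
elim: N x => [|N IH] x; first by rewrite maxsum_ge0.
by rewrite [leLHS]/= [leRHS]/= ge_max !le_max lexx /= lerD2l IH orbT.
Qed.

Lemma sum_le_maxsum h N x n : (n <= N)%N ->
  (\sum_(k < n) h (iter k S x) <= maxsum h N x)%R.
Proof.
elim: N n x => [|N IH] [|n] x // nN; rewrite ?big_ord0 ?maxsum_ge0//.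
rewrite big_ord_recl /= le_max lerD2l; apply/orP; right.
apply: le_trans (IH n (S x) nN); rewrite le_eqVlt; apply/orP; left; apply/eqP.
by apply: eq_bigr => i _; rewrite -iterSr.
Qed.

Lemma maxsum_gt0 h N x : (0 < maxsum h N x)%R ->
  exists n, (n < N)%N /\ (0 < \sum_(k < n.+1) h (iter k S x))%R.
Proof.
move=> M0.
suff : exists n, (n <= N)%N /\ maxsum h N x = (\sum_(k < n) h (iter k S x))%R.
  move=> [[|n] [nN E]]; first by move: M0; rewrite E big_ord0 ltxx.
  by exists n; rewrite -E.
elim: N x {M0} => [|N IH] x; first by exists 0%N; rewrite big_ord0.
have [n [nN E]] := IH (S x).
have [H|H] := leP 0%R (h x + maxsum h N (S x))%R.
  exists n.+1; split => //=; rewrite max_r// E big_ord_recl; congr (_ + _)%R.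
  by apply: eq_bigr => i _; rewrite -iterSr.
by exists 0%N; split => //=; rewrite max_l ?big_ord0// ltW.
Qed.

Lemma integrable_maxsum h N : P.-integrable setT (EFin \o h) ->
  P.-integrable setT (EFin \o maxsum h N).
Proof.
move=> hi; elim: N => [|N IH]; first exact: integrable0.
have /= := integrableD measurableT hi (integrable_preserving IH).
move=> i1; apply: le_integrable i1 => //.
  apply/measurable_EFinP => /=; apply: measurable_maxr => //.
  apply: measurable_funD; first by apply/measurable_EFinP; case/integrableP : hi.
  by apply/measurable_EFinP; case/integrableP : (integrable_preserving IH).
move=> x _ /=; rewrite lee_fin; have [H|H] := leP 0%R (h x + maxsum h N (S x))%R.
  by rewrite ger0_norm.
by rewrite normr0.
Qed.

Definition possum (h : T -> R) := [set x | exists n, (0 < \sum_(k < n.+1) h (iter k S x))%R].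

Lemma measurable_possum h : measurable_fun setT h -> measurable (possum h).
Proof.
move=> mh; rewrite (_ : possum h =
    \bigcup_n [set x | (0 < \sum_(k < n.+1) h (iter k S x))%R]).
  apply: bigcupT_measurable => n.
  rewrite -[X in measurable X]setTI.
  have m : measurable_fun setT (fun x => \sum_(k < n.+1) h (iter k S x))%R.
    by apply: measurable_sum => i; exact: measurableT_comp mh (measurable_iter _).
  rewrite (_ : [set x | _] = (fun x => \sum_(k < n.+1) h (iter k S x))%R @^-1` `]0%R, +oo[).
    exact: m.
  by apply/seteqP; split=> x /=; rewrite in_itv/= andbT.
by apply/seteqP; split=> [x [n]|x [n _]]; exists n.
Qed.

(** Let M_N be [maxsum h N]. Where M_(N+1) is positive it equals h plus M_N after S, and M_N <=
    M_(N+1) bounds h below by the difference of M_N and M_N after S; elsewhere M_N = 0 and this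
    difference is nonpositive. It integrates to 0 by invariance, and N tends to infinity by
    dominated convergence. *)
Lemma maximal_ergodic h : P.-integrable setT (EFin \o h) ->
  0 <= \int[P]_(x in possum h) (h x)%:E.
Proof.
move=> hi.
have mh : measurable_fun setT h by apply/measurable_EFinP; case/integrableP : hi.
pose B N := [set x | (0 < maxsum h N.+1 x)%R].
have mB N : measurable (B N).
  rewrite -[X in measurable X]setTI (_ : B N = maxsum h N.+1 @^-1` `]0%R, +oo[).
    by move: (integrable_maxsum N.+1 hi) => /integrableP[/measurable_EFinP + _]; apply.
  by apply/seteqP; split=> x /=; rewrite in_itv/= andbT.
have BE : possum h = \bigcup_N B N.
  apply/seteqP; split=> [x [n H]|x [n _ /maxsum_gt0[k [_ H]]]]; last by exists k.
  by exists n => //; apply: (lt_le_trans H); exact: sum_le_maxsum.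
have B0 N : 0 <= \int[P]_(x in B N) (h x)%:E.
  have M1 := integrable_maxsum N hi; have M2 := integrable_preserving M1.
  have <- : \int[P]_x ((maxsum h N x)%:E - (maxsum h N (S x))%:E) = 0.
    rewrite (integralB measurableT M1 M2) (integral_preserving M1) subee//.
    exact: integrable_fin_num.
  rewrite [leRHS]integral_mkcond; apply: le_integral => //.
  - exact: (integrableB measurableT M1 M2).
  - apply/(integrable_mkcond (EFin \o h) (mB N)).1.
    exact: (integrableS measurableT _ _ hi).
  move=> x _; rewrite /patch; case: ifPn => [xB|]; last first.
    move=> /negP; rewrite in_setE/B/= => /negP; rewrite -leNgt => H.
    have E : maxsum h N x = 0%R.
      by apply/eqP; rewrite eq_le maxsum_ge0 andbT (le_trans (maxsum_nd h N x)).
    by rewrite E add0e lee_fin oppr_le0 maxsum_ge0.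
  have : (0 < maxsum h N.+1 x)%R by move: xB; rewrite in_setE.
  rewrite -EFinB lee_fin lerBlDr => H.
  apply: (le_trans (maxsum_nd h N x)); move: H => /=.
  by case: (leP 0%R (h x + maxsum h N (S x))%R) => //; rewrite ltxx.
have cv : \int[P]_x ((EFin \o h) \_ (B N)) x @[N --> \oo] -->
    \int[P]_x ((EFin \o h) \_ (possum h)) x.
  apply: (@dominated_cvg _ _ _ P setT measurableT _ _ (fun x => `|(h x)%:E|)) => //.
  - by move=> N; apply/(measurable_restrictT _ (mB N)).1; apply: measurable_funTS; apply/measurable_EFinP.
  - move=> x _; apply: cvg_near_cst; have [xB|xB] := pselect (possum h x); last first.
      apply: nearW => N; rewrite /patch memNset//= ?memNset//.
      by move=> BN; apply: xB; rewrite BE; exists N.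
    move: (xB) => [n H]; exists n => // N /= nN; rewrite /patch mem_set/= ?mem_set//.
    by apply: (lt_le_trans H); apply: sum_le_maxsum.
  - exact: integrable_abse hi.
  - by move=> N x _; rewrite /patch; case: ifPn => //; rewrite abse0 abse_ge0.
rewrite [leRHS]integral_mkcond -(cvg_lim _ cv)//.
apply: lime_ge; first by apply/cvg_ex; eexists; exact: cv.
by apply: nearW => N; rewrite -integral_mkcond.
Qed.

End maximal_lemma.

(** * Upper integral bound for the limsup of Birkhoff averages *)

Section ergodic_averages.
Local Open Scope ereal_scope.
Context d (T : measurableType d) (R : realType) (P : probability T R).
Variables (S : T -> T) (mS : measurable_fun setT S).
Hypothesis PS : forall A, measurable A -> P (S @^-1` A) = P A.

Definition avg n (g : T -> \bar R) x :=
  (n.+1%:R^-1)%:E * \sum_(k < n.+1) g (iter k S x).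

Lemma measurable_avg n g : measurable_fun setT g -> measurable_fun setT (avg n g).
Proof.
move=> mg; apply: emeasurable_funM => //; apply: emeasurable_sum => k.
exact: measurableT_comp mg (measurable_iter mS k).
Qed.

Lemma avg_ge0 n g x : (forall y, 0 <= g y) -> 0 <= avg n g x.
Proof. by move=> g0; rewrite mule_ge0 ?lee_fin// sume_ge0. Qed.

Lemma le_avg n f g x : (forall y, f y <= g y) -> avg n f x <= avg n g x.
Proof. by move=> fg; rewrite lee_wpmul2l ?lee_fin// lee_sum. Qed.

Lemma avg_EFin n (f : T -> R) x :
  avg n (EFin \o f) x = (n.+1%:R^-1 * \sum_(k < n.+1) f (iter k S x))%:E.
Proof. by rewrite /avg sumEFin EFinM. Qed.

Lemma avg_shift n (f : T -> R) x : (n.+1%:R * (n.+1%:R^-1 * \sum_(k < n.+1) f (iter k S (S x))) =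
  n.+2%:R * (n.+2%:R^-1 * \sum_(k < n.+2) f (iter k S x)) - f x)%R.
Proof.
rewrite !mulrA !divff ?pnatr_eq0// !mul1r [in RHS]big_ord_recl /=.
rewrite [in RHS]addrAC subrr add0r.
by apply: eq_bigr => i _; rewrite -iterSr.
Qed.

(** The n+1 terms starting at S x are the n+2 terms starting at x without the first, which is
    nonnegative, and (n+2)/(n+1) tends to 1. This one inequality holds at every point, also when the
    limit is infinite. *)
Lemma limn_esup_avg_shift (f : T -> R) x : (forall y, 0 <= f y)%R ->
  limn_esup (fun n => avg n (EFin \o f) (S x)) <= limn_esup (fun n => avg n (EFin \o f) x).
Proof.
move=> f0; apply: lee_gtP => r fr.
have avg0 n : (0 <= n.+1%:R^-1 * \sum_(k < n.+1) f (iter k S x))%R.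
  by rewrite mulr_ge0// sumr_ge0.
have [r' fr' r'r] : exists2 r' : R, limn_esup (fun n => avg n (EFin \o f) x) < r'%:E & (r' < r)%R.
  move: fr; case E : (limn_esup _) => [s| |]//=.
    by rewrite lte_fin => sr; exists ((s + r) / 2)%R; rewrite ?lte_fin midf_lt.
  by exists (r - 1)%R; rewrite ?ltNyr// gtrBl.
apply: limn_esup_le_near.
have /limn_esup_lt [N _ H] := fr'.
have r'0 : (0 <= r')%R.
  have := H N (leqnn _); rewrite /= avg_EFin lte_fin => /ltW; exact: le_trans.
have r'1 : (0 < r' + 1)%R by rewrite ltr_wpDl.
(* With this margin, 1/(n+1) < (r - r')/(r' + 1) yields (n+2) r' <= (n+1) r; the added 1 keeps the
   denominator positive when r' = 0. *)
have rr : (0 < (r - r') / (r' + 1))%R by rewrite divr_gt0 ?subr_gt0.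
have [M _ HM] := near_infty_natSinv_lt (PosNum rr).
exists (N + M)%N => // n /= nNM; rewrite avg_EFin lee_fin.
rewrite -(@ler_pM2l _ n.+1%:R)// avg_shift.
have := H n.+1 (leq_trans (leq_trans (leq_addr _ _) nNM) (leqnSn _)).
rewrite /= avg_EFin lte_fin => Hn.
apply: (@le_trans _ _ (n.+2%:R * r')%R).
  by rewrite lerBlDr; apply: ler_wpDr => //; rewrite ler_pM2l// ltW.
have := HM n (leq_trans (leq_addl _ _) nNM); rewrite /= (ltr_pdivlMr _ _ r'1).
rewrite mulrC ltr_pdivrMr// => Hr.
by rewrite -natr1; lra.
Qed.

Lemma limn_einf_avg_shift (f : T -> R) x : (forall y, 0 <= f y)%R ->
  limn_einf (fun n => avg n (EFin \o f) x) <= limn_einf (fun n => avg n (EFin \o f) (S x)).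
Proof.
move=> f0; apply: gee_ltP => r fr.
have [r' fr' r'r] : exists2 r' : R, r'%:E < limn_einf (fun n => avg n (EFin \o f) x) & (r < r')%R.
  move: fr; case E : (limn_einf _) => [s| |]//=.
    by rewrite lte_fin => sr; exists ((r + s) / 2)%R; rewrite ?lte_fin midf_lt.
  by exists (r + 1)%R; rewrite ?ltry// ltrDl.
apply: limn_einf_ge_near.
have /limn_einf_gt [N _ H] := fr'.
have fx1 : (0 < f x + 1)%R by rewrite ltr_wpDl.
have rr : (0 < (r' - r) / (f x + 1))%R by rewrite divr_gt0 ?subr_gt0.
have [M _ HM] := near_infty_natSinv_lt (PosNum rr).
exists (N + M)%N => // n /= nNM; rewrite avg_EFin lee_fin.
rewrite -(@ler_pM2l _ n.+1%:R)// avg_shift.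
have := H n.+1 (leq_trans (leq_trans (leq_addr _ _) nNM) (leqnSn _)).
rewrite /= avg_EFin lte_fin => Hn.
have a0 : (0 <= n.+2%:R^-1 * \sum_(k < n.+2) f (iter k S x))%R.
  by rewrite mulr_ge0// sumr_ge0.
have := HM n (leq_trans (leq_addl _ _) nNM); rewrite /= (ltr_pdivlMr _ _ fx1).
rewrite mulrC ltr_pdivrMr// => Hr.
move: (n.+2%:R^-1 * _)%R a0 Hn => a a0 Hn.
have : (n.+1%:R * r' <= n.+1%:R * a)%R by rewrite ler_pM2l// ltW.
by rewrite -[n.+2%:R]natr1; lra.
Qed.

Lemma cvg_mine_nat (x : \bar R) : mine x n%:R%:E @[n --> \oo] --> x.
Proof.
case: x => [x| |].
- apply: cvg_near_cst.
  have [N _ HN] := nbhs_infty_ger x; exists N => // n /= /HN xn.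
  by rewrite minEle lee_fin xn.
- rewrite (_ : (fun n => _) = (fun n => n%:R%:E)).
    by apply/cvgeryP; exact: cvgr_idn.
  by apply/funext => n; rewrite minC min_l// leey.
- by apply: cvg_near_cst; apply: nearW => n; rewrite minEle leNye.
Qed.

Lemma mine_nat_nd (x : \bar R) : {homo (fun n => mine x n%:R%:E) : n m / (n <= m)%N >-> n <= m}.
Proof. by move=> n m nm; rewrite le_min ge_min lexx /= ge_min lee_fin ler_nat nm orbT. Qed.

Lemma cvg_integral_mine (g : T -> \bar R) : measurable_fun setT g -> (forall x, 0 <= g x) ->
  \int[P]_x mine (g x) n%:R%:E @[n --> \oo] --> \int[P]_x g x.
Proof.
move=> mg g0.
rewrite [X in _ --> X](_ : _ = \int[P]_x limn (fun n => mine (g x) n%:R%:E)).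
  apply: (@cvg_monotone_convergence _ _ _ P setT measurableT
    (fun n x => mine (g x) n%:R%:E)) => //.
  - by move=> n; exact: measurable_mine.
  - by move=> n x _; rewrite le_min g0 lee_fin ler0n.
  - by move=> x _; exact: mine_nat_nd.
by apply: eq_integral => x _; apply/esym/cvg_lim => //; exact: cvg_mine_nat.
Qed.

Lemma measurable_limn_einf (F : nat -> T -> \bar R) :
  (forall n, measurable_fun setT (F n)) ->
  measurable_fun setT (fun x => limn_einf (F ^~ x)).
Proof.
move=> mF; apply: (emeasurable_fun_cvg (fun n x => einfs (F ^~ x) n)) => //.
  by move=> n; exact: measurable_fun_einfs.
by move=> x _; rewrite limn_einf_ereal_sup; exact: cvg_einfs_sup.
Qed.

Lemma limn_einf_ge0 (u : (\bar R)^nat) : (forall n, 0 <= u n) -> 0 <= limn_einf u.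
Proof. by move=> u0; apply: limn_einf_ge_near; apply: nearW. Qed.

Lemma limn_esup_ge0 (u : (\bar R)^nat) : (forall n, 0 <= u n) -> 0 <= limn_esup u.
Proof. by move=> u0; apply: le_trans (limn_einf_sup _); exact: limn_einf_ge0. Qed.

(** Let c be the upper limit cut at K, which makes it integrable. It does not increase along orbits
    and some average of f exceeds c(x) - e, so f - c + e has a positive Birkhoff sum at every point;
    the maximal lemma then makes its integral nonnegative. *)
Lemma integral_limn_esup_avg_real (f : T -> R) : (forall x, 0 <= f x)%R ->
  P.-integrable setT (EFin \o f) ->
  \int[P]_x limn_esup (fun n => avg n (EFin \o f) x) <= \int[P]_x (f x)%:E.
Proof.
move=> f0 fi.
have mf : measurable_fun setT (EFin \o f) by case/integrableP : fi.
set fb := fun x => limn_esup (fun n => avg n (EFin \o f) x).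
have fb0 x : 0 <= fb x by apply: limn_esup_ge0 => n; apply: avg_ge0 => y; rewrite lee_fin.
have mfb : measurable_fun setT fb.
  by apply: measurable_fun_limn_esup => n; exact: measurable_avg.
rewrite -(cvg_lim _ (cvg_integral_mine mfb fb0))//.
apply: lime_le; first by apply/cvg_ex; eexists; exact: cvg_integral_mine.
apply: nearW => K.
pose c x := fine (mine (fb x) K%:R%:E).
have cE x : mine (fb x) K%:R%:E = (c x)%:E.
  rewrite fineK// fin_numElt; apply/andP; split.
    by apply: (@lt_le_trans _ _ 0); rewrite ?ltNy0// le_min fb0 lee_fin ler0n.
  by rewrite gt_min ltry orbT.
have c0 x : (0 <= c x)%R by rewrite -lee_fin -cE le_min fb0 lee_fin ler0n.
have cK x : (c x <= K%:R)%R by rewrite -lee_fin -cE ge_min lexx orbT.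
have cS x : (c (S x) <= c x)%R.
  rewrite -lee_fin -!cE le_min !ge_min lexx orbT andbT.
  by apply/orP; left; exact: limn_esup_avg_shift.
have cSk x k : (c (iter k S x) <= c x)%R.
  by elim: k => //= k IH; apply: le_trans IH.
have mc : measurable_fun setT (EFin \o c).
  rewrite (_ : _ \o _ = fun x => mine (fb x) K%:R%:E); last by apply/funext => x /=; rewrite cE.
  exact: measurable_mine.
have ci : P.-integrable setT (EFin \o c).
  have := @finite_measure_integrable_cst _ _ _ P setT K%:R measurableT.
  apply: (le_integrable measurableT mc) => x _ /=.
  by rewrite lee_fin !ger0_norm.
under eq_integral do rewrite cE.
apply/lee_addgt0Pr => e e0.
pose h x := (f x - c x + e)%R.
have hi : P.-integrable setT (EFin \o h).
  rewrite (_ : _ \o _ = ((EFin \o f) \- (EFin \o c)) \+ (EFin \o cst e))//.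
  apply: integrableD => //; first exact: integrableB.
  exact: finite_measure_integrable_cst.
have := maximal_ergodic mS PS hi.
have -> : possum S h = setT.
  apply/seteqP; split => // x _.
  have [n Hn] : exists n, (c x - e)%:E < avg n (EFin \o f) x.
    apply: contrapT => /forallNP H.
    have : fb x <= (c x - e)%:E.
      apply: limn_esup_le_near; apply: nearW => n.
      by rewrite leNgt; apply/negP; exact: H.
    apply/negP; rewrite -ltNge; apply: (@lt_le_trans _ _ (c x)%:E).
      by rewrite lte_fin gtrBl.
    by rewrite -cE ge_min lexx.
  exists n; move: Hn; rewrite avg_EFin lte_fin mulrC ltr_pdivlMr//.
  rewrite -subr_gt0 => /lt_le_trans; apply.
  rewrite big_split sumrB /= sumr_const card_ord -addrA lerD2l.
  have : (\sum_(i < n.+1) c (iter i S x) <= n.+1%:R * c x)%R.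
    apply: (@le_trans _ _ (\sum_(i < n.+1) c x)%R); first exact: ler_sum.
    by rewrite sumr_const card_ord mulr_natl.
  by rewrite -[(e *+ _)%R]mulr_natl; lra.
rewrite (_ : \int[P]_x (h x)%:E = \int[P]_x (f x)%:E - \int[P]_x (c x)%:E + e%:E); last first.
  rewrite -(integralB measurableT fi ci) -[X in _ = _ + X]mule1 -(@probability_setT _ _ _ P).
  rewrite -integral_cst// -integralD//; first exact: integrableB.
  exact: finite_measure_integrable_cst.
have fin1 := integrable_fin_num measurableT fi.
have fin2 := integrable_fin_num measurableT ci.
by rewrite addeAC sube_ge0// fin2.
Qed.

End ergodic_averages.

(** * Lower integral bound for the liminf, and the ergodic maximal function *)

Section maximal_function.
Local Open Scope ereal_scope.
Context d (T : measurableType d) (R : realType) (P : probability T R).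
Variables (S : T -> T) (mS : measurable_fun setT S).
Hypothesis PS : forall A, measurable A -> P (S @^-1` A) = P A.

(** Dual to the upper bound: boundedness makes the lower limit c integrable, c does not decrease
    along orbits, and the maximal lemma is applied to c - f + e. *)
Lemma le_integral_limn_einf_avg_bounded (f : T -> R) (K : R) : measurable_fun setT f ->
  (forall x, 0 <= f x <= K)%R ->
  \int[P]_x (f x)%:E <= \int[P]_x limn_einf (fun n => avg S n (EFin \o f) x).
Proof.
move=> mf' fK; have f0 x : (0 <= f x)%R by case/andP: (fK x).
have mf : measurable_fun setT (EFin \o f) by exact/measurable_EFinP.
set fl := fun x => limn_einf (fun n => avg S n (EFin \o f) x).
have fl0 x : 0 <= fl x by apply: limn_einf_ge0 => n; apply: avg_ge0 => y; rewrite lee_fin.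
have mfl : measurable_fun setT fl.
  by apply: measurable_limn_einf => n; exact: measurable_avg.
have flK x : fl x <= K%:E.
  apply: le_trans (limn_einf_sup _) _; apply: limn_esup_le_near; apply: nearW => n.
  rewrite avg_EFin lee_fin mulrC ler_pdivrMr//.
  apply: (@le_trans _ _ (\sum_(i < n.+1) K)%R).
    by apply: ler_sum => i _; case/andP : (fK (iter i S x)).
  by rewrite sumr_const card_ord mulr_natr.
pose c x := fine (fl x).
have cE x : fl x = (c x)%:E.
  rewrite fineK// fin_numElt; apply/andP; split.
    by apply: (@lt_le_trans _ _ 0); rewrite ?ltNy0.
  by apply: (le_lt_trans (flK x)); rewrite ltry.
have c0 x : (0 <= c x)%R by rewrite -lee_fin -cE.
have cS x : (c x <= c (S x))%R.
  by rewrite -lee_fin -!cE; exact: limn_einf_avg_shift.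
have cSk x k : (c x <= c (iter k S x))%R.
  by elim: k => //= k IH; apply: (le_trans IH).
have mc : measurable_fun setT (EFin \o c).
  by rewrite (_ : _ \o _ = fl)//; apply/funext => x /=; rewrite cE.
have bi (h : T -> R) : measurable_fun setT (EFin \o h) -> (forall x, 0 <= h x <= K)%R ->
    P.-integrable setT (EFin \o h).
  move=> mh hK; have := @finite_measure_integrable_cst _ _ _ P setT K measurableT.
  apply: (le_integrable measurableT mh) => x _ /=; have /andP[h0 hk] := hK x.
  by rewrite lee_fin !ger0_norm//; apply: le_trans hk.
have fi := bi _ mf fK.
have ci : P.-integrable setT (EFin \o c).
  by apply: bi => // x; rewrite c0 -lee_fin -cE flK.
rewrite [leRHS](_ : _ = \int[P]_x (c x)%:E); last first.
  by apply: eq_integral => x _; rewrite -cE.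
apply/lee_addgt0Pr => e e0.
pose h x := (c x - f x + e)%R.
have hi : P.-integrable setT (EFin \o h).
  rewrite (_ : _ \o _ = ((EFin \o c) \- (EFin \o f)) \+ (EFin \o cst e))//.
  apply: integrableD => //; first exact: integrableB.
  exact: finite_measure_integrable_cst.
have := maximal_ergodic mS PS hi.
have -> : possum S h = setT.
  apply/seteqP; split => // x _.
  have [n Hn] : exists n, avg S n (EFin \o f) x < (c x + e)%:E.
    apply: contrapT => /forallNP H.
    have : (c x + e)%:E <= fl x.
      apply: limn_einf_ge_near; apply: nearW => n.
      by rewrite leNgt; apply/negP; exact: H.
    by apply/negP; rewrite -ltNge cE lte_fin ltrDl.
  exists n; move: Hn; rewrite avg_EFin lte_fin mulrC ltr_pdivrMr//.
  rewrite -subr_gt0 => /lt_le_trans; apply.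
  rewrite big_split sumrB /= sumr_const card_ord.
  have : (n.+1%:R * c x <= \sum_(i < n.+1) c (iter i S x))%R.
    apply: (@le_trans _ _ (\sum_(i < n.+1) c x)%R); last exact: ler_sum.
    by rewrite sumr_const card_ord mulr_natl.
  by rewrite -[(e *+ _)%R]mulr_natl; lra.
rewrite (_ : \int[P]_x (h x)%:E = \int[P]_x (c x)%:E - \int[P]_x (f x)%:E + e%:E); last first.
  rewrite -(integralB measurableT ci fi) -[X in _ = _ + X]mule1 -(@probability_setT _ _ _ P).
  rewrite -integral_cst// -integralD//; first exact: integrableB.
  exact: finite_measure_integrable_cst.
have fin1 := integrable_fin_num measurableT fi.
have fin2 := integrable_fin_num measurableT ci.
by rewrite addeAC sube_ge0// fin1.
Qed.

(** Cutting g at K only lowers its averages, so the bounded case applies and monotone convergence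
    removes K, even when the integral is infinite. *)
Lemma le_integral_limn_einf_avg (g : T -> \bar R) : measurable_fun setT g ->
  (forall x, 0 <= g x) ->
  \int[P]_x g x <= \int[P]_x limn_einf (fun n => avg S n g x).
Proof.
move=> mg g0.
rewrite -(cvg_lim _ (cvg_integral_mine (P := P) mg g0))//.
apply: lime_le; first by apply/cvg_ex; eexists; exact: cvg_integral_mine.
apply: nearW => K.
pose c x := fine (mine (g x) K%:R%:E).
have cE x : mine (g x) K%:R%:E = (c x)%:E.
  rewrite fineK// fin_numElt; apply/andP; split.
    by apply: (@lt_le_trans _ _ 0); rewrite ?ltNy0// le_min g0 lee_fin ler0n.
  by rewrite gt_min ltry orbT.
have cK x : (0 <= c x <= K%:R)%R.
  by rewrite -!lee_fin -cE le_min g0 lee_fin ler0n ge_min lexx orbT.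
have mc : measurable_fun setT (EFin \o c).
  rewrite (_ : _ \o _ = fun x => mine (g x) K%:R%:E); last by apply/funext => x /=; rewrite cE.
  exact: measurable_mine.
under eq_integral do rewrite cE.
apply: (@le_trans _ _ (\int[P]_x limn_einf (fun n => avg S n (EFin \o c) x))).
  apply: (@le_integral_limn_einf_avg_bounded _ K%:R) => //.
  exact/measurable_EFinP.
apply: ge0_le_integral => //.
- move=> x _; apply: limn_einf_ge0 => n; apply: avg_ge0 => y.
  by case/andP: (cK y); rewrite lee_fin.
- by apply: measurable_limn_einf => n; exact: measurable_avg.
- by apply: measurable_limn_einf => n; exact: measurable_avg.
- move=> x _; apply: le_limn_einf; apply: nearW => n; apply: le_avg => y /=.
  by rewrite -cE ge_min lexx.
Qed.

(** [fine] sends +oo to 0; almost no orbit meets +oo, so g may be replaced by its real part in all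
    averages at once. *)
Lemma ae_orbit_fin_num (g : T -> \bar R) : measurable_fun setT g ->
  (forall x, 0 <= g x) -> \int[P]_x g x < +oo ->
  \forall x \ae P, forall k, g (iter k S x) = (fine (g (iter k S x)))%:E.
Proof.
move=> mg g0 gi; apply: ae_foralln => k.
have mgk : measurable_fun setT (g \o iter k S) by exact: measurableT_comp mg (measurable_iter mS k).
have : P.-integrable setT (g \o iter k S).
  apply/integrableP; split => //.
  under eq_integral do rewrite /= gee0_abs//.
  by rewrite (ge0_integral_preserving_iter mS PS).
by move=> /(integrable_ae measurableT); apply: filterS => x /(_ I) /fineK.
Qed.

Lemma integral_fine (g : T -> \bar R) : measurable_fun setT g ->
  (forall x, 0 <= g x) -> \int[P]_x g x < +oo ->
  \int[P]_x (fine (g x))%:E = \int[P]_x g x.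
Proof.
move=> mg g0 gi; apply: ae_eq_integral => //.
  by apply/measurable_EFinP; apply: measurableT_comp => //; exact: measurable_fine.
have := ae_orbit_fin_num mg g0 gi.
by apply: filterS => x /(_ 0%N) /= <-.
Qed.

Lemma integrable_fine (g : T -> \bar R) : measurable_fun setT g ->
  (forall x, 0 <= g x) -> \int[P]_x g x < +oo ->
  P.-integrable setT (EFin \o (fine \o g)).
Proof.
move=> mg g0 gi; apply/integrableP; split.
  by apply/measurable_EFinP; apply: measurableT_comp => //; exact: measurable_fine.
under eq_integral do rewrite gee0_abs /= ?lee_fin ?fine_ge0//.
by rewrite integral_fine.
Qed.

Lemma integral_limn_esup_avg (g : T -> \bar R) : measurable_fun setT g ->
  (forall x, 0 <= g x) ->
  \int[P]_x limn_esup (fun n => avg S n g x) <= \int[P]_x g x.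
Proof.
move=> mg g0; have [->|] := eqVneq (\int[P]_x g x) +oo; first by rewrite leey.
rewrite -ltey => gi; pose f := fine \o g.
have mf : measurable_fun setT f by apply: measurableT_comp => //; exact: measurable_fine.
have f0 x : (0 <= f x)%R by rewrite fine_ge0.
rewrite -(integral_fine mg g0 gi).
apply: le_trans (integral_limn_esup_avg_real mS PS f0 (integrable_fine mg g0 gi)).
rewrite le_eqVlt; apply/orP; left; apply/eqP; apply: ae_eq_integral => //.
- by apply: measurable_fun_limn_esup => n; exact: measurable_avg.
- by apply: measurable_fun_limn_esup => n; apply: measurable_avg => //; exact/measurable_EFinP.
have := ae_orbit_fin_num mg g0 gi.
apply: filterS => x H _; congr limn_esup; apply/funext => n; rewrite /avg; congr (_ * _).
by apply: eq_bigr => k _; rewrite H.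
Qed.

Definition maxavg (g : T -> \bar R) x := esups (fun n => avg S n g x) 0%N.

Lemma measurable_maxavg g : measurable_fun setT g -> measurable_fun setT (maxavg g).
Proof. by move=> mg; apply: measurable_fun_esups => n; exact: measurable_avg. Qed.

Lemma maxavg_gt (g : T -> \bar R) x l : l < maxavg g x -> exists n, l < avg S n g x.
Proof. by move=> /ereal_sup_gt[_ [n _ <-]] ?; exists n. Qed.

Lemma avg_le_maxavg (g : T -> \bar R) x n : avg S n g x <= maxavg g x.
Proof. by apply: ereal_sup_ubound; exists n. Qed.

Lemma measurable_gt (g : T -> \bar R) l : measurable_fun setT g ->
  measurable [set x | l < g x].
Proof.
move=> mg; rewrite -[X in measurable X]setTI (_ : [set x | _] = g @^-1` `]l, +oo[%classic).
  by apply: mg => //; exact: emeasurable_itv.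
by apply/seteqP; split=> x /=; rewrite in_itv/= andbT.
Qed.

(** Weak-type inequality: up to a null set, a maximal function above l means that f - l has a
    positive Birkhoff sum. On that set the maximal lemma bounds l times its probability by the
    integral of f. *)
Lemma maxavg_weak (g : T -> \bar R) (l : R) : measurable_fun setT g ->
  (forall x, 0 <= g x) -> (0 <= l)%R ->
  l%:E * P [set x | l%:E < maxavg g x] <= \int[P]_x g x.
Proof.
move=> mg g0 l0; have [->|] := eqVneq (\int[P]_x g x) +oo; first by rewrite leey.
rewrite -ltey => gi; pose f := fine \o g.
have mf : measurable_fun setT f by apply: measurableT_comp => //; exact: measurable_fine.
have f0 x : (0 <= f x)%R by rewrite fine_ge0.
have fi := integrable_fine mg g0 gi.
pose h x := (f x - l)%R.
have hi : P.-integrable setT (EFin \o h).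
  rewrite (_ : _ \o _ = (EFin \o f) \- (EFin \o cst l))//.
  by apply: integrableB => //; exact: finite_measure_integrable_cst.
have mB : measurable (possum S h).
  by apply: measurable_possum => //; apply/measurable_EFinP; case/integrableP : hi.
have := maximal_ergodic mS PS hi.
rewrite (_ : \int[P]_(x in _) _ = \int[P]_(x in possum S h) (f x)%:E - l%:E * P (possum S h)); last first.
  rewrite -integral_cst// -integralB//.
  - exact: integrableS measurableT mB _ fi.
  - exact: finite_measure_integrable_cst.
rewrite sube_ge0; last first.
  by apply/orP; left; rewrite fin_numM// fin_num_measure.
move=> H; rewrite -(integral_fine mg g0 gi).
have H2 : \int[P]_(x in possum S h) (f x)%:E <= \int[P]_x (fine (g x))%:E.
  apply: ge0_subset_integral => //; first exact/measurable_EFinP.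
  by move=> x _; rewrite lee_fin.
apply: le_trans H2; apply: le_trans H; rewrite lee_wpmul2l//.
have [N [mN PN HN]] := ae_orbit_fin_num mg g0 gi.
have -> : P (possum S h) = P (possum S h `|` N).
  by rewrite measureU0.
apply: le_measure; rewrite ?inE; [|exact: measurableU|].
  by apply: measurable_gt; exact: measurable_maxavg.
move=> x /= /maxavg_gt[n ln]; apply: contrapT => /not_orP[xh xN].
have Hx : forall k, g (iter k S x) = (fine (g (iter k S x)))%:E.
  by apply: contrapT => xk; exact/xN/HN.
apply: xh; exists n; move: ln; rewrite /avg (eq_bigr (fun k : 'I_n.+1 => (f (iter k S x))%:E)).
  rewrite sumEFin -EFinM lte_fin mulrC ltr_pdivlMr//.
  by rewrite sumrB sumr_const card_ord subr_gt0 mulr_natr.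
by move=> k _; rewrite Hx.
Qed.

End maximal_function.

(** * Ergodic averages of a sequence of functions *)

Section moving_averages.
Local Open Scope ereal_scope.
Context d (T : measurableType d) (R : realType) (P : probability T R).
Variables (S : T -> T) (mS : measurable_fun setT S).
Hypothesis PS : forall A, measurable A -> P (S @^-1` A) = P A.
Variables (F : nat -> T -> \bar R) (m : nat -> nat).
Hypothesis mF : forall n, measurable_fun setT (F n).
Hypothesis F0 : forall n x, 0 <= F n x.
Hypothesis leqm : forall n, (n <= m n)%N.

Let esups0 N x : 0 <= esups (F ^~ x) N.
Proof. by apply: le_ereal_sup_tmp; exists (F N x) => //; exists N => //=; exact: leqnn. Qed.

Let einfs0 N x : 0 <= einfs (F ^~ x) N.
Proof. by apply: le_ereal_inf_tmp => _ [n _ <-]. Qed.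

(** From N on, F n lies below the fixed function sup of F k over k >= N, to which the bound for a
    single function applies; m n >= n keeps the lengths tending to infinity. These suprema decrease
    to the upper limit, so dominated convergence asks for integrability of the first of them. *)
Lemma integral_limn_esup_avg_moving : \int[P]_x esups (F ^~ x) 0%N < +oo ->
  \int[P]_x limn_esup (fun n => avg S (m n) (F n) x) <=
  \int[P]_x limn_esup (F ^~ x).
Proof.
move=> Fi; pose G N x := esups (F ^~ x) N.
have mG N : measurable_fun setT (G N) by exact: measurable_fun_esups.
have H N : \int[P]_x limn_esup (fun n => avg S (m n) (F n) x) <= \int[P]_x G N x.
  apply: (@le_trans _ _ (\int[P]_x limn_esup (fun n => avg S n (G N) x))); last first.
    by apply: (integral_limn_esup_avg mS PS) => // x; exact: esups0.
  apply: ge0_le_integral => //.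
  - by move=> x _; apply: limn_esup_ge0 => n; apply: avg_ge0.
  - by apply: measurable_fun_limn_esup => n; exact: measurable_avg.
  - by apply: measurable_fun_limn_esup => n; exact: measurable_avg.
  move=> x _; apply: (@le_trans _ _ (limn_esup (fun n => avg S (m n) (G N) x))).
    apply: le_limn_esup; exists N => // n /= Nn; apply: le_avg => y.
    by apply: ereal_sup_ubound; exists n.
  apply: lee_gtP => r /limn_esup_lt[M _ HM]; apply: limn_esup_le_near.
  by exists M => // n /= Mn; apply: ltW; apply: HM => /=; exact: leq_trans (leqm n).
have cv : \int[P]_x G N x @[N --> \oo] --> \int[P]_x limn_esup (F ^~ x).
  have mL : measurable_fun setT (fun x => limn_esup (F ^~ x)) by exact: measurable_fun_limn_esup.
  have := @dominated_convergence _ _ _ P setT measurableT G _ (G 0%N) mG mL.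
  case => //.
  - by apply: aeW => x _; rewrite limn_esup_inf; exact: cvg_esups_inf.
  - by apply/integrableP; split => //; under eq_integral do rewrite (gee0_abs (esups0 _ _)).
  - apply: aeW => x n _; rewrite gee0_abs; last exact: esups0.
    exact: nonincreasing_esups.
rewrite -(cvg_lim _ cv)//; apply: lime_ge; first by apply/cvg_ex; eexists; exact: cv.
exact: nearW.
Qed.

(** The infima over k >= N increase, so monotone convergence takes the place of domination. *)
Lemma integral_limn_einf_avg_moving :
  \int[P]_x limn_einf (F ^~ x) <=
  \int[P]_x limn_einf (fun n => avg S (m n) (F n) x).
Proof.
pose G N x := einfs (F ^~ x) N.
have mG N : measurable_fun setT (G N) by exact: measurable_fun_einfs.
have H N : \int[P]_x G N x <= \int[P]_x limn_einf (fun n => avg S (m n) (F n) x).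
  apply: (@le_trans _ _ (\int[P]_x limn_einf (fun n => avg S n (G N) x))).
    by apply: (le_integral_limn_einf_avg mS PS) => // x; exact: einfs0.
  apply: ge0_le_integral => //.
  - by move=> x _; apply: limn_einf_ge0 => n; apply: avg_ge0 => y; exact: einfs0.
  - by apply: measurable_limn_einf => n; exact: measurable_avg.
  - by apply: measurable_limn_einf => n; exact: measurable_avg.
  move=> x _; apply: (@le_trans _ _ (limn_einf (fun n => avg S (m n) (G N) x))).
    apply: gee_ltP => r /limn_einf_gt[M _ HM]; apply: limn_einf_ge_near.
    by exists M => // n /= Mn; apply: ltW; apply: HM => /=; exact: leq_trans (leqm n).
  apply: le_limn_einf; exists N => // n /= Nn; apply: le_avg => y.
  by apply: ereal_inf_lbound; exists n.
have cv : \int[P]_x G N x @[N --> \oo] --> \int[P]_x limn_einf (F ^~ x).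
  rewrite [X in _ --> X](_ : _ = \int[P]_x limn (G ^~ x)).
    apply: (@cvg_monotone_convergence _ _ _ P setT measurableT G) => //.
      by move=> n x _; exact: einfs0.
    by move=> x _; exact: nondecreasing_einfs.
  by apply: eq_integral => x _; rewrite limn_einf_lim.
rewrite -(cvg_lim _ cv)//; apply: lime_le; first by apply/cvg_ex; eexists; exact: cv.
exact: nearW.
Qed.

End moving_averages.

(** * Polynomial tails and their stability under the maximal function *)

Section dyadic_tail.
Local Open Scope ereal_scope.
Context d (T : measurableType d) (R : realType) (P : probability T R).
Variables (rho : R).
Hypotheses (rho0 : (0 < rho)%R) (rho1 : (2 * rho < 1)%R).
Implicit Types g h : T -> \bar R.

(* P (g > t) = O(t^-a) with rho = 2^-a, a > 1, tested at dyadic t only. *)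
Definition dyadic_tail g := exists C : R,
  forall j, P [set x | (2 ^+ j)%:E < g x] <= (C * rho ^+ j)%:E.

Lemma dyadic_tail_shift g m (C : R) : measurable_fun setT g ->
  (forall j, P [set x | (2 ^+ (j + m))%:E < g x] <= (C * rho ^+ j)%:E) ->
  dyadic_tail g.
Proof.
(* For j < m the bound 1 on probabilities suffices, since rho^j / rho^m >= 1; for j >= m the factor
   rho^-m undoes the shift. *)
move=> mg H; exists (Num.max 1 C / rho ^+ m)%R => j.
have rm : (0 < rho ^+ m)%R by rewrite exprn_gt0.
have rj : (0 < rho ^+ j)%R by rewrite exprn_gt0.
have rle1 : (rho <= 1)%R by move: rho0 rho1; lra.
have [mj|jm] := leqP m j.
  have := H (j - m)%N; rewrite subnK// => /le_trans; apply.
  rewrite lee_fin -[in leRHS](subnK mj) [in leRHS]exprD mulrAC mulrA mulfK ?gt_eqF//.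
  by apply: ler_wpM2r; rewrite ?exprn_ge0 ?(ltW rho0)// le_max lexx orbT.
apply: (@le_trans _ _ 1); first by apply: probability_le1; exact: measurable_gt.
rewrite lee_fin mulrAC ler_pdivlMr// mul1r.
apply: (@le_trans _ _ (rho ^+ j)%R).
  by apply: ler_wiXn2l => //; rewrite ?(ltW rho0)// ltnW.
by rewrite ler_peMl ?(ltW rj)// le_max lexx.
Qed.

Lemma le_dyadic_tail g h : measurable_fun setT g -> measurable_fun setT h ->
  (forall x, g x <= h x) -> dyadic_tail h -> dyadic_tail g.
Proof.
move=> mg mh gh [C H]; exists C => j; apply: le_trans (H j).
apply: le_measure; rewrite ?inE; [exact: measurable_gt..|].
by move=> x /= /lt_le_trans; apply.
Qed.

Lemma dyadic_tailD g h : measurable_fun setT g -> measurable_fun setT h ->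
  dyadic_tail g -> dyadic_tail h -> dyadic_tail (fun x => g x + h x).
Proof.
move=> mg mh [C Hg] [D Hh]; apply: (@dyadic_tail_shift _ 1 (C + D)).
  exact: emeasurable_funD.
move=> j; rewrite mulrDl EFinD.
apply: le_trans (leeD (Hg j) (Hh j)).
apply: le_trans (measureU2 _ _ _); [|exact: measurable_gt..].
apply: le_measure; rewrite ?inE.
- by apply: measurable_gt; exact: emeasurable_funD.
- by apply: measurableU; exact: measurable_gt.
move=> x /= H; apply: contrapT => /not_orP[/negP + /negP +].
rewrite -!leNgt => gx hx; move: H; apply/negP; rewrite -leNgt.
by apply: (le_trans (leeD gx hx)); rewrite -EFinD lee_fin addn1 exprS; lra.
Qed.

Lemma dyadic_tailZ g (k : nat) : measurable_fun setT g -> (forall x, 0 <= g x) ->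
  dyadic_tail g -> dyadic_tail (fun x => k%:R%:E * g x).
Proof.
move=> mg g0 Hg; elim: k => [|k IH].
  exists 0%R => j; rewrite mul0r (_ : [set x | _] = set0) ?measure0//.
  by apply/seteqP; split => // x /=; rewrite mul0e lte_fin ltNge exprn_ge0.
apply: (le_dyadic_tail _ _ _ (dyadic_tailD _ mg IH Hg)).
- exact: emeasurable_funM.
- by apply: emeasurable_funD => //; exact: emeasurable_funM.
- by move=> x; rewrite -natr1 EFinD ge0_muleDl ?mul1e.
- exact: emeasurable_funM.
Qed.

(** Layer-cake estimate: on the level set, g is at most the sum of 2^(j+i+1) over the levels 2^(j+i)
    that it exceeds. Integration produces a geometric series of ratio 2 rho < 1, whose sum is the
    constant. *)
Lemma dyadic_tail_integral g : measurable_fun setT g -> (forall x, 0 <= g x) ->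
  dyadic_tail g -> exists C : R, forall j,
    \int[P]_(x in [set x | (2 ^+ j)%:E < g x]) g x <= (C * (2 * rho) ^+ j)%:E.
Proof.
move=> mg g0 [C0 H0].
pose C : R := `|C0|%R.
have H j : P [set x | (2 ^+ j)%:E < g x] <= (C * rho ^+ j)%:E.
  apply: le_trans (H0 j) _; rewrite lee_fin ler_wpM2r ?exprn_ge0 ?(ltW rho0)//.
  exact: ler_norm.
exists (2 * C / (1 - 2 * rho))%R => j.
pose B i := [set x | (2 ^+ i)%:E < g x].
have mB i : measurable (B i) by exact: measurable_gt.
pose f i x : \bar R := (2 ^+ (j + i).+1 * \1_(B (j + i)%N) x)%:E.
have f0 i x : 0 <= f i x by rewrite lee_fin mulr_ge0// exprn_ge0.
have mf i : measurable_fun setT (f i).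
  by apply/measurable_EFinP; apply: measurable_funM => //; exact: measurable_indic.
rewrite integral_mkcond.
apply: (@le_trans _ _ (\int[P]_x \sum_(i <oo) f i x)).
  apply: ge0_le_integral => //.
  - by move=> x _; rewrite /patch; case: ifPn.
  - by apply/(measurable_restrictT _ (mB j)); exact: measurable_funTS.
  - by apply: ge0_emeasurable_sum => // i x _ _; exact: f0.
  move=> x _; rewrite /patch; case: ifPn; last by move=> _; apply: nneseries_ge0.
  rewrite inE /= => gj.
  have fE m : B (j + m)%N x -> (2 ^+ (j + m).+1)%:E <= \sum_(i <oo) f i x.
    move=> Bm; apply: le_trans (nneseries_lim_ge m.+1 _) => //.
    rewrite big_mkord big_ord_recr /= /f indicE mem_set// mulr1.
    by rewrite leeDr// sume_ge0.
  (* For the least k with g x <= 2^(j+k+1), the k-th term alone dominates g x. If there is no such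
     k, arbitrarily large terms occur and the series is +oo. *)
  have [[m Hm]|/forallNP H2] := pselect (exists m, g x <= (2 ^+ (j + m).+1)%:E).
    have [k Hk kmin] := ex_minnP (ex_intro (fun m => g x <= (2 ^+ (j + m).+1)%:E) m Hm).
    apply: (le_trans Hk); apply: fE; rewrite /B /=.
    case: k Hk kmin => [|k] Hk kmin; first by rewrite addn0.
    by rewrite ltNge addnS; apply/negP => /kmin; rewrite ltnn.
  suff -> : \sum_(i <oo) f i x = +oo by rewrite leey.
  apply/eqyP => A A0; have [k Ak] : exists k : nat, (A <= k%:R)%R.
    by have [N _ HN] := nbhs_infty_ger A; exists N; apply: HN => /=; exact: leqnn.
  apply: le_trans (fE k _); last first.
    have := H2 k; rewrite /B /= => /negP; rewrite -ltNge; apply: lt_trans.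
    by rewrite lte_fin ltr_eXn2l ?ltr1n.
  rewrite lee_fin; apply: (le_trans Ak); rewrite -natrX ler_nat.
  by apply: ltnW; apply: ltn_trans (ltn_expl _ _) => //; rewrite ltnS leq_addl.
rewrite integral_nneseries//.
have -> : (2 * C / (1 - 2 * rho) * (2 * rho) ^+ j)%:E =
    \sum_(i <oo) (2 * C * (2 * rho) ^+ j * (2 * rho) ^+ i)%:E.
  have r1 : (`|2 * rho| < 1)%R by rewrite ger0_norm ?mulr_ge0 ?(ltW rho0).
  have cv := @cvg_geometric_series R (2 * C * (2 * rho) ^+ j)%R _ r1.
  have -> : (2 * C / (1 - 2 * rho) * (2 * rho) ^+ j =
      2 * C * (2 * rho) ^+ j * (1 - 2 * rho)^-1)%R by rewrite mulrAC.
  apply/esym/cvg_lim => //.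
  rewrite (_ : (fun n => _) = EFin \o series (geometric (2 * C * (2 * rho) ^+ j)%R (2 * rho)%R)).
    by apply: cvg_EFin cv; exact: nearW.
  by apply/funext => n; rewrite /= sumEFin.
apply: lee_nneseries => [i _ _|i _]; first exact: integral_ge0.
rewrite /f; under eq_integral do rewrite EFinM.
rewrite ge0_integralZl//; last by apply/measurable_EFinP; exact: measurable_indic.
rewrite integral_indic// setIT.
apply: le_trans (lee_wpmul2l _ (H _)) _; first by rewrite lee_fin exprn_ge0.
rewrite -EFinM lee_fin exprS !exprD !exprMn le_eqVlt; apply/orP; left; apply/eqP.
ring.
Qed.

Lemma dyadic_tail_lty g : measurable_fun setT g -> (forall x, 0 <= g x) ->
  dyadic_tail g -> \int[P]_x g x < +oo.
Proof.
move=> mg g0 /(dyadic_tail_integral mg g0)[C /(_ 0%N) HC].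
have mB : measurable [set x | (2 ^+ 0)%:E < g x] by exact: measurable_gt.
apply: (@le_lt_trans _ _ (\int[P]_x (1 + (g \_ [set x | (2 ^+ 0)%:E < g x]) x))).
  apply: ge0_le_integral => //.
  - apply: emeasurable_funD => //.
    by apply/(measurable_restrictT _ mB); exact: measurable_funTS.
  move=> x _; rewrite /patch; case: ifPn => [_|]; first by rewrite leeDr.
  by rewrite notin_setE /= expr0 => /negP; rewrite -leNgt adde0.
rewrite ge0_integralD//.
- rewrite -integral_mkcond; apply: lte_add_pinfty; last exact: le_lt_trans HC (ltry _).
  by rewrite integral_cst// mul1e -ge0_fin_numE// fin_num_measure.
- by move=> x _; rewrite /patch; case: ifPn.
- by apply/(measurable_restrictT _ mB); exact: measurable_funTS.
Qed.

Lemma dyadic_tail_comp (S : T -> T) g : measurable_fun setT S ->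
  (forall A, measurable A -> P (S @^-1` A) = P A) ->
  measurable_fun setT g -> dyadic_tail g -> dyadic_tail (g \o S).
Proof.
move=> mS PS mg [C H]; exists C => j; apply: le_trans (H j).
by rewrite -[leRHS]PS//; exact: measurable_gt.
Qed.

(** Split g at 2^j: the part below contributes at most 2^j to any average, so a maximal function
    above 2^(j+1) forces that of the part above to exceed 2^j. The weak-type inequality bounds this
    probability by 2^-j C (2 rho)^j = C rho^j, the same rate as before, so the operation can be
    iterated. *)
Lemma dyadic_tail_maxavg (S : T -> T) g : measurable_fun setT S ->
  (forall A, measurable A -> P (S @^-1` A) = P A) ->
  measurable_fun setT g -> (forall x, 0 <= g x) ->
  dyadic_tail g -> dyadic_tail (maxavg S g).
Proof.
move=> mS PS mg g0 /(dyadic_tail_integral mg g0)[C HC].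
apply: (@dyadic_tail_shift _ 1 C); first exact: measurable_maxavg.
move=> j; set B := [set x | (2 ^+ j)%:E < g x].
have mB : measurable B by exact: measurable_gt.
have mgB : measurable_fun setT (g \_ B).
  by apply/(measurable_restrictT _ mB); exact: measurable_funTS.
have gB0 x : 0 <= (g \_ B) x by rewrite /patch; case: ifPn.
have j0 : (0 < (2 : R) ^+ j)%R by rewrite exprn_gt0.
have := HC j; rewrite integral_mkcond => HC'.
have := le_trans (maxavg_weak mS PS mgB gB0 (ltW j0)) HC'.
rewrite exprMn mulrCA EFinM lee_pmul2l// => H.
apply: le_trans H; apply: le_measure; rewrite ?inE.
- by apply: measurable_gt; exact: measurable_maxavg.
- by apply: measurable_gt; exact: measurable_maxavg.
move=> x /= /maxavg_gt[n Hn].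
apply: lt_le_trans (avg_le_maxavg S (g \_ B) x n).
have gle y : g y <= (2 ^+ j)%:E + (g \_ B) y.
  rewrite /patch; case: ifPn => [_|]; first by rewrite leeDr// lee_fin ltW.
  by rewrite notin_setE /B /= => /negP; rewrite -leNgt adde0.
have : (2 ^+ (j + 1))%:E < (2 ^+ j)%:E + avg S n (g \_ B) x.
  apply: (lt_le_trans Hn); apply: (le_trans (le_avg S n x gle)).
  rewrite /avg big_split /= muleDr//; last first.
    by apply: ge0_adde_def; rewrite inE ?sume_ge0// => i _; rewrite lee_fin ltW.
  rewrite leeD2r// sumEFin -EFinM lee_fin sumr_const card_ord -[X in (_ * X <= _)%R]mulr_natl mulrA.
  by rewrite mulVf ?mul1r.
by rewrite addn1 exprS mulrDl mul1r EFinD lteD2lE.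
Qed.

End dyadic_tail.

(** * Parallelepipeds in lattice coordinates *)

Section topology_cV.
Context {R : realType} {d : nat}.
Implicit Types (x y v : 'cV[R]_d) (f : 'cV[R]_d -> R).

Lemma continuous_measurable_cV f : continuous f -> measurable_fun setT f.
Proof.
move=> /continuousP cf; apply: (measurability _ (RGenOpens.measurableE R)) => //.
move=> _ [_ [a [b ->]] <-]; rewrite setTI.
by apply: sub_sigma_algebra; apply: cf; exact: interval_open.
Qed.

Definition cube (M : R) : set 'cV[R]_d := [set x | forall i, `|x i 0| <= M].

Lemma continuous_trmx n m : continuous (fun x : 'M[R]_(n, m) => x^T).
Proof.
move=> x A [Q xQ QA]; exists (fun i j => Q j i) => [i j|y yQ].
  by have := xQ j i; rewrite mxE.
by apply: QA => i j; rewrite mxE; exact: yQ.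
Qed.

Lemma cube_compact M : compact (cube M).
Proof.
rewrite (_ : cube M = trmx @` [set v : 'rV[R]_d | forall i, `[- M, M]%classic (v ord0 i)]).
  apply: continuous_compact.
    exact/continuous_subspaceT/continuous_trmx.
  apply: (@rV_compact R d (fun=> `[- M, M]%classic)) => _.
  exact: segment_compact.
apply/seteqP; split => [x xM|_ [v vM <-] i].
  exists x^T; last by rewrite trmxK.
  by move=> i; rewrite /= mxE in_itv/= -ler_norml; exact: xM.
by rewrite mxE ler_norml; have := vM i; rewrite /= in_itv.
Qed.

Lemma cV_ballP x (e : R) y : 0 < e -> ball x e y <-> forall i, `|x i 0 - y i 0| < e.
Proof.
move=> e0; split=> [[_ H] i|H]; first exact: (H i 0).
by split=> // i j; rewrite (ord1 j); exact: H.
Qed.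

Lemma continuous_cVP f : continuous f <->
  forall x (e : R), 0 < e -> exists2 r : R, 0 < r &
    forall y, (forall i, `|x i 0 - y i 0| < r) -> `|f x - f y| < e.
Proof.
split=> [cf x e e0|H x].
  have /cvgrPdist_lt/(_ _ e0)/nbhs_ballP[r r0 rf] := cf x.
  by exists r => // y xy; apply: rf; exact/cV_ballP.
apply/(@cvgrPdist_lt _ _ _ (nbhs x)) => e e0; have [r r0 rf] := H x e e0.
by apply/nbhs_ballP; exists r => // y /(cV_ballP _ _ r0); exact: rf.
Qed.

(** Only x is confined to the cube, y need not be. Compactness enters in its near-covering form,
    with the filter of small positive radii. *)
Lemma uniform_continuous_cube f M (e : R) : continuous f -> 0 < e ->
  exists2 r : R, 0 < r & forall x y, cube M x -> (forall i, `|x i 0 - y i 0| < r) ->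
    `|f x - f y| < e.
Proof.
move=> /continuous_cVP cf e0.
have /(_ R (0^'+ : set_system R) (fun r x =>
  forall y, (forall i, `|x i 0 - y i 0| < r) -> `|f x - f y| < e) _) :=
  (compact_near_coveringP (cube M)).1 (@cube_compact M).
case.
  move=> x _; have e20 : 0 < e / 2 by rewrite divr_gt0.
  have [r r0 rf] := cf x _ e20; have r20 : 0 < r / 2 by rewrite divr_gt0.
  exists (ball x (r / 2), [set t | t < r / 2]).
    split; first exact: nbhsx_ballx.
    by near=> t => /=; near: t; exact: nbhs_right_lt.
  move=> [x' t] /= [/(cV_ballP _ _ r20) xx' tr] y x'y.
  rewrite (splitr e) -(subrKA (f x)) (le_lt_trans (ler_normD _ _))// ltrD//.
    rewrite distrC; apply: rf => i; apply: (lt_trans (xx' i)).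
    by rewrite ltr_pdivrMr// ltr_pMr// ltr1n.
  apply: rf => i; rewrite -(subrKA (x' i 0)) (splitr r).
  by rewrite (le_lt_trans (ler_normD _ _))// ltrD// (lt_trans (x'y i)).
move=> r /= r0 H.
have rr : `|r / 2| < r.
  by rewrite gtr0_norm ?divr_gt0// ltr_pdivrMr// ltr_pMr// ltr1n.
exists (r / 2); first by rewrite divr_gt0.
move=> x y Mx xy; apply: (H (r / 2)) => //=; last by rewrite divr_gt0.
by rewrite sub0r normrN.
Unshelve. all: by end_near. Qed.

End topology_cV.

Section locally_finite.
Context {R : realType} {d : nat}.

Lemma measurable_cube M : measurable (@cube R d M).
Proof.
rewrite (_ : cube M = \bigcap_(i in [set: 'I_d])
    (fun x : 'cV[R]_d => x i 0) @^-1` `[- M, M]%classic).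
  apply: fin_bigcap_measurable => // i _; rewrite -[X in measurable X]setTI.
  exact: measurable_coord.
by apply/seteqP; split=> x /= xP i => [_|]; have := xP i; rewrite /= in_itv/= -ler_norml//; exact.
Qed.

Lemma locally_finite_cube (nu : {measure set 'cV[R]_d -> \bar R}) M :
  locally_finite nu -> (nu (cube M) < +oo)%E.
Proof.
move=> lf; have /choice[U HU] x : exists U, open_nbhs x U /\ (nu U < +oo)%E.
  by have [U ? ?] := lf x; exists U.
have := @cube_compact R d M; rewrite compact_cover.
move=> /(_ _ setT U (fun x _ => (HU x).1.1)) [x _|D _ DU]; first by exists x => //; exact: (HU x).1.2.
have mU x : measurable (U x) by apply: sub_sigma_algebra; exact: (HU x).1.1.
have mbU (s : seq 'cV[R]_d) : measurable (\big[setU/set0]_(x <- s) U x).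
  by apply: bigsetU_measurable => x _; exact: mU.
have H (s : seq 'cV[R]_d) : (nu (\big[setU/set0]_(x <- s) U x) < +oo)%E.
  elim: s => [|x s IH]; first by rewrite big_nil measure0.
  rewrite big_cons; apply: le_lt_trans (measureU2 _ _ _) _ => //.
  by apply: lte_add_pinfty => //; exact: (HU x).2.
apply: le_lt_trans (H (finmap.enum_fset D)); apply: le_measure; rewrite ?inE//.
  exact: measurable_cube.
by rewrite -bigcup_seq.
Qed.

End locally_finite.

(** * Lebesgue measure under homotheties and translations *)

Section lebesgue_affine.
Context {R : realType}.

Definition cbox n (a b : 'I_n -> R) : set 'cV[R]_n :=
  [set x | forall i, x i 0 \in `[a i, b i]].

Lemma measurable_cbox n (a b : 'I_n -> R) : measurable (cbox a b).
Proof.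
rewrite (_ : cbox a b = \bigcap_(i in [set: 'I_n])
    (fun x : 'cV[R]_n => x i 0) @^-1` `[a i, b i]%classic).
  apply: fin_bigcap_measurable => // i _; rewrite -[X in measurable X]setTI.
  exact: measurable_coord.
by apply/seteqP; split=> x /= xP i => [_|]; exact: xP.
Qed.

Definition cboxes n : set (set 'cV[R]_n) := [set B | exists a b, B = cbox a b].

Lemma cboxes_cover n : \bigcup_k cbox (fun _ : 'I_n => - k%:R) (fun=> k%:R) = setT.
Proof.
apply/seteqP; split => // x _.
have [N _ HN] := nbhs_infty_ger (\sum_i `|x i 0|).
exists N => // i; rewrite in_itv/= -ler_norml.
apply: le_trans (HN N (leqnn N)).
by rewrite (bigD1 i)//= lerDl sumr_ge0.
Qed.

Lemma measurable_cboxesE n : @measurable _ 'cV[R]_n `<=` <<s @cboxes n >>.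
Proof.
suff H : @measurable_fun _ _ (g_sigma_algebraType (@cboxes n)) 'cV[R]_n setT id.
  by move=> A mA; have := H measurableT A mA; rewrite setTI preimage_id.
apply: measurable_fun_cV => i; apply: (measurability _ (RGenCInfty.measurableE R)) => //.
move=> _ [_ [r ->] <-]; rewrite setTI.
rewrite (_ : _ @^-1` _ = \bigcup_k cbox (fun j => if j == i then r else - k%:R) (fun=> k%:R)).
  apply: bigcupT_measurable => k; apply: sub_sigma_algebra.
  by exists (fun j => if j == i then r else - k%:R), (fun=> k%:R).
apply/seteqP; split => x /=.
  rewrite in_itv/= andbT => rx; have [k _ kx] : (\bigcup_k cbox (fun _ : 'I_n => - k%:R) (fun=> k%:R)) x.
    by rewrite cboxes_cover.
  exists k => // j; have := kx j; case: eqP => [->|//].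
  by rewrite !in_itv/= rx => /andP[].
by move=> [k _ /(_ i)]; rewrite eqxx !in_itv/= andbT => /andP[].
Qed.

(** Both sides are measures in A that agree on closed boxes, a generating pi-system that exhausts
    the space by sets of finite mass. *)
Lemma lebesgue_cV_affine n (s : R) (v : 'cV[R]_n) (A : set 'cV[R]_n) : 0 < s ->
  measurable A ->
  lebesgue_cV R n [set s *: x + v | x in A] = ((s ^+ n)%:E * lebesgue_cV R n A)%E.
Proof.
move=> s0 mA; have sn0 : s != 0 by rewrite gt_eqF.
pose f (y : 'cV[R]_n) := s^-1 *: (y - v).
have fE (B : set 'cV[R]_n) : [set s *: x + v | x in B] = f @^-1` B.
  apply/seteqP; split => [_ [x Bx <-]|y By] /=.
    by rewrite /f addrK scalerA mulVf// scale1r.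
  by exists (f y) => //; rewrite /f scalerA divff// scale1r subrK.
have mf : measurable_fun setT f.
  apply: measurable_fun_cV => i; under eq_fun do rewrite !mxE.
  apply: measurable_funM => //; apply: measurable_funB => //.
  exact: measurable_coord.
have sge : (0 <= s ^+ n) by rewrite exprn_ge0 ?ltW.
pose m1 := measure_function_pushforward__canonical__measure_function_Measure (lebesgue_cV R n) mf.
pose m2 := mscale (NngNum sge) (lebesgue_cV R n).
rewrite fE.
have boxE (a b : 'I_n -> R) : f @^-1` (cbox a b) = cbox (fun i => s * a i + v i 0) (fun i => s * b i + v i 0).
  apply/seteqP; split => x /= xP i; have := xP i; rewrite /f !mxE !in_itv/=.
    rewrite mulrC ler_pdivlMr// ler_pdivrMr// => /andP[H1 H2].
    by rewrite mulrC -lerBrDr H1 -lerBlDr mulrC.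
  move=> /andP[H1 H2]; rewrite mulrC ler_pdivlMr// ler_pdivrMr//.
  by apply/andP; split; move: H1 H2; lra.
have : m1 A = m2 A.
  apply: (g_sigma_algebra_measure_unique (@cboxes n) _
     (fun k : nat => cbox (fun _ : 'I_n => - k%:R) (fun=> k%:R))).
  - by move=> _ [a [b ->]]; exact: measurable_cbox.
  - by move=> k; exists (fun=> - k%:R), (fun=> k%:R).
  - exact: cboxes_cover.
  - move=> _ _ [a [b ->]] [a' [b' ->]].
    exists (fun i => Num.max (a i) (a' i)), (fun i => Num.min (b i) (b' i)).
    apply/seteqP; split => [x [xa xb] i|x xi].
      have := xa i; have := xb i; rewrite !in_itv/= ge_max le_min.
      by move=> /andP[-> ->] /andP[-> ->].
    by split=> i; have := xi i; rewrite !in_itv/= ge_max le_min => /andP[/andP[? ?] /andP[? ?]]; apply/andP.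
  - move=> _ [a [b ->]]; rewrite /m1 /m2 /= /pushforward boxE /mscale/=.
    have [ab|/existsNP[i /negP]] := pselect (forall i, a i <= b i).
      rewrite !lebesgue_cV_box//; last by move=> i; rewrite lerD2r ler_pM2l.
      rewrite -EFinM; congr EFin; rewrite -[X in s ^+ X](card_ord n) -prodr_const -big_split/=.
      by apply: eq_bigr => i _; rewrite opprD addrACA subrr addr0 mulrBr.
    rewrite -ltNge => ba.
    have -> : cbox a b = set0.
      apply/seteqP; split => // x /(_ i); rewrite in_itv/= => /andP[/le_trans h/h].
      by rewrite leNgt ba.
    have -> : cbox (fun i => s * a i + v i 0) (fun i => s * b i + v i 0) = set0.
      apply/seteqP; split => // x /(_ i); rewrite in_itv/= => /andP[/le_trans h/h].
      by rewrite lerD2r ler_pM2l// leNgt ba.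
    by rewrite !measure0 mule0.
  - move=> k; rewrite /m1 /= /pushforward boxE lebesgue_cV_box ?ltry// => i.
    by rewrite lerD2r ler_pM2l// ge0_cp// oppr_le0.
  - exact: measurable_cboxesE.
by [].
Qed.

End lebesgue_affine.

(** * Boxes in lattice coordinates *)

Section vbox.
Context {R : realType} {d : nat}.
Variables (V : 'M[R]_d).
Hypothesis V_unit : V \in unitmx.
Implicit Types (x y g : 'cV[R]_d) (a b : 'I_d -> R).

Definition vcoord x (i : 'I_d) : R := (invmx V *m x) i 0.

(** Half-open, so that boxes can be cut along coordinate hyperplanes and tiled without overlap or
    loss. *)
Definition vbox a b : set 'cV[R]_d := [set x | forall i, a i <= vcoord x i < b i].

Lemma vcoordE x i : vcoord x i = \sum_j invmx V i j * x j 0.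
Proof. by rewrite /vcoord mxE. Qed.

Lemma vcoordD x y i : vcoord (x + y) i = vcoord x i + vcoord y i.
Proof. by rewrite /vcoord mulmxDr mxE. Qed.

Lemma vcoordZ c x i : vcoord (c *: x) i = c * vcoord x i.
Proof. by rewrite /vcoord -scalemxAr mxE. Qed.

Lemma vcoord_mulV g i : vcoord (V *m g) i = g i 0.
Proof. by rewrite /vcoord mulKmx. Qed.

Lemma vcoordK x : V *m (\col_i vcoord x i) = x.
Proof.
rewrite (_ : \col_i _ = invmx V *m x) ?mulKVmx//.
by apply/colP => i; rewrite mxE.
Qed.

Lemma measurable_vcoord i : measurable_fun setT (vcoord ^~ i).
Proof.
under eq_fun do rewrite vcoordE.
by apply: measurable_sum => j; apply: measurable_funM => //; exact: measurable_coord.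
Qed.

Lemma measurable_vbox a b : measurable (vbox a b).
Proof.
rewrite (_ : vbox a b = \bigcap_(i in [set: 'I_d])
    (vcoord ^~ i) @^-1` `[a i, b i[%classic).
  apply: fin_bigcap_measurable => // i _; rewrite -[X in measurable X]setTI.
  exact: measurable_vcoord.
by apply/seteqP; split=> x /= xP i => [_|]; have := xP i; rewrite /= in_itv//=; exact.
Qed.

Lemma cellE : cell V = vbox (fun=> 0) (fun=> 1).
Proof.
have cE (t : 'I_d -> R) : \sum_i t i *: col i V = V *m \col_i t i.
  apply/colP => k; rewrite summxE mxE; apply: eq_bigr => j _.
  by rewrite !mxE mulrC.
apply/seteqP; split => [_ [t t01 <-] i|x x01] /=.
  by rewrite cE vcoord_mulV mxE; exact: t01.
by exists (vcoord x) => //; rewrite cE vcoordK.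
Qed.

Lemma tau_vbox g a b :
  tau V g @` vbox a b = vbox (fun i => a i + g i 0) (fun i => b i + g i 0).
Proof.
apply/seteqP; split => [_ [x xab <-] i|x xab] /=.
  by rewrite vcoordD vcoord_mulV lerD2r ltrD2r; exact: xab.
exists (x - V *m g); last by rewrite /tau subrK.
move=> i; rewrite vcoordD -mulmxN vcoord_mulV mxE.
by have := xab i; rewrite lerBrDr ltrBlDr.
Qed.

Lemma scale_vbox c a b : 0 < c ->
  [set c *: x | x in vbox a b] = vbox (fun i => c * a i) (fun i => c * b i).
Proof.
move=> c0; apply/seteqP; split => [_ [x xab <-] i|x xab] /=.
  by rewrite vcoordZ ler_pM2l// ltr_pM2l//; exact: xab.
exists (c^-1 *: x); last by rewrite scalerA divff ?gt_eqF// scale1r.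
move=> i; rewrite vcoordZ; have := xab i.
by rewrite [_^-1 * _]mulrC ler_pdivlMr// ltr_pdivrMr// ![c * _]mulrC.
Qed.

(** A crude bound for the operator norm in the sup norm; it serves only to compare lattice
    coordinates with the standard ones. *)
Definition entry_sum (A : 'M[R]_d) : R := \sum_i \sum_j `|A i j|.

Lemma entry_sum_ge0 (A : 'M[R]_d) : 0 <= entry_sum A.
Proof. by apply: sumr_ge0 => i _; apply: sumr_ge0. Qed.

Lemma mulmx_coord_le (A : 'M[R]_d) x (r : R) i : (forall j, `|x j 0| <= r) ->
  `|(A *m x) i 0| <= entry_sum A * r.
Proof.
move=> xr; have r0 : 0 <= r by apply: le_trans (xr i).
rewrite mxE; apply: le_trans (ler_norm_sum _ _ _) _.
apply: (@le_trans _ _ (\sum_j `|A i j| * r)).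
  by apply: ler_sum => j _; rewrite normrM ler_wpM2l.
rewrite -mulr_suml ler_wpM2r//.
by rewrite /entry_sum [leRHS](bigD1 i)//= lerDl; apply: sumr_ge0 => k _; apply: sumr_ge0.
Qed.

Lemma vcoord_le_cube x (r : R) i : (forall j, `|vcoord x j| <= r) ->
  `|x i 0| <= entry_sum V * r.
Proof.
move=> xr; rewrite -[in leLHS](vcoordK x); apply: mulmx_coord_le => j.
by rewrite mxE.
Qed.

Lemma coord_le_norm x i : `|x i 0| <= euclidean_norm x.
Proof.
rewrite /euclidean_norm -sqrtr_sqr ler_wsqrtr// (bigD1 i)//= lerDl.
by apply: sumr_ge0 => j _; rewrite sqr_ge0.
Qed.

(** The added 1 makes the factor visibly positive, so that its inverse can serve as a constant
    later. *)
Lemma vcoord_le_norm x i : `|vcoord x i| <= (entry_sum (invmx V) + 1) * euclidean_norm x.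
Proof.
have := @mulmx_coord_le (invmx V) x _ i (fun j => coord_le_norm x j).
move/le_trans; apply; rewrite ler_wpM2r ?sqrtr_ge0// lerDl//.
Qed.

Lemma vbox_cube a b : exists M, vbox a b `<=` cube M.
Proof.
exists (entry_sum V * \sum_j (`|a j| + `|b j|)) => x xab i.
apply: vcoord_le_cube => j; rewrite (bigD1 j)//=.
apply: (@le_trans _ _ (`|a j| + `|b j|)).
  have /andP[ax xb] := xab j; rewrite ler_norml.
  have := ler_norm (- a j); have := ler_norm (b j); rewrite normrN.
  have := normr_ge0 (a j); have := normr_ge0 (b j).
  by move: ax xb => ax xb ? ? ? ?; apply/andP; split; lra.
by rewrite lerDl sumr_ge0// => k _; rewrite addr_ge0.
Qed.

Lemma locally_finite_vbox (nu : {measure set 'cV[R]_d -> \bar R}) a b :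
  locally_finite nu -> (nu (vbox a b) < +oo)%E.
Proof.
move=> lf; have [M HM] := vbox_cube a b.
apply: le_lt_trans (locally_finite_cube M lf).
by apply: le_measure; rewrite ?inE//; [exact: measurable_vbox|exact: measurable_cube].
Qed.

Definition upd a (i : 'I_d) (c : R) : 'I_d -> R := fun j => if j == i then c else a j.

Lemma upd_upd a i c e : upd (upd a i c) i e = upd a i e.
Proof. by apply/funext => j; rewrite /upd; case: eqP. Qed.

Lemma upd_eq a i c : upd a i c i = c.
Proof. by rewrite /upd eqxx. Qed.

Lemma vbox_split (nu : {measure set 'cV[R]_d -> \bar R}) a b i c : a i <= c <= b i ->
  nu (vbox a b) = (nu (vbox a (upd b i c)) + nu (vbox (upd a i c) b))%E.
Proof.
move=> /andP[ac cb]; rewrite -measureU.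
- congr (nu _); apply/seteqP; split => [x xab|x [] xab j].
  + have [xc|cx] := ltP (vcoord x i) c; [left|right] => j; rewrite /upd;
      case: eqP => [->|_]; have := xab j => //; have := xab i.
      by case/andP => ->.
    by case/andP => _ ->; rewrite cx.
  + have := xab j; rewrite /upd; case: eqP => [->|//].
    by case/andP => -> /lt_le_trans ->.
  + have := xab j; rewrite /upd; case: eqP => [->|//].
    by case/andP => /(le_trans ac) -> ->.
- exact: measurable_vbox.
- exact: measurable_vbox.
- apply/seteqP; split => // x [/(_ i) + /(_ i)]; rewrite /upd eqxx => /andP[_ xc] /andP[cx _].
  by move: xc; rewrite ltNge cx.
Qed.

(** The first sum covers [0, q) and the second [-p, 0) in direction i. Each unit slab is a lattice
    translate of the one over [0, 1), which will turn the sums into orbit sums. *)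
Lemma vbox_slabs (nu : {measure set 'cV[R]_d -> \bar R}) a b i (p q : nat) :
  nu (vbox (upd a i (- p%:R)) (upd b i q%:R)) =
  (\sum_(k < q) nu (vbox (upd a i k%:R) (upd b i k.+1%:R)) +
   \sum_(k < p) nu (vbox (upd a i (- k.+1%:R)) (upd b i (- k%:R))))%E.
Proof.
have vb0 (u v : 'I_d -> R) c : nu (vbox (upd u i c) (upd v i c)) = 0%E.
  rewrite (_ : vbox _ _ = set0) ?measure0//; apply/seteqP; split => // x /(_ i).
  by rewrite !upd_eq => /andP[/le_lt_trans h/h]; rewrite ltxx.
elim: p => [|p IH].
  rewrite oppr0 big_ord0 adde0.
  elim: q => [|q IHq]; first by rewrite big_ord0 vb0.
  rewrite big_ord_recr/= -IHq.
  rewrite [LHS](@vbox_split nu _ _ i q%:R) ?upd_eq ?upd_upd//.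
  by rewrite ler0n ler_nat leqnSn.
rewrite big_ord_recr/= addeA -IH addeC.
rewrite [LHS](@vbox_split nu _ _ i (- p%:R)) ?upd_eq ?upd_upd//.
rewrite lerN2 ler_nat leqnSn /=.
by apply: (@le_trans _ _ 0); rewrite ?oppr_le0 ?ler0n.
Qed.

(** With equal sides the box is a translate of a homothetic cell, so the volume of the cell stays a
    factor and no determinant is computed. *)
Lemma lebesgue_vbox a (s : R) : 0 < s ->
  lebesgue_cV R d (vbox a (fun i => a i + s)) = ((s ^+ d)%:E * lebesgue_cV R d (cell V))%E.
Proof.
move=> s0; rewrite -(lebesgue_cV_affine (V *m \col_i a i))//; last first.
  by rewrite cellE; exact: measurable_vbox.
congr (lebesgue_cV R d _).
transitivity (tau V (\col_i a i) @` [set s *: x | x in cell V]).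
  rewrite cellE scale_vbox// tau_vbox; congr vbox; apply/funext => i; rewrite mxE ?mulr0 ?mulr1.
    by rewrite add0r.
  by rewrite addrC.
by rewrite image_comp.
Qed.

Lemma lebesgue_cell_fin : (lebesgue_cV R d (cell V) < +oo)%E.
Proof.
rewrite cellE; have [M HM] := vbox_cube (fun=> 0) (fun=> 1).
have M0 : - `|M| <= `|M| by apply: (@le_trans _ _ 0); rewrite ?oppr_le0.
have := @lebesgue_cV_box R d (fun=> - `|M|) (fun=> `|M|) (fun=> M0) => H.
apply: (@le_lt_trans _ _ (lebesgue_cV R d (cbox (fun=> - `|M|) (fun=> `|M|)))).
  apply: le_measure; rewrite ?inE; [exact: measurable_vbox|exact: measurable_cbox|].
  move=> x /HM xM i; rewrite in_itv/= -ler_norml; apply: le_trans (xM i) (ler_norm _).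
by rewrite /cbox H ltry.
Qed.

Lemma vbox_cover : \bigcup_k vbox (fun=> - k.+1%:R) (fun=> k.+1%:R) = setT.
Proof.
apply/seteqP; split => // x _.
have [N _ HN] := nbhs_infty_ger (\sum_i `|vcoord x i| + 1).
exists N => // i; have xN : `|vcoord x i| < N.+1%:R.
  apply: lt_le_trans (HN N.+1 (leqnSn N)).
  by rewrite (bigD1 i)//= -addrA ltrDl ltr_wpDl// sumr_ge0.
by move: xN; rewrite ltr_norml => /andP[/ltW -> ->].
Qed.

(** If the cell were null, so would be all boxes with equal sides; countably many of them cover the
    space, which contains a cube of volume 1. *)
Lemma lebesgue_cell_gt0 : (0 < lebesgue_cV R d (cell V))%E.
Proof.
rewrite lt0e measure_ge0 andbT; apply/eqP => c0.
have H k : lebesgue_cV R d (vbox (fun=> - k.+1%:R) (fun=> k.+1%:R)) = 0%E.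
  have := @lebesgue_vbox (fun=> - k.+1%:R) (k.+1%:R + k.+1%:R).
  rewrite c0 mule0 addKr => -> //; exact: addr_gt0.
have : lebesgue_cV R d (cbox (fun=> 0) (fun=> 1)) = 0%E.
  apply: (@subset_measure0 _ _ _ _ _ (\bigcup_k vbox (fun=> - k.+1%:R) (fun=> k.+1%:R))).
  - exact: measurable_cbox.
  - by apply: bigcupT_measurable => k; exact: measurable_vbox.
  - by rewrite vbox_cover.
  - apply/eqP; rewrite eq_le measure_ge0 andbT.
    apply: le_trans (measure_sigma_subadditive _ _ _ (@subset_refl _ _)) _.
    + by move=> k; exact: measurable_vbox.
    + by apply: bigcupT_measurable => k; exact: measurable_vbox.
    by rewrite eseries0// => k _ _; exact: H.
rewrite /cbox lebesgue_cV_box// big1 ?subr0// => /eqP.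
by rewrite onee_eq0.
Qed.

End vbox.

(** * Measurability of the mass of a parallelepiped *)

Section ramp.
Context {R : realType}.

(** The rising slope ends at a and the descending slope ends at b, so the pointwise limit is the
    indicator of the half-open interval. There is no monotonicity in n, but all supports lie in one
    bounded interval, which suits dominated convergence. *)
Definition ramp (a b : R) (n : nat) (s : R) : R :=
  Num.max 0 (Num.min 1 (Num.min (1 + n.+1%:R * (s - a)) (n.+1%:R * (b - s)))).

Lemma ramp_ge0 a b n s : 0 <= ramp a b n s.
Proof. by rewrite le_max lexx. Qed.

Lemma ramp_le1 a b n s : ramp a b n s <= 1.
Proof. by rewrite ge_max ler01 ge_min lexx. Qed.

Lemma ramp_neq0 a b n s : ramp a b n s != 0 -> a - 1 <= s < b.
Proof.
move=> r0; have : 0 < ramp a b n s by rewrite lt0r r0 ramp_ge0.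
rewrite lt_max ltxx /= !lt_min ltr01 /= => /andP[H1 H2].
have n1 : 1 <= n.+1%:R :> R by rewrite ler1n.
rewrite pmulr_rgt0 ?subr_gt0// in H2; rewrite H2 andbT.
rewrite leNgt; apply/negP => sa; move: H1; apply/negP; rewrite -leNgt.
have : n.+1%:R * (s - a) <= n.+1%:R * (- 1) by rewrite ler_pM2l//; lra.
by move: n1; lra.
Qed.

Lemma continuous_ramp a b n : continuous (ramp a b n).
Proof.
move=> s.
pose f t : R^o := 1 + n.+1%:R * (t - a); pose g t : R^o := n.+1%:R * (b - t).
have cf : {for s, continuous f}.
  apply: cvgD; first exact: cvg_cst.
  by apply: cvgM; [exact: cvg_cst|apply: cvgB; [exact: cvg_id|exact: cvg_cst]].
have cg : {for s, continuous g}.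
  by apply: cvgM; [exact: cvg_cst|apply: cvgB; [exact: cvg_cst|exact: cvg_id]].
have c0 c : {for s, continuous (cst c : R -> R^o)} by exact: cvg_cst.
exact: (continuous_max (c0 0) (continuous_min (c0 1) (continuous_min cf cg))).
Qed.

Lemma ramp_near a b s : \forall n \near \oo, ramp a b n s = (a <= s < b)%R%:R.
Proof.
have [as_|sa] := leP a s; have [sb|bs] := ltP s b => /=.
- have bs0 : 0 < b - s by rewrite subr_gt0.
  have [N _ HN] := near_infty_natSinv_lt (PosNum bs0).
  exists N => // n /HN /=; rewrite -div1r ltr_pdivrMr// mulrC => /ltW H.
  rewrite /ramp (min_idPl _) ?max_r// le_min H andbT lerDl mulr_ge0// subr_ge0//.
- apply: nearW => n; apply/eqP; rewrite eq_le ramp_ge0 andbT ge_max lexx /=.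
  by rewrite !ge_min mulr_ge0_le0 ?orbT// subr_le0.
- have sa0 : 0 < a - s by rewrite subr_gt0.
  have [N _ HN] := near_infty_natSinv_lt (PosNum sa0).
  exists N => // n /HN /=; rewrite -div1r ltr_pdivrMr// mulrC => /ltW H.
  apply/eqP; rewrite eq_le ramp_ge0 andbT ge_max lexx /= !ge_min.
  by apply/orP; right; apply/orP; left; move: H; lra.
- apply: nearW => n; apply/eqP; rewrite eq_le ramp_ge0 andbT ge_max lexx /=.
  by rewrite !ge_min mulr_ge0_le0 ?orbT// subr_le0.
Qed.

End ramp.

Lemma continuous_sum (R : realType) (T : topologicalType) (I : Type) (r : seq I)
  (F : I -> T -> R) : (forall i, continuous (F i)) -> continuous (fun x => \sum_(i <- r) F i x).
Proof. by move=> cF x; apply: cvg_big => [|i _]; [exact: add_continuous|exact: cF]. Qed.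

Lemma continuous_prod (R : realType) (T : topologicalType) (I : Type) (r : seq I)
  (F : I -> T -> R) : (forall i, continuous (F i)) -> continuous (fun x => \prod_(i <- r) F i x).
Proof. by move=> cF x; apply: cvg_big => [|i _]; [exact: mul_continuous|exact: cF]. Qed.

Lemma continuous_mulcst (R : realType) (T : topologicalType) (c : R) (f : T -> R) :
  continuous f -> continuous (fun x => c * f x).
Proof. by move=> cf x; apply: cvgM; [exact: cvg_cst|exact: cf]. Qed.

Section measurable_random_measure.
Context {R : realType} {d : nat}.
Variables (V : 'M[R]_d).
Hypothesis V_unit : V \in unitmx.
Context d' (Omega : measurableType d').
Variables (mu : Omega -> lfmeasure R d).
Hypothesis mu_meas : measurable_fun setT mu.

(** The evaluation at f is a coordinate of [vague_eval], hence continuous for the initial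
    topology. *)
Lemma measurable_integral_ccs (f : continuous_compact_support (R := R) d) :
  measurable_fun setT (fun w => \int[mu w]_x sval f x).
Proof.
apply: (measurable_comp (F := setT) (f := fun nu : lfmeasure R d => \int[nu]_x sval f x)) => //.
apply: (measurability _ (RGenOpens.measurableE R)) => //.
move=> _ [_ [a [b ->]] <-]; rewrite setTI; apply: sub_sigma_algebra.
have cf : continuous (fun nu : lfmeasure R d => \int[nu]_x sval f x : R).
  move=> nu; have := @initial_continuous _ _ (@vague_eval R d) nu.
  move=> c1; have c2 := @proj_continuous {classic (continuous_compact_support (R := R) d)}
    (fun=> R) f (vague_eval nu).
  exact: (continuous_comp c1 c2).
by move/continuousP : cf; apply; exact: interval_open.
Qed.

Definition ramp_vbox (a b : 'I_d -> R) n (x : 'cV[R]_d) : R :=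
  \prod_i ramp (a i) (b i) n (vcoord V x i).

Lemma continuous_vcoord i : continuous (fun x : 'cV[R]_d => vcoord V x i).
Proof.
have -> : (fun x : 'cV[R]_d => vcoord V x i) = fun x => \sum_j invmx V i j * x j 0.
  by apply/funext => y; rewrite vcoordE.
apply: continuous_sum => j; apply: continuous_mulcst; exact: coord_continuous.
Qed.

Lemma continuous_ramp_vbox a b n : continuous (ramp_vbox a b n).
Proof.
apply: continuous_prod => i x.
exact: (continuous_comp (@continuous_vcoord i x) (@continuous_ramp _ _ _ _ _)).
Qed.

Lemma ramp_vbox_ge0 a b n x : 0 <= ramp_vbox a b n x.
Proof. by apply: prodr_ge0 => i _; exact: ramp_ge0. Qed.

Lemma ramp_vbox_le1 a b n x : ramp_vbox a b n x <= 1.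
Proof. rewrite /ramp_vbox; apply: (@le_trans _ _ (\prod_(i < d) 1)); last by rewrite big1.
by apply: ler_prod => i _; rewrite ramp_ge0 ramp_le1. Qed.

Lemma ramp_vbox_neq0 a b n x : ramp_vbox a b n x != 0 ->
  vbox V (fun i => a i - 1) b x.
Proof. by move=> /prodf_neq0 H i; apply: ramp_neq0 (H i isT). Qed.

Lemma ramp_vbox_compact a b n : compact (closure [set x | ramp_vbox a b n x != 0]).
Proof.
have [M HM] := vbox_cube V_unit (fun i => a i - 1) b.
apply: (@subclosed_compact _ _ (@cube R d (M + 1))); first exact: closed_closure.
  exact: cube_compact.
move=> x xcl i.
have [y [/ramp_vbox_neq0/HM yM /(cV_ballP _ _ ltr01) xy]] := xcl _ (nbhsx_ballx x 1 ltr01).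
rewrite -(subrK (y i 0) (x i 0)) addrC; apply: le_trans (ler_normD _ _) _.
by apply: lerD; [exact: yM|exact: ltW].
Qed.

Lemma ramp_vbox_near a b x :
  \forall n \near \oo, ramp_vbox a b n x = \1_(vbox V a b) x.
Proof.
have : \forall n \near \oo, forall i, ramp (a i) (b i) n (vcoord V x i) = (a i <= vcoord V x i < b i)%R%:R.
  by apply: filter_forall => i; exact: ramp_near.
apply: filterS => n H; rewrite /ramp_vbox indicE.
have [xab|xab] := pselect (vbox V a b x).
  by rewrite mem_set// big1// => i _; rewrite H xab.
rewrite memNset//; have /existsNP[i /negP/negbTE xi] := xab.
by rewrite (bigD1 i)//= H xi mul0r.
Qed.

(** The Borel sets of the vague topology give access to integrals of continuous functions only, so
    the indicator of the box is reached as a limit of ramps. *)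
Lemma measurable_mu_vbox a b : measurable_fun setT (fun w => mu w (vbox V a b)).
Proof.
pose f n : continuous_compact_support (R := R) d :=
  exist _ (ramp_vbox a b n) (conj (@continuous_ramp_vbox a b n) (@ramp_vbox_compact a b n)).
apply: (emeasurable_fun_cvg (fun n w => (\int[mu w]_x sval (f n) x)%:E)) => //.
  by move=> n; apply/measurable_EFinP; exact: measurable_integral_ccs.
(* Every ramp vanishes outside this enlarged box, which has finite mass; its indicator is the
   dominating function. *)
move=> w _; set D := vbox V (fun i => a i - 1) b.
have mD : measurable D by exact: measurable_vbox.
have Dfin : (mu w D < +oo)%E by apply: locally_finite_vbox => //; exact: lfmeasureP.
have iD : (mu w).-integrable setT (EFin \o \1_D).
  apply/integrableP; split; first by apply/measurable_EFinP; exact: measurable_indic.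
  under eq_integral do rewrite gee0_abs /= ?lee_fin//.
  by rewrite integral_indic// setIT.
have ramp_le n x : ramp_vbox a b n x <= \1_D x.
  have [->|r0] := eqVneq (ramp_vbox a b n x) 0; first by rewrite indicE.
  by rewrite indicE mem_set ?ramp_vbox_le1//; exact: ramp_vbox_neq0 r0.
have mr n : measurable_fun setT (ramp_vbox a b n).
  by apply: continuous_measurable_cV; exact: continuous_ramp_vbox.
(* The vague evaluation is a real integral, that is [fine] of the extended one; finiteness makes the
   two agree. *)
have E n : (\int[mu w]_x sval (f n) x)%:E = (\int[mu w]_x (ramp_vbox a b n x)%:E)%E.
  rewrite fineK//; apply: integrable_fin_num => //.
  apply: le_integrable iD => //; first by apply/measurable_EFinP; exact: mr.
  by move=> x _; rewrite /= lee_fin !ger0_norm ?ramp_vbox_ge0 ?ramp_le// indicE.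
under eq_cvg do rewrite E.
have -> : mu w (vbox V a b) = (\int[mu w]_x (\1_(vbox V a b) x)%:E)%E.
  by rewrite integral_indic ?setIT//; exact: measurable_vbox.
apply: (@dominated_cvg _ _ _ (mu w) setT measurableT _ _ (EFin \o \1_D)) => //.
- by move=> n; apply/measurable_EFinP; exact: mr.
- move=> x _; apply: cvg_near_cst; have := ramp_vbox_near a b x.
  by apply: filterS => n ->.
- by move=> n x _; rewrite /= lee_fin ger0_norm ?ramp_vbox_ge0.
Qed.

End measurable_random_measure.

(** * Almost sure limits of box averages *)

Section limsup_algebra.
Local Open Scope ereal_scope.
Context {R : realType}.
Implicit Types (u v : (\bar R)^nat).

Lemma lte_between (x : \bar R) (r : R) : x < r%:E -> exists2 s : R, x < s%:E & (s < r)%R.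
Proof.
case: x => [x| |]//=; rewrite ?lte_fin => H.
  by exists ((x + r) / 2)%R; rewrite ?lte_fin midf_lt.
by exists (r - 1)%R; rewrite ?ltNyr// gtrBl.
Qed.

Lemma limn_esupZ u (k : R) : (0 <= k)%R -> (forall n, 0 <= u n) ->
  limn_esup (fun n => k%:E * u n) <= k%:E * limn_esup u.
Proof.
rewrite le_eqVlt => /predU1P[<- _|k0 u0].
  by rewrite mul0e; apply: limn_esup_le_near; apply: nearW => n; rewrite mul0e.
apply: lee_gtP => r.
rewrite muleC -lte_pdivlMr// => /limn_esup_lt H; apply: limn_esup_le_near.
by apply: filterS H => n; rewrite lte_pdivlMr// muleC => /ltW.
Qed.

Lemma limn_einfZ u (k : R) : (0 <= k)%R -> (forall n, 0 <= u n) ->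
  k%:E * limn_einf u <= limn_einf (fun n => k%:E * u n).
Proof.
rewrite le_eqVlt => /predU1P[<- _|k0 u0].
  by rewrite mul0e; apply: limn_einf_ge_near; apply: nearW => n; rewrite mul0e.
apply: gee_ltP => r.
rewrite muleC -lte_pdivrMr// => /limn_einf_gt H; apply: limn_einf_ge_near.
by apply: filterS H => n; rewrite lte_pdivrMr// muleC => /ltW.
Qed.

Lemma limn_esupD u v : (forall n, 0 <= u n) -> (forall n, 0 <= v n) ->
  limn_esup (fun n => u n + v n) <= limn_esup u + limn_esup v.
Proof.
move=> u0 v0; have lu := limn_esup_ge0 u0; have lv := limn_esup_ge0 v0.
have [->|] := eqVneq (limn_esup u) +oo.
  by rewrite addye ?leey// gt_eqF// (lt_le_trans _ lv)// ltNy0.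
have [->|] := eqVneq (limn_esup v) +oo.
  by rewrite addey ?leey// gt_eqF// (lt_le_trans _ lu)// ltNy0.
rewrite -!ltey -!ge0_fin_numE// => fv fu.
rewrite -(fineK fu) -(fineK fv) -EFinD; apply/lee_addgt0Pr => e e0.
have e20 : (0 < e / 2)%R by rewrite divr_gt0.
have Hu : \forall n \near \oo, u n < (fine (limn_esup u) + e / 2)%:E.
  by apply: limn_esup_lt; rewrite EFinD fineK// lteDl.
have Hv : \forall n \near \oo, v n < (fine (limn_esup v) + e / 2)%:E.
  by apply: limn_esup_lt; rewrite EFinD fineK// lteDl.
apply: limn_esup_le_near; apply: filterS2 Hu Hv => n /ltW un /ltW vn.
apply: (le_trans (leeD un vn)); rewrite -!EFinD lee_fin.
by rewrite [X in (_ <= _ + X)%R](splitr e) addrACA.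
Qed.

Lemma limn_einfD u v : (forall n, 0 <= u n) -> (forall n, 0 <= v n) ->
  limn_einf u + limn_einf v <= limn_einf (fun n => u n + v n).
Proof.
move=> u0 v0; have lu := limn_einf_ge0 u0; have lv := limn_einf_ge0 v0.
apply: (@le_trans _ _ (limn (fun n => einfs u n + einfs v n))).
  rewrite limeD; [by rewrite -!limn_einf_lim|exact: is_cvg_einfs|exact: is_cvg_einfs|].
  by rewrite -!limn_einf_lim; apply: ge0_adde_def; rewrite inE.
rewrite limn_einf_lim; apply: lee_lim; [|exact: is_cvg_einfs|].
  apply: is_cvgeD; [|exact: is_cvg_einfs|exact: is_cvg_einfs].
  by rewrite -!limn_einf_lim; apply: ge0_adde_def; rewrite inE.
apply: nearW => n; apply: le_ereal_inf_tmp => _ [m /= nm <-].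
by apply: leeD; apply: ereal_inf_lbound; exists m.
Qed.

(** Made for translations: a translate of the n-th box fits into the (n+c)-th, and the change of
    normalisation is a factor tending to 1. *)
Lemma limn_esup_shift_le u v (s : nat -> R) c : (forall n, 0 <= v n) ->
  (forall n, (0 <= s n)%R) -> s @ \oo --> (1%R : R) ->
  (forall n, u n <= (s n)%:E * v (n + c)%N) -> limn_esup u <= limn_esup v.
Proof.
move=> v0 s0 s1 uv; apply: lee_gtP => r /lte_between[r' vr' r'r].
have r'0 : (0 <= r')%R by rewrite -lee_fin; apply: le_trans (ltW vr'); exact: limn_esup_ge0.
have /limn_esup_lt[N _ HN] := vr'.
have sr : (s n * r')%R @[n --> \oo] --> (1 * r')%R by apply: cvgM; [exact: s1|exact: cvg_cst].
rewrite mul1r in sr.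
have H2 : \forall n \near \oo, (s n * r' <= r)%R.
  exact: (cvgr_le _ sr _ r'r).
apply: limn_esup_le_near; near=> n.
apply: (le_trans (uv n)); apply: (@le_trans _ _ ((s n)%:E * r'%:E)).
  rewrite lee_wpmul2l ?lee_fin//; apply: ltW; apply: HN => /=.
  by apply: leq_trans (leq_addr _ _); near: n; exists N.
by rewrite -EFinM lee_fin; near: n.
Unshelve. all: by end_near. Qed.

Lemma limn_einf_shift_le u v (s : nat -> R) c : (forall n, 0 <= v n) ->
  (forall n, (0 <= s n)%R) -> s @ \oo --> (1%R : R) ->
  (forall n, u n <= (s n)%:E * v (n + c)%N) -> limn_einf u <= limn_einf v.
Proof.
move=> v0 s0 s1 uv; apply: gee_ltP => r ru.
have [r0|r0] := ltP r 0%R.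
  by apply: le_trans (limn_einf_ge0 v0); rewrite lee_fin ltW.
have [r' ru' rr'] : exists2 r' : R, r'%:E < limn_einf u & (r < r')%R.
  move: ru; case: (limn_einf u) => [x| |]//=; rewrite ?lte_fin => H.
    by exists ((r + x) / 2)%R; rewrite ?lte_fin midf_lt.
  by exists (r + 1)%R; rewrite ?ltry// ltrDl.
have /limn_einf_gt[N _ HN] := ru'.
have sr : (s n * r)%R @[n --> \oo] --> (1 * r)%R by apply: cvgM; [exact: s1|exact: cvg_cst].
rewrite mul1r in sr.
have [M _ HM] : \forall n \near \oo, (s n * r <= r')%R.
  exact: (cvgr_le _ sr _ rr').
apply: limn_einf_ge_near; exists (N + M + c)%N => // n /= nN.
have nc : (n - c + c = n)%N by rewrite subnK// (leq_trans _ nN)// leq_addl.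
have nc2 : (N + M <= n - c)%N by rewrite leq_subRL ?(leq_trans _ nN) ?leq_addl// addnC.
have H1 := HN (n - c)%N (leq_trans (leq_addr _ _) nc2).
have H2 := HM (n - c)%N (leq_trans (leq_addl _ _) nc2).
have := lt_le_trans H1 (uv (n - c)%N); rewrite nc => H3.
rewrite leNgt; apply/negP => vr.
move: H3; apply/negP; rewrite -leNgt.
apply: (@le_trans _ _ ((s (n - c)%N)%:E * r%:E)); first by rewrite lee_wpmul2l ?lee_fin// ltW.
by rewrite -EFinM lee_fin.
Qed.

End limsup_algebra.

(** * Ergodicity applied to functions that are monotone along the action *)

Section invariant_functions.
Local Open Scope ereal_scope.
Context {R : realType} {d : nat} d' (Omega : measurableType d') (P : probability Omega R).
Variables (G : set 'cV[R]_d) (theta : 'cV[R]_d -> Omega -> Omega).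
Hypotheses (theta_act : measurable_action G theta) (P_erg : ergodic P G theta).
Hypothesis GN : forall g, G g -> G (- g)%R.

Lemma thetaNK g w : G g -> theta g (theta (- g)%R w) = w.
Proof.
case: theta_act => t0 tD _ Gg.
by have /(congr1 (@^~ w)) /= -> := tD g (- g)%R Gg (GN Gg); rewrite subrr t0.
Qed.

(** The reverse inclusion comes from acting with -g. *)
Lemma subinvariant_set (B : set Omega) : measurable B ->
  (forall g w, G g -> B w -> B (theta g w)) -> invariant_set G theta B.
Proof.
move=> mB HB; split => // g Gg; apply/seteqP; split => [_ [w Bw <-]|w Bw].
  exact: HB.
by exists (theta (- g)%R w); [apply: HB => //; exact: GN|exact: thetaNK].
Qed.

Lemma measurable_le (f : Omega -> \bar R) l : measurable_fun setT f ->
  measurable [set x | f x <= l].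
Proof.
move=> mf; rewrite (_ : [set x | _] = ~` [set x | l < f x]).
  by apply: measurableC; exact: measurable_gt.
by apply/seteqP; split=> x /=; rewrite leNgt => /negP.
Qed.

Lemma measurable_ge (f : Omega -> \bar R) l : measurable_fun setT f ->
  measurable [set x | l <= f x].
Proof.
move=> mf; rewrite (_ : [set x | _] = [set x | - f x <= - l]).
  by apply: measurable_le; exact: measurableT_comp.
by apply/seteqP; split=> x /=; rewrite leeN2.
Qed.

Lemma prob1_bigcap (B : nat -> set Omega) : (forall n, measurable (B n)) ->
  (forall n, P (B n) = 1) -> P (\bigcap_n B n) = 1.
Proof.
move=> mB PB; have mI : measurable (\bigcap_n B n) by exact: bigcap_measurable.
have : P (~` \bigcap_n B n) = 0.
  rewrite setC_bigcap; apply/eqP; rewrite eq_le measure_ge0 andbT.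
  apply: le_trans (measure_sigma_subadditive _ _ _ (@subset_refl _ _)) _.
  - by move=> n; exact: measurableC.
  - by apply: bigcupT_measurable => n; exact: measurableC.
  rewrite eseries0// => n _ _; rewrite /= probability_setC// PB subee//.
have Pfin : P (\bigcap_n B n) \is a fin_num by exact: fin_num_measure.
rewrite probability_setC// -(fineK Pfin) -EFinB => -[] /eqP.
by rewrite subr_eq0 => /eqP <-.
Qed.

(** For r > c the set where L <= r is invariant. If its probability were 0, L would exceed r almost
    surely and its integral would be at least r > c. Intersecting over r = c + 1/(n+1) gives the
    claim. *)
Lemma subinvariant_le_ae (L : Omega -> \bar R) (c : R) : measurable_fun setT L ->
  (forall w, 0 <= L w) -> (forall g w, G g -> L (theta g w) <= L w) ->
  \int[P]_w L w <= c%:E -> P [set w | L w <= c%:E] = 1.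
Proof.
move=> mL L0 Linv Lc.
have c0 : (0 <= c)%R by rewrite -lee_fin; apply: le_trans Lc; exact: integral_ge0.
have mB r : measurable [set w | L w <= r] by exact: measurable_le.
have H (r : R) : (c < r)%R -> P [set w | L w <= r%:E] = 1.
  move=> cr; have r0 : (0 < r)%R by exact: le_lt_trans cr.
  have [PB|//] : P [set w | L w <= r%:E] = 0 \/ P [set w | L w <= r%:E] = 1.
    apply: P_erg; apply: subinvariant_set => // g w Gg; apply: le_trans; exact: Linv.
  have : P (~` [set w | L w <= r%:E]) = 1 by rewrite probability_setC// PB sube0.
  move=> PC; have : r%:E <= \int[P]_w L w.
    rewrite -[leLHS]mule1 -PC -integral_cst; last exact: measurableC.
    apply: (@le_trans _ _ (\int[P]_(w in ~` [set w | L w <= r%:E]) L w)).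
      apply: ge0_le_integral => //.
      - exact: measurableC.
      - by move=> x _; rewrite /= lee_fin ltW.
      - exact: measurable_funTS.
      - by move=> x /negP; rewrite -ltNge => /ltW.
    by apply: ge0_subset_integral => //; exact: measurableC.
  by move=> /le_trans/(_ Lc); rewrite lee_fin leNgt cr.
rewrite (_ : [set w | _] = \bigcap_n [set w | L w <= (c + n.+1%:R^-1)%:E]).
  by apply: prob1_bigcap => // n; apply: H; rewrite ltrDl.
apply/seteqP; split => w /=.
  by move=> Lw n _; apply: (le_trans Lw); rewrite lee_fin lerDl.
move=> Lw; apply/lee_addgt0Pr => e e0.
have [N _ HN] := near_infty_natSinv_lt (PosNum e0).
apply: (le_trans (Lw N I)); rewrite -EFinD lee_fin lerD2l ltW//.
by apply: HN => /=.
Qed.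

Lemma superinvariant_ge_ae (L : Omega -> \bar R) (c : R) : measurable_fun setT L ->
  (forall w, 0 <= L w) -> (forall g w, G g -> L w <= L (theta g w)) ->
  c%:E <= \int[P]_w L w -> P [set w | c%:E <= L w] = 1.
Proof.
move=> mL L0 Linv Lc.
have mB r : measurable [set w | r <= L w] by exact: measurable_ge.
have H (r : R) : (r < c)%R -> P [set w | r%:E <= L w] = 1.
  move=> rc; have [r0|r0] := leP r 0%R.
    rewrite (_ : [set w | _] = setT) ?probability_setT//.
    by apply/seteqP; split => // w _ /=; apply: le_trans (L0 w); rewrite lee_fin.
  have [PB|//] : P [set w | r%:E <= L w] = 0 \/ P [set w | r%:E <= L w] = 1.
    apply: P_erg; apply: subinvariant_set => // g w Gg /= rL.
    by apply: le_trans rL _; exact: Linv.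
  have : \int[P]_w L w <= r%:E.
    rewrite (@ge0_negligible_integral _ _ _ P setT [set w | r%:E <= L w])//.
    rewrite setTD; apply: (@le_trans _ _ (\int[P]_(w in ~` [set w | r%:E <= L w]) (cst r%:E w))).
      apply: ge0_le_integral => //.
      - exact: measurableC.
      - exact: measurable_funTS.
      - by move=> x /negP; rewrite -ltNge => /ltW.
    rewrite integral_cst; last exact: measurableC.
    rewrite -[leRHS]mule1 lee_wpmul2l ?lee_fin ?(ltW r0)//.
    by apply: probability_le1; exact: measurableC.
  by move=> /(le_trans Lc); rewrite lee_fin leNgt rc.
rewrite (_ : [set w | _] = \bigcap_n [set w | (c - n.+1%:R^-1)%:E <= L w]).
  by apply: prob1_bigcap => // n; apply: H; rewrite gtrBl.
apply/seteqP; split => w /=.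
  by move=> Lw n _; apply: le_trans Lw; rewrite lee_fin gerBl.
move=> Lw; apply/lee_addgt0Pr => e e0.
have [N _ HN] := near_infty_natSinv_lt (PosNum e0).
rewrite -leeBlDr//; apply: le_trans (Lw N I); rewrite -EFinB lee_fin lerB// ltW//.
by apply: HN => /=.
Qed.

End invariant_functions.

Section moment_tail.
Local Open Scope ereal_scope.
Context d' (Omega : measurableType d') (R : realType) (P : probability Omega R).

(** Markov's inequality for X^alpha at the levels 2^j. *)
Lemma dyadic_tail_moment (X : Omega -> \bar R) (alpha : R) : measurable_fun setT X ->
  (forall w, 0 <= X w) -> (1 < alpha)%R -> \int[P]_w (X w `^ alpha) < +oo ->
  dyadic_tail P (2 `^ (- alpha))%R X.
Proof.
move=> mX X0 a1 Xi; have a0 : (0 < alpha)%R by apply: lt_trans a1.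
have mXa : measurable_fun setT (fun w => X w `^ alpha).
  exact: measurableT_comp (measurable_poweR _) mX.
have Xa0 w : 0 <= X w `^ alpha by exact: poweR_ge0.
have Xfin : \int[P]_w (X w `^ alpha) \is a fin_num by rewrite ge0_fin_numE// integral_ge0.
exists (fine (\int[P]_w (X w `^ alpha))) => j.
have mB : measurable [set w | (2 ^+ j)%:E < X w] by exact: measurable_gt.
have E : ((2 `^ (- alpha)) ^+ j = (((2 : R) ^+ j) `^ alpha)^-1)%R.
  by rewrite -powR_mulrn ?powR_ge0// -powRrM mulNr mulrC powRN powRrM powR_mulrn.
have j0 : (0 < ((2 : R) ^+ j) `^ alpha)%R by rewrite powR_gt0// exprn_gt0.
rewrite E EFinM fineK// lee_pdivlMr// muleC.
rewrite -integral_cst//.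
apply: (@le_trans _ _ (\int[P]_(w in [set w | (2 ^+ j)%:E < X w]) (X w `^ alpha))).
  apply: ge0_le_integral => //.
  - by move=> w _; rewrite /= lee_fin ltW.
  - exact: measurable_funTS.
  move=> w /= Hw; rewrite -poweR_EFin; apply: gt0_ler_poweR => //.
  - exact: ltW.
  - by rewrite in_itv/= leey lee_fin exprn_ge0.
  - by rewrite in_itv/= leey X0.
  - exact: ltW.
exact: ge0_subset_integral.
Qed.

Lemma rate_gt0 (alpha : R) : (0 < 2 `^ (- alpha))%R.
Proof. by rewrite powR_gt0. Qed.

(** The product is 2^(1 - alpha): this is where alpha > 1 makes the dyadic series converge. *)
Lemma rate_lt (alpha : R) : (1 < alpha)%R -> (2 * 2 `^ (- alpha) < 1)%R.
Proof.
move=> a1; rewrite -[X in (X * _)%R](powRr1 (ler0n _ 2)) -powRD ?pnatr_eq0 ?implybT//.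
rewrite /powR pnatr_eq0/= expR_lt1 pmulr_llt0 ?subr_lt0//.
by rewrite ln_gt0// ltr1n.
Qed.

End moment_tail.

Lemma mule_split {R : realType} (a x y : R) (Z : \bar R) : 0 <= a -> 0 <= x -> 0 <= y ->
  ((a * (x + y))%:E * Z = y%:E * (a%:E * Z) + x%:E * (a%:E * Z))%E.
Proof.
move=> a0 x0 y0; rewrite !muleA -!EFinM -ge0_muleDl ?lee_fin ?mulr_ge0// -EFinD.
by congr (_%:E * _)%E; ring.
Qed.

Lemma lee_comb {R : realType} (a b : R) (x y x' y' : \bar R) : 0 <= a -> 0 <= b ->
  (x <= x' -> y <= y' -> a%:E * x + b%:E * y <= a%:E * x' + b%:E * y')%E.
Proof.
move=> a0 b0 xz yz; apply: leeD; apply: lee_wpmul2l; rewrite ?lee_fin//.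
Qed.

Section combination.
Local Open Scope ereal_scope.
Context d' (Omega : measurableType d') (R : realType) (P : probability Omega R).
Variables (a b : R) (A B H : nat -> Omega -> \bar R).
Hypotheses (a0 : (0 <= a)%R) (b0 : (0 <= b)%R).
Hypotheses (A0 : forall n w, 0 <= A n w) (B0 : forall n w, 0 <= B n w).
Hypotheses (mA : forall n, measurable_fun setT (A n)).
Hypotheses (mB : forall n, measurable_fun setT (B n)).
Hypothesis HE : forall n w, H n w = a%:E * A n w + b%:E * B n w.

Let HE' : H = fun n w => a%:E * A n w + b%:E * B n w.
Proof. by apply/funext => n; apply/funext => w; rewrite HE. Qed.

Lemma integral_limn_esup_comb : \int[P]_w limn_esup (H ^~ w) <=
  a%:E * \int[P]_w limn_esup (A ^~ w) + b%:E * \int[P]_w limn_esup (B ^~ w).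
Proof.
have mlA : measurable_fun setT (fun w => limn_esup (A ^~ w)) by exact: measurable_fun_limn_esup.
have mlB : measurable_fun setT (fun w => limn_esup (B ^~ w)) by exact: measurable_fun_limn_esup.
have lA0 w : 0 <= limn_esup (A ^~ w) by exact: limn_esup_ge0.
have lB0 w : 0 <= limn_esup (B ^~ w) by exact: limn_esup_ge0.
rewrite -!ge0_integralZl// -ge0_integralD//; try exact: emeasurable_funM;
  try by move=> w _; rewrite mule_ge0.
rewrite HE'; apply: ge0_le_integral => //.
- by move=> w _; apply: limn_esup_ge0 => n; rewrite adde_ge0// mule_ge0.
- apply: measurable_fun_limn_esup => n.
  by apply: emeasurable_funD; exact: emeasurable_funM.
- by apply: emeasurable_funD; exact: emeasurable_funM.
move=> w _; apply: le_trans (limn_esupD _ _) _; try by move=> n; rewrite mule_ge0.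
by apply: leeD; exact: limn_esupZ.
Qed.

Lemma integral_limn_einf_comb :
  a%:E * \int[P]_w limn_einf (A ^~ w) + b%:E * \int[P]_w limn_einf (B ^~ w) <=
  \int[P]_w limn_einf (H ^~ w).
Proof.
have mlA : measurable_fun setT (fun w => limn_einf (A ^~ w)) by exact: measurable_limn_einf.
have mlB : measurable_fun setT (fun w => limn_einf (B ^~ w)) by exact: measurable_limn_einf.
have lA0 w : 0 <= limn_einf (A ^~ w) by exact: limn_einf_ge0.
have lB0 w : 0 <= limn_einf (B ^~ w) by exact: limn_einf_ge0.
rewrite -!ge0_integralZl// -ge0_integralD//; try exact: emeasurable_funM;
  try by move=> w _; rewrite mule_ge0.
rewrite HE'; apply: ge0_le_integral => //.
- by move=> w _; rewrite adde_ge0// mule_ge0.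
- by apply: emeasurable_funD; exact: emeasurable_funM.
- apply: measurable_limn_einf => n.
  by apply: emeasurable_funD; exact: emeasurable_funM.
move=> w _; apply: le_trans (limn_einfD _ _); try by move=> n; rewrite mule_ge0.
by apply: leeD; exact: limn_einfZ.
Qed.

End combination.

(** * Induction over the lattice directions *)

Section box_averages.
Context (R : realType) (d : nat) (dOmega : measure_display) (Omega : measurableType dOmega).
Variables (P : probability Omega R) (G : set 'cV[R]_d).
Hypothesis GE : G = setT \/ G = integer_vectors R d.
Variables (theta : 'cV[R]_d -> Omega -> Omega).
Hypothesis theta_act : measurable_action G theta.
Variables (V : 'M[R]_d).
Hypothesis V_unit : V \in unitmx.
Hypotheses (P_stat : stationary P G theta) (P_erg : ergodic P G theta).
Variables (mu : Omega -> lfmeasure R d).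
Hypothesis mu_meas : measurable_fun setT mu.
Hypothesis mu_cov : forall w g, G g -> forall A, measurable A ->
    mu (theta g w) A = tau_measure V g (mu w) A.

Lemma integer_G g : integer_vectors R d g -> G g.
Proof. by case: GE => ->. Qed.

Lemma oppr_G g : G g -> G (- g).
Proof. by case: GE => -> // Gg i; rewrite mxE rpredN. Qed.

Lemma measurable_G : measurable G.
Proof. by case: GE => -> //; exact: measurable_integer_vectors. Qed.

Lemma measurable_theta g : G g -> measurable_fun setT (theta g).
Proof.
move=> Gg; case: theta_act => _ _ mt.
rewrite (_ : theta g = (fun p => theta p.1 p.2) \o (fun w => (g, w)))//.
apply: (measurable_comp _ _ mt).
- by apply: measurableX => //; exact: measurable_G.
- by move=> _ [w _ <-].
- exact: measurable_fun_pair.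
Qed.

Definition unitv (i : 'I_d) : 'cV[R]_d := delta_mx i 0.

Lemma integer_unitv i (k : R) : k \is a Num.int -> integer_vectors R d (k *: unitv i).
Proof. by move=> ki j; rewrite !mxE rpredM// eqxx andbT rpred_nat. Qed.

Lemma G_unitv i (k : R) : k \is a Num.int -> G (k *: unitv i).
Proof. by move=> ki; exact/integer_G/integer_unitv. Qed.

Lemma iter_theta i (e : R) k w : e \is a Num.int ->
  iter k (theta (e *: unitv i)) w = theta ((k%:R * e) *: unitv i) w.
Proof.
move=> ei; case: theta_act => t0 tD _; elim: k => [|k IH].
  by rewrite mul0r scale0r t0.
rewrite iterS IH.
have /(congr1 (@^~ w)) /= -> := tD _ _ (G_unitv i ei) (G_unitv i (rpredM (rpred_nat _ k) ei)).
by rewrite -scalerDl -[in RHS]natr1 mulrDl mul1r addrC.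
Qed.

Lemma mu_theta_vbox g w a b : G g -> mu (theta g w) (vbox V a b) =
  mu w (vbox V (fun i => a i + g i 0) (fun i => b i + g i 0)).
Proof.
move=> Gg; rewrite mu_cov//; last exact: measurable_vbox.
by rewrite /tau_measure tau_vbox.
Qed.

Lemma mu_vbox_slab w a b i (e : R) k : e \is a Num.int ->
  mu (iter k (theta (e *: unitv i)) w) (vbox V a b) =
  mu w (vbox V (upd a i (a i + k%:R * e)) (upd b i (b i + k%:R * e))).
Proof.
move=> ei; rewrite iter_theta// mu_theta_vbox; last first.
  by apply: G_unitv; rewrite rpredM// rpred_nat.
congr (mu w (vbox V _ _)); apply/funext => j; rewrite /upd !mxE.
  by case: eqP => [->|_] /=; rewrite ?mulr1// mulr0 addr0.
by case: eqP => [->|_] /=; rewrite ?mulr1// mulr0 addr0.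
Qed.

Section fixed_box.
Variables (p q : 'I_d -> nat).
Hypotheses (p0 : forall i, (0 < p i)%N) (q0 : forall i, (0 < q i)%N).

(* These boxes interpolate, one direction at a time, between the cell (j = 0) and a dilated box (j = d). *)
Definition box_lo j n (i : 'I_d) : R := if (i < j)%N then - (p i * n.+1)%:R else 0.
Definition box_up j n (i : 'I_d) : R := if (i < j)%N then (q i * n.+1)%:R else 1.

Definition box_avg j n w : \bar R :=
  ((n.+1%:R ^- j)%:E * mu w (vbox V (box_lo j n) (box_up j n)))%E.

Lemma box_avg_ge0 j n w : (0 <= box_avg j n w)%E.
Proof. by rewrite mule_ge0// lee_fin invr_ge0 exprn_ge0. Qed.

Lemma measurable_box_avg j n : measurable_fun setT (box_avg j n).
Proof. by apply: emeasurable_funM => //; exact: measurable_mu_vbox. Qed.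

(** Cut the box along direction i into unit slabs; covariance turns the k-th slab into the previous
    box seen from the k-th orbit point. The new factor 1/(n+1) is q i, resp. p i, divided by the
    number of slabs on that side. The negative slabs begin with [-1, 0), hence the extra [\o T']. *)
Lemma box_avg_step j n w (jd : (j < d)%N) (i := Ordinal jd)
    (T := theta (1 *: unitv i)) (T' := theta ((-1) *: unitv i)) :
  box_avg j.+1 n w =
  ((q i)%:R%:E * avg T (q i * n.+1).-1 (box_avg j n) w +
   (p i)%:R%:E * avg T' (p i * n.+1).-1 (box_avg j n \o T') w)%E.
Proof.
have loE : box_lo j.+1 n = upd (box_lo j n) i (- (p i * n.+1)%:R).
  apply/funext => k; rewrite /box_lo /upd ltnS leq_eqVlt -val_eqE /=.
  by case: eqP => //= kj; rewrite (_ : k = i)//; exact: val_inj.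
have upE : box_up j.+1 n = upd (box_up j n) i (q i * n.+1)%:R.
  apply/funext => k; rewrite /box_up /upd ltnS leq_eqVlt -val_eqE /=.
  by case: eqP => //= kj; rewrite (_ : k = i)//; exact: val_inj.
have lo0 : box_lo j n i = 0 by rewrite /box_lo /= ltnn.
have up1 : box_up j n i = 1 by rewrite /box_up /= ltnn.
have pn : (p i * n.+1).-1.+1 = (p i * n.+1)%N by rewrite prednK// muln_gt0 p0.
have qn : (q i * n.+1).-1.+1 = (q i * n.+1)%N by rewrite prednK// muln_gt0 q0.
rewrite {1}/box_avg loE upE vbox_slabs//.
rewrite ge0_muleDr ?sume_ge0//; congr (_ + _)%E.
  rewrite /avg qn muleA -EFinM natrM invfM mulrA divff ?mul1r; last by rewrite pnatr_eq0 -lt0n.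
  rewrite exprS invfM EFinM -muleA; congr (_ * _)%E.
  rewrite ge0_sume_distrr//; apply: eq_bigr => k _; rewrite /box_avg mu_vbox_slab ?rpred1//.
  by rewrite lo0 up1 mulr1 add0r nat1r.
rewrite /avg pn muleA -EFinM natrM invfM mulrA divff ?mul1r; last by rewrite pnatr_eq0 -lt0n.
rewrite exprS invfM EFinM -muleA; congr (_ * _)%E.
rewrite ge0_sume_distrr//; apply: eq_bigr => k _; rewrite /box_avg /= -iterS.
rewrite mu_vbox_slab ?rpredN ?rpred1// lo0 up1.
have -> : (1 + k.+1%:R * -1 = - k%:R :> R) by rewrite -(natr1 k); ring.
by rewrite mulrN1 add0r.
Qed.

Let X w := mu w (cell V).
Let c j : R := \prod_(i < d | (i < j)%N) (p i + q i)%:R.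

Lemma theta_unitv_preserving i (e : R) A : e \is a Num.int -> measurable A ->
  P (theta (e *: unitv i) @^-1` A) = P A.
Proof. by move=> ei mA; apply: P_stat => //; exact: G_unitv. Qed.

Lemma box_avg0 n w : box_avg 0 n w = X w.
Proof. by rewrite /box_avg expr0 invr1 mul1e /X cellE. Qed.

Variable alpha : R.
Hypothesis alpha_gt1 : 1 < alpha.
Hypothesis mu_moment : (\int[P]_w (mu w (cell V) `^ alpha) < +oo)%E.
Let rho : R := 2 `^ (- alpha).

Lemma measurable_mu_cell : measurable_fun setT X.
Proof. by rewrite /X cellE//; exact: measurable_mu_vbox. Qed.

Lemma dyadic_tail_cell : dyadic_tail P rho X.
Proof. by apply: dyadic_tail_moment => //; exact: measurable_mu_cell. Qed.

(** By [box_avg_step] the supremum over n at stage j+1 is at most a combination of maximal functions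
    of the supremum at stage j. Tail bounds of a fixed rate pass through such a step; mere
    integrability would not. *)
Lemma dyadic_tail_sup_box_avg j : (j <= d)%N ->
  dyadic_tail P rho (fun w => esups (box_avg j ^~ w) 0%N).
Proof.
have rho0 : 0 < rho by exact: rate_gt0.
have rho1 : 2 * rho < 1 by exact: rate_lt.
have mS k : measurable_fun setT (fun w => esups (box_avg k ^~ w) 0%N).
  by apply: measurable_fun_esups => n; exact: measurable_box_avg.
have S0 k w : (0 <= esups (box_avg k ^~ w) 0%N)%E.
  by apply: le_ereal_sup_tmp; exists (box_avg k 0%N w); [exists 0%N|exact: box_avg_ge0].
elim: j => [_|j IH jd].
  apply: le_dyadic_tail dyadic_tail_cell => //; first exact: measurable_mu_cell.
  by move=> w; apply: ge_ereal_sup => _ [n _ <-]; rewrite box_avg0.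
have {}IH := IH (ltnW jd).
pose i := Ordinal jd; pose T := theta (1 *: unitv i); pose T' := theta ((-1) *: unitv i).
pose S w := esups (box_avg j ^~ w) 0%N.
have i1 : (1 : R) \is a Num.int by rewrite rpred1.
have iN1 : (-1 : R) \is a Num.int by rewrite rpredN rpred1.
have mT : measurable_fun setT T by apply: measurable_theta; exact: G_unitv.
have mT' : measurable_fun setT T' by apply: measurable_theta; exact: G_unitv.
have PT A : measurable A -> P (T @^-1` A) = P A by exact: theta_unitv_preserving.
have PT' A : measurable A -> P (T' @^-1` A) = P A by exact: theta_unitv_preserving.
have mST' : measurable_fun setT (S \o T') by apply: measurableT_comp => //; exact: mS.
have m1 : measurable_fun setT (maxavg T S) by apply: measurable_maxavg => //; exact: mS.
have m2 : measurable_fun setT (maxavg T' (S \o T')) by exact: measurable_maxavg.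
have M0 U g w : (forall y, 0 <= g y)%E -> (0 <= maxavg U g w)%E.
  by move=> g0; apply: le_trans (avg_le_maxavg U g w 0%N); exact: avg_ge0.
have t1 : dyadic_tail P rho (fun w => (q i)%:R%:E * maxavg T S w)%E.
  apply: dyadic_tailZ => //; first by move=> w; apply: M0; exact: S0.
  by apply: dyadic_tail_maxavg => //; [exact: mS|exact: S0].
have t2 : dyadic_tail P rho (fun w => (p i)%:R%:E * maxavg T' (S \o T') w)%E.
  apply: dyadic_tailZ => //; first by move=> w; apply: M0 => y; exact: S0.
  apply: dyadic_tail_maxavg => //; first by move=> w; exact: S0.
  by apply: dyadic_tail_comp => //; exact: mS.
have m1' : measurable_fun setT (fun w => (q i)%:R%:E * maxavg T S w)%E by exact: emeasurable_funM.
have m2' : measurable_fun setT (fun w => (p i)%:R%:E * maxavg T' (S \o T') w)%E by exact: emeasurable_funM.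
apply: le_dyadic_tail (dyadic_tailD _ _ m1' m2' t1 t2) => //.
  exact: emeasurable_funD.
move=> w; apply: ge_ereal_sup => _ [n _ <-].
have leS y : (box_avg j n y <= S y)%E by apply: ereal_sup_ubound; exists n.
rewrite (box_avg_step n w jd); apply: leeD; rewrite lee_wpmul2l ?lee_fin//.
  by apply: le_trans (avg_le_maxavg _ _ _ (q i * n.+1).-1); exact: le_avg.
by apply: le_trans (avg_le_maxavg _ _ _ (p i * n.+1).-1); apply: le_avg => y /=.
Qed.

(** Each step multiplies both bounds by p i + q i, the weights of the two directional averages in
    [box_avg_step]; [T] and [T'] preserve the integrals of the upper and lower limits of stage j. *)
Lemma integral_box_avg j : (j <= d)%N ->
  (\int[P]_w limn_esup (box_avg j ^~ w) <= (c j)%:E * \int[P]_w X w /\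
   (c j)%:E * \int[P]_w X w <= \int[P]_w limn_einf (box_avg j ^~ w))%E.
Proof.
elim: j => [_|j IH jd].
  rewrite /c big1 ?mul1e//.
  have E w : (box_avg 0 ^~ w @ \oo --> X w)%E.
    by apply: cvg_near_cst; apply: nearW => n; rewrite box_avg0.
  split; rewrite le_eqVlt; apply/orP; left; apply/eqP; apply: eq_integral => w _.
    by rewrite (cvg_limn_einf_sup (E w)).2.
  by rewrite (cvg_limn_einf_sup (E w)).1.
have [IH1 IH2] := IH (ltnW jd).
pose i := Ordinal jd; pose T := theta (1 *: unitv i); pose T' := theta ((-1) *: unitv i).
have rho0 : 0 < rho by exact: rate_gt0.
have rho1 : 2 * rho < 1 by exact: rate_lt.
have i1 : (1 : R) \is a Num.int by rewrite rpred1.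
have iN1 : (-1 : R) \is a Num.int by rewrite rpredN rpred1.
have mT : measurable_fun setT T by apply: measurable_theta; exact: G_unitv.
have mT' : measurable_fun setT T' by apply: measurable_theta; exact: G_unitv.
have PT A : measurable A -> P (T @^-1` A) = P A by exact: theta_unitv_preserving.
have PT' A : measurable A -> P (T' @^-1` A) = P A by exact: theta_unitv_preserving.
have cS : c j.+1 = c j * (p i + q i)%:R.
  rewrite /c (bigD1 i)//= mulrC; congr (_ * _); apply: eq_bigl => k.
  by rewrite ltnS leq_eqVlt -val_eqE /=; case: ltngtP.
pose F n w := box_avg j n w; pose F' n w := box_avg j n (T' w).
have mF n : measurable_fun setT (F n) by exact: measurable_box_avg.
have mF' n : measurable_fun setT (F' n) by apply: measurableT_comp mT'; exact: measurable_box_avg.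
have F0 n w : (0 <= F n w)%E by exact: box_avg_ge0.
have F'0 n w : (0 <= F' n w)%E by exact: box_avg_ge0.
(* [avg] of index n averages n+1 terms, hence the predecessors; positivity of p and q gives n <= mq
   n and n <= mp n. *)
pose mq n := (q i * n.+1).-1; pose mp n := (p i * n.+1).-1.
have leq_mq n : (n <= mq n)%N.
  by rewrite /mq -ltnS prednK ?muln_gt0 ?q0//; apply: leq_pmull.
have leq_mp n : (n <= mp n)%N.
  by rewrite /mp -ltnS prednK ?muln_gt0 ?p0//; apply: leq_pmull.
have mES : measurable_fun setT (fun w => esups (F ^~ w) 0%N) by exact: measurable_fun_esups.
have ES0 w : (0 <= esups (F ^~ w) 0%N)%E.
  by apply: le_ereal_sup_tmp; exists (F 0%N w) => //; exists 0%N.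
have SF : (\int[P]_w esups (F ^~ w) 0%N < +oo)%E.
  apply: (dyadic_tail_lty rho0 rho1) => //.
  exact: dyadic_tail_sup_box_avg (ltnW jd).
have SF' : (\int[P]_w esups (F' ^~ w) 0%N < +oo)%E.
  by rewrite (ge0_integral_preserving mT' PT' (f := fun w => esups (F ^~ w) 0%N)).
have U1 := integral_limn_esup_avg_moving mT PT mF F0 leq_mq SF.
have U2 := integral_limn_esup_avg_moving mT' PT' mF' F'0 leq_mp SF'.
have L1 := integral_limn_einf_avg_moving mT PT mF F0 leq_mq.
have L2 := integral_limn_einf_avg_moving mT' PT' mF' F'0 leq_mp.
have mls : measurable_fun setT (fun w => limn_esup (F ^~ w)) by exact: measurable_fun_limn_esup.
have mli : measurable_fun setT (fun w => limn_einf (F ^~ w)) by exact: measurable_limn_einf.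
have E1 : (\int[P]_w limn_esup (F' ^~ w) = \int[P]_w limn_esup (F ^~ w))%E.
  apply: (ge0_integral_preserving mT' PT' mls) => w; exact: limn_esup_ge0.
have E2 : (\int[P]_w limn_einf (F' ^~ w) = \int[P]_w limn_einf (F ^~ w))%E.
  apply: (ge0_integral_preserving mT' PT' mli) => w; exact: limn_einf_ge0.
rewrite E1 in U2; rewrite E2 in L2.
have a0 n w : (0 <= avg T (mq n) (F n) w)%E by exact: avg_ge0.
have a'0 n w : (0 <= avg T' (mp n) (F' n) w)%E by exact: avg_ge0.
have ma n : measurable_fun setT (avg T (mq n) (F n)) by exact: measurable_avg.
have ma' n : measurable_fun setT (avg T' (mp n) (F' n)) by exact: measurable_avg.
have X0 : (0 <= \int[P]_w X w)%E by exact: integral_ge0.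
have E n w : box_avg j.+1 n w = ((q i)%:R%:E * avg T (mq n) (F n) w + (p i)%:R%:E * avg T' (mp n) (F' n) w)%E.
  exact: box_avg_step.
have mb n : measurable_fun setT (box_avg j.+1 n) by exact: measurable_box_avg.
have b0 n w : (0 <= box_avg j.+1 n w)%E by exact: box_avg_ge0.
have c0 : 0 <= c j by apply: prodr_ge0.
have HU := integral_limn_esup_comb P (ler0n R (q i)) (ler0n R (p i)) a0 a'0 ma ma' E.
have HL := integral_limn_einf_comb P (ler0n R (q i)) (ler0n R (p i)) a0 a'0 ma ma' E.
move: IH1 IH2 c0; rewrite cS natrD; move: (c j) => cj IH1 IH2 c0.
rewrite (mule_split (\int[P]_w X w) c0 (ler0n _ (p i)) (ler0n _ (q i))).
split.
  exact: (le_trans HU (lee_comb (ler0n _ _) (ler0n _ _) (le_trans U1 IH1) (le_trans U2 IH1))).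
exact: (le_trans (lee_comb (ler0n _ _) (ler0n _ _) (le_trans IH2 L1) (le_trans IH2 L2)) HL).
Qed.

End fixed_box.

End box_averages.

Lemma cvg_limn_esup_einf {R : realType} (u : (\bar R)^nat) (l : \bar R) :
  (limn_esup u <= l -> l <= limn_einf u -> u @ \oo --> l)%E.
Proof.
move=> ul lu.
have El : limn_einf u = l by apply/eqP; rewrite eq_le lu (le_trans (limn_einf_sup u)).
have Eu : limn_esup u = l by apply/eqP; rewrite eq_le ul (le_trans lu)// limn_einf_sup.
have c1 : einfs u @ \oo --> l by rewrite -El limn_einf_ereal_sup; exact: cvg_einfs_sup.
have c2 : esups u @ \oo --> l by rewrite -Eu limn_esup_inf; exact: cvg_esups_inf.
apply: squeeze_cvge c1 c2; apply: nearW => n; apply/andP; split.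
  by apply: ereal_inf_lbound; exists n => //=; exact: leqnn.
by apply: ereal_sup_ubound; exists n => //=; exact: leqnn.
Qed.

Lemma cvg_ratio_shift {R : realType} (c d : nat) :
  (((n + c).+1%:R / n.+1%:R) ^+ d : R) @[n --> \oo] --> (1 : R).
Proof.
rewrite -[X in _ --> X](expr1n _ d); apply: (continuous_cvg _ (@exprn_continuous R d 1)).
have -> : (fun n => (n + c).+1%:R / n.+1%:R) = (fun n : nat => 1 + c%:R * n.+1%:R^-1 :> R).
  by apply/funext => n; rewrite -addSn natrD mulrDl divff.
rewrite -[X in _ --> X]addr0 -[X in _ + X](mulr0 c%:R).
apply: cvgD; first exact: cvg_cst.
by apply: cvgM; [exact: cvg_cst|exact: cvg_harmonic].
Qed.

(** * The invariant set of full measure *)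

Section invariant_limits.
Context (R : realType) (d : nat) (dOmega : measure_display) (Omega : measurableType dOmega).
Variables (P : probability Omega R) (G : set 'cV[R]_d).
Hypothesis GE : G = setT \/ G = integer_vectors R d.
Variables (theta : 'cV[R]_d -> Omega -> Omega).
Hypothesis theta_act : measurable_action G theta.
Variables (V : 'M[R]_d).
Hypothesis V_unit : V \in unitmx.
Hypotheses (P_stat : stationary P G theta) (P_erg : ergodic P G theta).
Variables (mu : Omega -> lfmeasure R d).
Hypothesis mu_meas : measurable_fun setT mu.
Hypothesis mu_cov : forall w g, G g -> forall A, measurable A ->
    mu (theta g w) A = tau_measure V g (mu w) A.
Variable alpha : R.
Hypothesis alpha_gt1 : 1 < alpha.
Hypothesis mu_moment : (\int[P]_w (mu w (cell V) `^ alpha) < +oo)%E.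

Lemma vboxS (a b a' b' : 'I_d -> R) : (forall i, a' i <= a i) -> (forall i, b i <= b' i) ->
  vbox V a b `<=` vbox V a' b'.
Proof.
move=> aa bb x xab i; have /andP[ax xb] := xab i.
by rewrite (le_trans (aa i) ax) (lt_le_trans xb (bb i)).
Qed.

Lemma le_vbox (nu : {measure set 'cV[R]_d -> \bar R}) (a b a' b' : 'I_d -> R) :
  (forall i, a' i <= a i) -> (forall i, b i <= b' i) ->
  (nu (vbox V a b) <= nu (vbox V a' b'))%E.
Proof.
by move=> aa bb; apply: le_measure; rewrite ?inE; [exact: measurable_vbox..|exact: vboxS].
Qed.

Section fixed_box.
Variables (p q : 'I_d -> nat).
Hypotheses (p0 : forall i, (0 < p i)%N) (q0 : forall i, (0 < q i)%N).
Local Notation F n w := (box_avg V mu p q d n w).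

(* The box contains 0 in its interior, so a translate of its n-th dilate sits in a slightly larger dilate. *)
Lemma box_avg_theta g : G g -> exists c : nat, forall n w,
  (F n (theta g w) <= (((n + c).+1%:R / n.+1%:R) ^+ d)%:E * F (n + c)%N w)%E.
Proof.
move=> Gg; have [c Hc] : exists c : nat, forall i, `|g i 0| <= c%:R.
  have [N _ HN] := nbhs_infty_ger (\sum_i `|g i 0|).
  exists N => i; apply: le_trans (HN N (leqnn N)).
  by rewrite (bigD1 i)//= lerDl sumr_ge0.
exists c => n w.
rewrite /box_avg muleA -EFinM exprMn exprVn mulrAC divff ?mul1r; last first.
  by rewrite expf_neq0// pnatr_eq0.
apply: lee_wpmul2l; first by rewrite lee_fin invr_ge0 exprn_ge0.
rewrite (mu_theta_vbox V_unit mu_cov w _ _ Gg); apply: le_vbox => i; rewrite /box_lo /box_up ltn_ord.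
  have /(le_trans _) H : - `|g i 0| <= g i 0 by rewrite lerNl ler_normr lexx orbT.
  rewrite -addSn mulnDr natrD opprD lerD2l; apply: H.
  rewrite lerN2; apply: (le_trans (Hc i)); rewrite ler_nat; exact: leq_pmull.
rewrite -addSn mulnDr natrD lerD2l; apply: le_trans (ler_norm _) _.
by apply: (le_trans (Hc i)); rewrite ler_nat; exact: leq_pmull.
Qed.

Lemma limn_esup_box_theta g w : G g ->
  (limn_esup (fun n => F n (theta g w)) <= limn_esup (fun n => F n w))%E.
Proof.
move=> Gg; have [c Hc] := box_avg_theta Gg.
apply: (limn_esup_shift_le (c := c) _ _ (@cvg_ratio_shift R c d)) => n.
- exact: box_avg_ge0.
- by rewrite exprn_ge0// divr_ge0.
- exact: Hc.
Qed.

Lemma limn_einf_box_theta g w : G g ->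
  (limn_einf (fun n => F n w) <= limn_einf (fun n => F n (theta g w)))%E.
Proof.
(* The one-sided comparison of boxes is used for -g at the point [theta g w], which reverses its
   direction. *)
move=> Gg; have GN := oppr_G GE; have [c Hc] := box_avg_theta (GN _ Gg).
apply: (limn_einf_shift_le (c := c) _ _ (@cvg_ratio_shift R c d)) => n.
- exact: box_avg_ge0.
- by rewrite exprn_ge0// divr_ge0.
- have := Hc n (theta g w).
  by have := thetaNK theta_act GN w (GN _ Gg); rewrite opprK => ->.
Qed.

Let EX := fine (\int[P]_w mu w (cell V))%E.
Let cpq : R := \prod_i (p i + q i)%:R.

Lemma expectation_cell_fin : (\int[P]_w mu w (cell V) < +oo)%E.
Proof.
apply: (dyadic_tail_lty (rate_gt0 alpha) (rate_lt alpha_gt1)) => //.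
  exact: measurable_mu_cell.
exact: (dyadic_tail_cell V_unit mu_meas alpha_gt1 mu_moment).
Qed.

Definition box_limit_set := [set w | (limn_esup (fun n => F n w) <= (cpq * EX)%:E)%E] `&`
  [set w | ((cpq * EX)%:E <= limn_einf (fun n => F n w))%E].

Lemma measurable_box_limit_set : measurable box_limit_set.
Proof.
apply: measurableI; [apply: measurable_le|apply: measurable_ge].
  by apply: measurable_fun_limn_esup => n; exact: measurable_box_avg.
by apply: measurable_limn_einf => n; exact: measurable_box_avg.
Qed.

Lemma box_limit_set_theta g w : G g -> box_limit_set w -> box_limit_set (theta g w).
Proof.
move=> Gg [/= H1 H2]; split => /=.
  exact: le_trans (limn_esup_box_theta w Gg) H1.
exact: le_trans H2 (limn_einf_box_theta w Gg).
Qed.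

Lemma prob_box_limit_set : P box_limit_set = 1%E.
Proof.
have [H1 H2] := integral_box_avg GE theta_act V_unit P_stat mu_meas mu_cov p0 q0 alpha_gt1 mu_moment (leqnn d).
have EXE : (\int[P]_w mu w (cell V) = EX%:E)%E.
  by rewrite fineK// ge0_fin_numE ?expectation_cell_fin// integral_ge0.
have cE : \prod_(i < d | (i < d)%N) (p i + q i)%:R = cpq.
  by apply: eq_bigl => i; rewrite ltn_ord.
rewrite EXE cE -EFinM in H1 H2.
have m1 : measurable_fun setT (fun w => limn_esup (fun n => F n w)).
  by apply: measurable_fun_limn_esup => n; exact: measurable_box_avg.
have m2 : measurable_fun setT (fun w => limn_einf (fun n => F n w)).
  by apply: measurable_limn_einf => n; exact: measurable_box_avg.
have P1 := subinvariant_le_ae theta_act P_erg (oppr_G GE) m1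
  (fun w => limn_esup_ge0 (fun n => box_avg_ge0 V mu p q d n w))
  (fun g w => @limn_esup_box_theta g w) H1.
have P2 := superinvariant_ge_ae theta_act P_erg (oppr_G GE) m2
  (fun w => limn_einf_ge0 (fun n => box_avg_ge0 V mu p q d n w))
  (fun g w => @limn_einf_box_theta g w) H2.
(* The two events form a sequence that is constant from index 1 on, so the countable intersection
   lemma applies. *)
pose B (n : nat) := if n is 0%N then [set w | (limn_esup (fun n => F n w) <= (cpq * EX)%:E)%E]
  else [set w | ((cpq * EX)%:E <= limn_einf (fun n => F n w))%E].
have -> : box_limit_set = \bigcap_n B n.
  apply/seteqP; split => [w [w1 w2] [|n] _//|w Bw]; split; [exact: (Bw 0%N)|exact: (Bw 1%N)].
by apply: prob1_bigcap => -[|n] //=; [exact: measurable_le|exact: measurable_ge].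
Qed.

End fixed_box.

Let EX := fine (\int[P]_w mu w (cell V))%E.

Lemma box_limits : exists A : set Omega, [/\ invariant_set G theta A, P A = 1%E &
  forall w, A w -> forall p q : 'I_d -> nat, (forall i, 0 < p i)%N -> (forall i, 0 < q i)%N ->
  box_avg V mu p q d n w @[n --> \oo] --> ((\prod_i (p i + q i)%:R) * EX)%:E].
Proof.
(* Countability of the pairs (p, q) allows one set to serve all boxes. The codes store predecessors,
   so every index, also one that decodes to the default, yields positive p and q. *)
pose pq (n : nat) : {ffun 'I_d -> nat} * {ffun 'I_d -> nat} :=
  odflt ([ffun=> 0%N], [ffun=> 0%N]) (unpickle n).
pose B n := box_limit_set (fun i => ((pq n).1 i).+1) (fun i => ((pq n).2 i).+1).
exists (\bigcap_n B n); split.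
- apply: (subinvariant_set theta_act (oppr_G GE)).
    by apply: bigcap_measurable => // n _; exact: measurable_box_limit_set.
  by move=> g w Gg Bw n _; apply: box_limit_set_theta => //; exact: Bw.
- by apply: prob1_bigcap => n; [exact: measurable_box_limit_set|exact: prob_box_limit_set].
move=> w Aw p q p0 q0.
have := Aw (pickle ([ffun i => (p i).-1], [ffun i => (q i).-1])) I.
rewrite /B /pq pickleK /=.
have -> : (fun i => ([ffun i0 => (p i0).-1] i).+1) = p.
  by apply/funext => i; rewrite ffunE prednK.
have -> : (fun i => ([ffun i0 => (q i0).-1] i).+1) = q.
  by apply/funext => i; rewrite ffunE prednK.
by move=> [H1 H2]; exact: cvg_limn_esup_einf.
Qed.

End invariant_limits.

(** * Scaling limits of a single measure *)

Lemma intr_nat_eq {R : pzRingType} (z : int) (m : nat) : z = m%:Z -> z%:~R = m%:R :> R.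
Proof. by move=> ->. Qed.

Lemma intr_oppnat_eq {R : pzRingType} (z : int) (m : nat) : z = - m%:Z -> z%:~R = - m%:R :> R.
Proof. by move=> ->; rewrite mulrNz. Qed.

Section scaling_limits.
Context {R : realType} {d : nat}.
Variables (V : 'M[R]_d).
Hypothesis V_unit : V \in unitmx.
Variable nu : {measure set 'cV[R]_d -> \bar R}.
Hypothesis nu_lf : locally_finite nu.
Variable E0 : R.
Hypothesis nu_lim : forall p q : 'I_d -> nat, (forall i, 0 < p i)%N -> (forall i, 0 < q i)%N ->
  n.+1%:R ^- d * fine (nu (vbox V (fun i => - (p i * n.+1)%:R) (fun i => (q i * n.+1)%:R)))
    @[n --> \oo] --> (\prod_i (p i + q i)%:R) * E0.

Definition vol (a b : 'I_d -> R) : R := fine (nu (vbox V a b)).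

Lemma volE a b : nu (vbox V a b) = (vol a b)%:E.
Proof. by rewrite fineK// ge0_fin_numE//; exact: locally_finite_vbox. Qed.

Lemma le_vol a b a' b' : (forall i, a' i <= a i) -> (forall i, b i <= b' i) ->
  vol a b <= vol a' b'.
Proof. by move=> aa bb; rewrite -lee_fin -!volE; exact: le_vbox. Qed.

Lemma rescale_vbox eps a b : 0 < eps -> rescale eps nu (vbox V a b) =
  (eps ^+ d * vol (fun i => eps^-1 * a i) (fun i => eps^-1 * b i))%:E.
Proof. by move=> e0; rewrite /rescale scale_vbox ?invr_gt0// volE. Qed.

Definition rvol eps a b : R := eps ^+ d * vol (fun i => eps^-1 * a i) (fun i => eps^-1 * b i).

Lemma cvg_truncn_right (delta : R) : 0 < delta ->
  Num.truncn (delta / eps) @[eps --> 0^'+] --> \oo.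
Proof.
move=> d0 A [N _ NA].
have : \forall eps \near 0^'+, eps < delta / N.+1%:R.
  by apply: nbhs_right_lt; rewrite divr_gt0.
have : \forall eps \near 0^'+, 0 < eps :> R by exact: nbhs_right_gt.
apply: filterS2 => eps e0 eN; apply: NA => /=.
have de0 : 0 <= delta / eps by rewrite divr_ge0// ltW.
rewrite truncn_ge_nat// ler_pdivlMr// mulrC.
have : eps * N.+1%:R <= delta by rewrite -ler_pdivlMr// ltW.
by apply: le_trans; rewrite ler_pM2l// ler_nat.
Qed.

Lemma cvg_right_id : (eps : R) @[eps --> 0^'+] --> (0 : R).
Proof. exact: cvg_at_right_filter (@cvg_id _ (nbhs (0:R))). Qed.

Lemma cvg_eps_truncn (delta : R) : 0 < delta ->
  (eps * (Num.truncn (delta / eps))%:R : R) @[eps --> 0^'+] --> delta.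
Proof.
move=> d0; have H : \forall eps \near 0^'+, delta - eps <= eps * (Num.truncn (delta / eps))%:R <= delta.
  near=> eps; have e0 : 0 < eps by near: eps; exact: nbhs_right_gt.
  have /andP[H1 H2] := truncn_itv (divr_ge0 (ltW d0) (ltW e0)).
  rewrite ler_pdivlMr// in H1; rewrite ltr_pdivrMr// -natr1 in H2.
  by apply/andP; split; lra.
apply: (squeeze_cvgr H); last exact: cvg_cst.
rewrite -[X in _ --> X]subr0; apply: cvgB; [exact: cvg_cst|exact: cvg_right_id].
Unshelve. all: by end_near. Qed.

Lemma cvg_eps_truncnS (delta : R) : 0 < delta ->
  (eps * (Num.truncn (delta / eps)).+1%:R : R) @[eps --> 0^'+] --> delta.
Proof.
move=> d0; rewrite (_ : (fun eps => _) =
    (fun eps : R => eps * (Num.truncn (delta / eps))%:R + eps)); last first.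
  by apply/funext => eps; rewrite -natr1 mulrDr mulr1.
rewrite -[X in _ --> X]addr0; apply: cvgD; [exact: cvg_eps_truncn|exact: cvg_right_id].
Qed.

(** With t the floor of delta/eps, monotonicity places the box between the integer boxes of scales t
    and t+1, while eps t and eps (t+1) both tend to delta. *)
Lemma rvol_box_cvg (p q : 'I_d -> nat) (delta : R) : 0 < delta ->
  (forall i, 0 < p i)%N -> (forall i, 0 < q i)%N ->
  rvol eps (fun i => - (delta * (p i)%:R)) (fun i => delta * (q i)%:R) @[eps --> 0^'+] -->
  delta ^+ d * ((\prod_i (p i + q i)%:R) * E0).
Proof.
move=> d0 p0 q0; set L := _ * E0.
pose f (n : nat) := vol (fun i => - (p i * n)%:R) (fun i => (q i * n)%:R).
pose Fr n := n.+1%:R ^- d * f n.+1.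
have FrL : Fr @ \oo --> L by exact: nu_lim.
pose t eps := Num.truncn (delta / eps).
have up : (eps * (t eps).+1%:R) ^+ d * Fr (t eps) @[eps --> 0^'+] --> delta ^+ d * L.
  apply: cvgM.
    apply: (continuous_cvg _ (@exprn_continuous R d delta)); exact: cvg_eps_truncnS.
  exact: (cvg_comp _ _ (cvg_truncn_right d0) FrL).
(* [Fr n] belongs to the scale n+1, so the scale t corresponds to the index t-1; this is meaningful
   because t >= 1 for small eps. *)
have lo : (eps * (t eps)%:R) ^+ d * Fr (t eps).-1 @[eps --> 0^'+] --> delta ^+ d * L.
  apply: cvgM.
    apply: (continuous_cvg _ (@exprn_continuous R d delta)); exact: cvg_eps_truncn.
  have pinf : (fun n => n.-1) @ \oo --> \oo.
    by move=> A [N _ NA]; exists N.+1 => // n /= Nn; apply: NA => /=; rewrite -ltnS prednK// (leq_ltn_trans _ Nn).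
  exact: (cvg_comp _ _ (cvg_truncn_right d0) (cvg_comp _ _ pinf FrL)).
have near1 : \forall eps \near 0^'+, (1 <= t eps)%N.
  by have /(_ [set n | (1 <= n)%N]) := cvg_truncn_right d0; apply; exists 1%N.
apply: squeeze_cvgr lo up; near=> eps.
have e0 : 0 < eps by near: eps; exact: nbhs_right_gt.
have t1 : (1 <= t eps)%N.
  by near: eps; exact: near1.
have de0 : 0 <= delta / eps by rewrite divr_ge0// ltW.
have /andP[H1 H2] := truncn_itv de0.
have FE n : (eps * n.+1%:R) ^+ d * Fr n = eps ^+ d * f n.+1.
  rewrite exprMn /Fr -mulrA; congr (_ * _).
  by rewrite mulrA divff ?mul1r// expf_neq0// pnatr_eq0.
rewrite FE -{1}(prednK t1) FE prednK// /rvol.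
have eE x : eps^-1 * (delta * x) = (delta / eps) * x by rewrite mulrCA mulrA.
have Hx (x : nat) : (x * t eps)%:R <= delta / eps * x%:R <= (x * (t eps).+1)%:R.
  by rewrite !natrM ![x%:R * _]mulrC !ler_wpM2r// ltW.
rewrite !ler_pM2l ?exprn_gt0//; apply/andP; split; apply: le_vol => i;
  rewrite ?mulrN ?eE ?lerN2; by case/andP: (Hx (p i)); case/andP: (Hx (q i)).
Unshelve. all: by end_near. Qed.

Lemma rvol_split eps a b i c : 0 < eps -> a i <= c <= b i ->
  rvol eps a b = rvol eps a (upd b i c) + rvol eps (upd a i c) b.
Proof.
move=> e0 /andP[ac cb]; have ei0 : 0 < eps^-1 by rewrite invr_gt0.
have updE (u : 'I_d -> R) : (fun j => eps^-1 * upd u i c j) = upd (fun j => eps^-1 * u j) i (eps^-1 * c).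
  by apply/funext => j; rewrite /upd; case: eqP.
rewrite /rvol !updE -mulrDr; congr (_ * _).
apply: EFin_inj; rewrite EFinD -!volE; apply: vbox_split.
by rewrite !ler_pM2l// ac cb.
Qed.

Variable delta : R.
Hypothesis delta0 : 0 < delta.

(** Hybrid boxes: sides of a tile in the first j directions, sides around 0 in the others. Odd
    multiples of delta as end points make 0 interior to the central tile, which is then itself one
    of the known boxes. *)
Definition mix_lo (j : nat) (p : 'I_d -> nat) (k : 'I_d -> int) (i : 'I_d) : R :=
  if (i < j)%N then delta * (2 * k i - 1)%:~R else - (delta * (p i)%:R).
Definition mix_up (j : nat) (q : 'I_d -> nat) (k : 'I_d -> int) (i : 'I_d) : R :=
  if (i < j)%N then delta * (2 * k i + 1)%:~R else delta * (q i)%:R.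

Definition updn (a : 'I_d -> nat) (i : 'I_d) (c : nat) : 'I_d -> nat :=
  fun j => if j == i then c else a j.

(** Inclusion-exclusion one direction at a time: a side away from 0 is the difference of two sides
    that both have 0 in their interior, for which the induction hypothesis holds with other p and
    q. *)
Lemma mix_cvg j (p q : 'I_d -> nat) (k : 'I_d -> int) : (j <= d)%N ->
  (forall i, 0 < p i)%N -> (forall i, 0 < q i)%N ->
  rvol eps (mix_lo j p k) (mix_up j q k) @[eps --> 0^'+] -->
  (\prod_(i < d) (if (i < j)%N then 2 * delta else delta * (p i + q i)%:R)) * E0.
Proof.
elim: j p q => [|j IH] p q jd p0 q0.
  rewrite big_split/= prodr_const card_ord -mulrA.
  exact: rvol_box_cvg.
pose i0 := Ordinal jd.
have up0 (a : 'I_d -> nat) c : (forall i, 0 < a i)%N -> (0 < c)%N -> (forall i, 0 < updn a i0 c i)%N.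
  by move=> a0 c0 i; rewrite /updn; case: eqP.
have ltS (i : 'I_d) : (i < j.+1)%N = (i == i0) || (i < j)%N.
  by rewrite ltnS leq_eqVlt -val_eqE.
have loE m : mix_lo j (updn p i0 m) k = upd (mix_lo j p k) i0 (- (delta * m%:R)).
  apply/funext => i; rewrite /mix_lo /updn /upd; case: eqP => [->|//].
  by rewrite /= ltnn.
have upE m : mix_up j (updn q i0 m) k = upd (mix_up j q k) i0 (delta * m%:R).
  apply/funext => i; rewrite /mix_up /updn /upd; case: eqP => [->|//].
  by rewrite /= ltnn.
have loS : mix_lo j.+1 p k = upd (mix_lo j p k) i0 (delta * (2 * k i0 - 1)%:~R).
  by apply/funext => i; rewrite /mix_lo /upd ltS; case: eqP => [->|].
have upS : mix_up j.+1 q k = upd (mix_up j q k) i0 (delta * (2 * k i0 + 1)%:~R).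
  by apply/funext => i; rewrite /mix_up /upd ltS; case: eqP => [->|].
pose Q := \prod_(i < d | i != i0) (if (i < j)%N then 2 * delta else delta * (p i + q i)%:R).
have PS : \prod_(i < d) (if (i < j.+1)%N then 2 * delta else delta * (p i + q i)%:R) = 2 * delta * Q.
  rewrite (bigD1 i0)//= ltnSn; congr (_ * _); apply: eq_bigr => i /negbTE ii.
  by rewrite ltS ii.
have Pm m n : \prod_(i < d) (if (i < j)%N then 2 * delta else delta * (updn p i0 m i + updn q i0 n i)%:R) =
    delta * (m + n)%:R * Q.
  rewrite (bigD1 i0)//= ltnn /updn eqxx; congr (_ * _).
  by apply: eq_bigr => i /negbTE ii; rewrite ii.
rewrite PS.
have H m n : (0 < m)%N -> (0 < n)%N -> rvol eps (upd (mix_lo j p k) i0 (- (delta * m%:R)))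
    (upd (mix_up j q k) i0 (delta * n%:R)) @[eps --> 0^'+] --> delta * (m + n)%:R * Q * E0.
  move=> m0 n0; rewrite -loE -upE -Pm; apply: IH; [exact: ltnW|exact: up0..].
rewrite loS upS.
have [k0|[m [km|km]]] : k i0 = 0 \/ exists m : nat, k i0 = m.+1%:Z \/ k i0 = - m.+1%:Z.
  by case: (intP (k i0)) => [|m|m]; [left|right; exists m; left|right; exists m; right].
- rewrite k0 mulr0 sub0r add0r; have := H 1%N 1%N isT isT.
  by rewrite mulrN1z mulr1z mulrN [delta * 2]mulrC.
(* For k = m+1 the side [delta (2m+1), delta (2m+3)) is [-delta, delta (2m+3)) without [-delta,
   delta (2m+1)). The case k = -(m+1) below is its mirror image. *)
- rewrite km.
  have -> : (2 * m.+1%:Z - 1)%:~R = (m.*2.+1)%:R :> R.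
    by apply: intr_nat_eq; lia.
  have -> : (2 * m.+1%:Z + 1)%:~R = (m.*2.+3)%:R :> R.
    by apply: intr_nat_eq; lia.
  have A1 := H 1%N m.*2.+3 isT isT; have A2 := H 1%N m.*2.+1 isT isT.
  have -> : 2 * delta * Q * E0 =
      delta * (1 + m.*2.+3)%:R * Q * E0 - delta * (1 + m.*2.+1)%:R * Q * E0.
    by rewrite -mul2n; ring.
  apply: cvg_trans (cvgB A1 A2); apply: near_eq_cvg.
  near=> eps; have e0 : 0 < eps by near: eps; exact: nbhs_right_gt.
  set a := upd (mix_lo j p k) i0 _; set b := upd (mix_up j q k) i0 (delta * m.*2.+3%:R).
  have ac : a i0 <= delta * m.*2.+1%:R <= b i0.
    rewrite /a /b !upd_eq; apply/andP; split; last by rewrite ler_pM2l// ler_nat; lia.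
    by apply: (@le_trans _ _ 0); rewrite ?oppr_le0 mulr_ge0// ltW.
  have Es := rvol_split e0 ac.
  transitivity (rvol eps a b - rvol eps a (upd (mix_up j q k) i0 (delta * m.*2.+1%:R))) => //.
  by rewrite Es /a /b !upd_upd addrAC subrr add0r.
- rewrite km.
  have -> : (2 * - m.+1%:Z - 1)%:~R = - (m.*2.+3)%:R :> R.
    by apply: intr_oppnat_eq; lia.
  have -> : (2 * - m.+1%:Z + 1)%:~R = - (m.*2.+1)%:R :> R.
    by apply: intr_oppnat_eq; lia.
  have A1 := H m.*2.+3 1%N isT isT; have A2 := H m.*2.+1 1%N isT isT.
  rewrite !mulrN; have -> : 2 * delta * Q * E0 =
      delta * (m.*2.+3 + 1)%:R * Q * E0 - delta * (m.*2.+1 + 1)%:R * Q * E0.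
    by rewrite -mul2n; ring.
  apply: cvg_trans (cvgB A1 A2); apply: near_eq_cvg.
  near=> eps; have e0 : 0 < eps by near: eps; exact: nbhs_right_gt.
  set a := upd (mix_lo j p k) i0 (- (delta * m.*2.+3%:R)); set b := upd (mix_up j q k) i0 _.
  have ac : a i0 <= - (delta * m.*2.+1%:R) <= b i0.
    rewrite /a /b !upd_eq lerN2; apply/andP; split; first by rewrite ler_pM2l// ler_nat; lia.
    by apply: (@le_trans _ _ 0); rewrite ?oppr_le0 mulr_ge0// ltW.
  have Es := rvol_split e0 ac.
  transitivity (rvol eps a b - rvol eps (upd (mix_lo j p k) i0 (- (delta * m.*2.+1%:R))) b) => //.
  by rewrite Es /a /b !upd_upd addrK.
Unshelve. all: by end_near. Qed.

Lemma tile_cvg (k : 'I_d -> int) :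
  rvol eps (fun i => delta * (2 * k i - 1)%:~R) (fun i => delta * (2 * k i + 1)%:~R)
  @[eps --> 0^'+] --> (2 * delta) ^+ d * E0.
Proof.
have := @mix_cvg d (fun=> 1%N) (fun=> 1%N) k (leqnn d) (fun=> isT) (fun=> isT).
have -> : mix_lo d (fun=> 1%N) k = (fun i => delta * (2 * k i - 1)%:~R).
  by apply/funext => i; rewrite /mix_lo ltn_ord.
have -> : mix_up d (fun=> 1%N) k = (fun i => delta * (2 * k i + 1)%:~R).
  by apply/funext => i; rewrite /mix_up ltn_ord.
rewrite (eq_bigr (fun=> 2 * delta)) ?prodr_const ?card_ord// => i _.
by rewrite ltn_ord.
Qed.

(* The bound at side r/eps costs at most one more lattice unit, hence the factor (1 + eps)^d. *)
Lemma rvol_growth : exists C : R, 0 <= C /\ forall eps r, 0 < eps -> 1 <= r ->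
  rvol eps (fun=> - r) (fun=> r) <= C * (1 + eps) ^+ d * r ^+ d.
Proof.
have := nu_lim (p := fun=> 1%N) (q := fun=> 1%N) (fun=> isT) (fun=> isT).
move=> lim1; have /cvg_seq_bounded := cvgP _ lim1.
move=> [M [_ /(_ (M + 1) (ltr_pwDr ltr01 (lexx M))) HC]].
set C := M + 1 in HC; exists `|C|; split => // eps r e0 r1.
have r0 : 0 < r by apply: lt_le_trans r1.
have re0 : 0 <= r / eps by rewrite divr_ge0// ltW.
have /andP[t1 t2] := truncn_itv re0; set n := Num.truncn _ in t1 t2.
have H : n.+1%:R ^- d * vol (fun i => - (1 * n.+1)%:R) (fun i => (1 * n.+1)%:R) <= `|C|.
  apply: le_trans (ler_norm _) _; apply: le_trans (HC n I) _; exact: ler_norm.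
rewrite mulrC ler_pdivrMr ?exprn_gt0// in H.
have H2 : eps * n.+1%:R <= (1 + eps) * r.
  rewrite ler_pdivlMr// in t1; rewrite -natr1.
  have : eps * 1 <= eps * r by rewrite ler_pM2l.
  by move: t1; lra.
rewrite -mulrA -exprMn; apply: (@le_trans _ _ (`|C| * (eps * n.+1%:R) ^+ d)); last first.
  by rewrite ler_wpM2l// lerXn2r// nnegrE mulr_ge0// ltW// addr_gt0.
rewrite exprMn mulrCA /rvol ler_pM2l ?exprn_gt0//; apply: le_trans H.
by apply: le_vol => i; rewrite ?mulrN ?lerN2 mul1n mulrC ltW.
Qed.

End scaling_limits.

(** * Dyadic summability of the radial profile *)

Section profile.
Context {R : realType} {d : nat}.
Hypothesis d_gt0 : (0 < d)%N.
Variables (vtheta : R -> R).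
Hypothesis vtheta_ge0 : forall r : R, 0 <= r -> 0 <= vtheta r.
Hypothesis vtheta_meas : measurable_fun `[(0 : R), +oo[ vtheta.
Hypothesis vtheta_nincr : {in `[(0 : R), +oo[ &, {homo vtheta : r s /~ r <= s}}.
Hypothesis vtheta_int : (\int[lebesgue_measure]_(r in `[(0 : R)%R, +oo[)
    (r ^+ d.-1 * vtheta r)%:E < +oo)%E.

Lemma vtheta_le (r s : R) : 0 <= r -> r <= s -> vtheta s <= vtheta r.
Proof.
move=> r0 rs; apply: vtheta_nincr => //; rewrite in_itv/= andbT//.
exact: le_trans rs.
Qed.

(** With s = kappa 2^j, the integrand r^(d-1) vtheta(r) is at least (s/2)^(d-1) vtheta(s) on [s/2,
    s), an interval of length s/2. These intervals are disjoint for different j, so the sum is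
    controlled by the integral. *)
Lemma profile_summable (kappa : R) : 0 < kappa ->
  (\sum_(j <oo) (vtheta (kappa * 2 ^+ j) * (2 ^+ j.+1) ^+ d)%:E < +oo)%E.
Proof.
move=> k0; pose s j : R := kappa * 2 ^+ j.
have s0 j : 0 < s j by rewrite mulr_gt0// exprn_gt0.
have sS j : s j.+1 = 2 * s j by rewrite /s exprS mulrCA.
pose F j : set R := `[s j / 2, s j[%classic.
pose h r := (r ^+ d.-1 * vtheta r)%:E.
have mh : measurable_fun `[(0 : R), +oo[ h.
  by apply/measurable_EFinP; apply: measurable_funM => //; exact: measurable_funX.
have Fsub j : F j `<=` `[(0 : R), +oo[%classic.
  move=> r; rewrite /F/= !in_itv/= andbT => /andP[+ _]; apply: le_trans.
  by rewrite divr_ge0// ltW.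
have h0 r : 0 <= r -> (0 <= h r)%E.
  by move=> r0; rewrite lee_fin mulr_ge0 ?exprn_ge0// vtheta_ge0.
have tF : trivIset setT F.
  apply: ltn_trivIset => -[//|n] m; rewrite ltnS => mn; apply/seteqP; split => // r [].
  rewrite /F /= !in_itv/= => /andP[_ rm] /andP[nr _].
  move: (le_lt_trans nr rm); rewrite sS mulrAC divff ?mul1r// ltNge.
  by rewrite /s ler_pM2l// ler_weXn2l ?ler1n// mn.
(* The constant comes from 2^(j+1) = (4/kappa) (s/2). *)
pose K : R := (4 / kappa) ^+ d.
have K0 : 0 <= K by rewrite exprn_ge0// divr_ge0// ltW.
have dE : d.-1.+1 = d by rewrite prednK.
have uE j : vtheta (s j) * (2 ^+ j.+1) ^+ d = K * ((s j / 2) ^+ d.-1 * vtheta (s j) * (s j / 2)).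
  have -> : (2 : R) ^+ j.+1 = 4 / kappa * (s j / 2).
    rewrite /s exprS; have := lt0r_neq0 k0; move: (2 ^+ j) => z kn0.
    by field.
  by rewrite exprMn /K -[in (s j / 2) ^+ d]dE exprSr; ring.
apply: (@le_lt_trans _ _ (K%:E * \sum_(j <oo) \int[lebesgue_measure]_(r in F j) h r)%E).
  rewrite -nneseriesZl; last first.
    move=> j _; apply: integral_ge0 => r /Fsub; rewrite /= in_itv/= andbT; exact: h0.
  apply: lee_nneseries => [j _ _|j _].
    rewrite lee_fin; apply: mulr_ge0; last by rewrite !exprn_ge0.
    by apply: vtheta_ge0; exact: ltW (s0 j).
  rewrite uE EFinM; apply: lee_wpmul2l; first by rewrite lee_fin.
  have mF : measurable (F j) by exact: measurable_itv.
  have -> : ((s j / 2) ^+ d.-1 * vtheta (s j) * (s j / 2))%:E =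
      (\int[lebesgue_measure]_(r in F j) (cst ((s j / 2) ^+ d.-1 * vtheta (s j))%:E r))%E.
    rewrite integral_cst// EFinM; congr (_ * _)%E.
    have := @lebesgue_measure_itv R `[s j / 2, s j[; rewrite /= lte_fin ifT.
      by move=> Hm; rewrite [RHS]Hm -EFinB; congr EFin; field.
    by rewrite ltr_pdivrMr// ltr_pMr// ltr1n.
  apply: ge0_le_integral => //.
  - move=> r _; rewrite lee_fin; apply: mulr_ge0; last by rewrite vtheta_ge0// ltW.
    by rewrite exprn_ge0// divr_ge0// ltW.
  - exact: measurable_funS mh.
  move=> r; rewrite /F /= in_itv/= => /andP[sr rs].
  have s20 : 0 <= s j / 2 by rewrite divr_ge0// ltW.
  have r0 : 0 <= r by apply: le_trans sr.
  rewrite lee_fin; apply: ler_pM.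
  - by rewrite exprn_ge0.
  - by apply: vtheta_ge0; exact: ltW.
  - by apply: lerXn2r.
  - by apply: vtheta_le => //; exact: ltW.
rewrite -ge0_integral_bigcup//; last 3 first.
- by move=> k; exact: measurable_itv.
- by apply: measurable_funS mh => //; move=> r [j _ /Fsub].
- by move=> r [j _ /Fsub]; rewrite /= in_itv/= andbT; exact: h0.
apply: lte_mul_pinfty; [by rewrite lee_fin|by []|].
apply: le_lt_trans vtheta_int; apply: ge0_subset_integral => //.
- by apply: bigcupT_measurable => k; exact: measurable_itv.
- by move=> r; rewrite /= in_itv/= andbT; exact: h0.
- by move=> r [j _ /Fsub].
Qed.

End profile.

(** * Integrals against measures with a growth bound *)

Section approximation.
Context {R : realType} {d : nat}.
Hypothesis d_gt0 : (0 < d)%N.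
Variables (V : 'M[R]_d).
Hypothesis V_unit : V \in unitmx.
Variables (vtheta : R -> R).
Hypothesis vtheta_ge0 : forall r : R, 0 <= r -> 0 <= vtheta r.
Hypothesis vtheta_meas : measurable_fun `[(0 : R), +oo[ vtheta.
Hypothesis vtheta_nincr : {in `[(0 : R), +oo[ &, {homo vtheta : r s /~ r <= s}}.
Hypothesis vtheta_int : (\int[lebesgue_measure]_(r in `[(0 : R)%R, +oo[)
    (r ^+ d.-1 * vtheta r)%:E < +oo)%E.

(** Chosen so that the Euclidean norm is at least kappa 2^j outside [dbox j]. *)
Let kappa : R := (entry_sum (invmx V) + 1)^-1.

Let kappa_gt0 : 0 < kappa.
Proof. by rewrite invr_gt0 ltr_wpDl// entry_sum_ge0. Qed.

Definition dbox (j : nat) : set 'cV[R]_d := vbox V (fun=> - 2 ^+ j) (fun=> 2 ^+ j).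

Lemma measurable_dbox j : measurable (dbox j).
Proof. exact: measurable_vbox. Qed.

Lemma norm_dboxC j x : ~ dbox j x -> kappa * 2 ^+ j <= euclidean_norm x.
Proof.
move=> /existsNP[i xi]; rewrite mulrC ler_pdivrMr; last by rewrite ltr_wpDl// entry_sum_ge0.
rewrite mulrC; apply: le_trans (vcoord_le_norm V x i).
rewrite leNgt; apply/negP; rewrite ltr_norml => /andP[H1 H2]; apply: xi.
by rewrite H2 ltW.
Qed.

Lemma dbox_dyadic i x : ~ dbox i x -> exists j, [/\ (i <= j)%N, ~ dbox j x & dbox j.+1 x].
Proof.
move=> xi; have [m Hm] : exists m, `[< dbox (i + m) x >].
  have [N _ HN] := nbhs_infty_ger (\sum_k `|vcoord V x k|).
  exists N; apply/asboolP => k.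
  have : `|vcoord V x k| < 2 ^+ (i + N).
    apply: (@le_lt_trans _ _ N%:R).
      apply: le_trans (HN N (leqnn N)); rewrite (bigD1 k)//= lerDl.
      exact: sumr_ge0.
    rewrite -natrX ltr_nat; apply: leq_trans (ltn_expl N (ltnSn 1)) _.
    by rewrite leq_exp2l// leq_addl.
  by rewrite ltr_norml => /andP[/ltW -> ->].
have [k /asboolP Hk kmin] := ex_minnP (ex_intro (fun m => `[< dbox (i + m) x >]) m Hm).
case: k Hk kmin => [|k] Hk kmin; first by move: Hk; rewrite addn0.
exists (i + k)%N; split; [exact: leq_addr| |by rewrite -addnS].
by move=> /asboolP/kmin; rewrite ltnn.
Qed.

(** Up to the growth constant, this bounds the integral of |phi| over the shell between [dbox j] and
    [dbox j.+1]: the largest value of the profile there times the growth of the outer box. *)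
Let u j : R := vtheta (kappa * 2 ^+ j) * (2 ^+ j.+1) ^+ d.

Let u_ge0 j : 0 <= u j.
Proof. by rewrite /u mulr_ge0 ?exprn_ge0// vtheta_ge0// mulr_ge0 ?exprn_ge0// ltW. Qed.

Section growth.
Variables (nu : {measure set 'cV[R]_d -> \bar R}) (C : R).
Hypothesis C0 : 0 <= C.
Hypothesis nu_growth : forall j, (nu (dbox j) <= (C * (2 ^+ j) ^+ d)%:E)%E.
Variable phi : 'cV[R]_d -> R.
Hypothesis phi_cont : continuous phi.
Hypothesis phi_le : forall x, `|phi x| <= vtheta (euclidean_norm x).

Let mphi : measurable_fun setT phi.
Proof. exact: continuous_measurable_cV. Qed.

(** Every point outside [dbox i] lies in some dyadic shell of index j >= i, so |phi| is dominated by
    the series of profile values on the boxes [dbox j.+1]. The measure enters the bound only through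
    [C], hence the uniformity over rescaled measures. *)
Lemma integral_tail i :
  (\int[nu]_(x in ~` dbox i) `|phi x|%:E <= C%:E * \sum_(i <= j <oo) (u j)%:E)%E.
Proof.
pose f j x : \bar R := ((vtheta (kappa * 2 ^+ j))%:E * (\1_(dbox j.+1) x)%:E)%E.
have v0 j : 0 <= vtheta (kappa * 2 ^+ j) by rewrite vtheta_ge0// mulr_ge0 ?exprn_ge0// ltW.
have f0 j x : (0 <= f j x)%E by rewrite mule_ge0// lee_fin.
have mf j : measurable_fun setT (f j).
  apply: emeasurable_funM => //; apply/measurable_EFinP; apply: measurable_indic.
  exact: measurable_dbox.
have mC : measurable (~` dbox i) by apply: measurableC; exact: measurable_dbox.
have mp : measurable_fun setT (fun x => `|phi x|%:E).
  by apply/measurable_EFinP; exact: measurableT_comp.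
have fi j : (\int[nu]_x f j x <= C%:E * (u j)%:E)%E.
  rewrite /f ge0_integralZl ?lee_fin//; last first.
    by apply/measurable_EFinP; apply: measurable_indic; exact: measurable_dbox.
  rewrite integral_indic ?setIT//; last exact: measurable_dbox.
  apply: le_trans (lee_wpmul2l _ (nu_growth j.+1)) _; first by rewrite lee_fin.
  by rewrite -!EFinM lee_fin /u mulrCA.
pose g k x := f (i + k)%N x.
have shiftE (h : nat -> \bar R) : (forall k, 0 <= h k)%E ->
    (\sum_(i <= j <oo) h j = \sum_(k <oo) h (i + k)%N)%E.
  move=> h0; rewrite -nneseries_addn//.
  by apply: eq_eseriesr => k _; rewrite addnC.
rewrite shiftE// -nneseriesZl; last by move=> k _; rewrite lee_fin.
apply: (@le_trans _ _ (\sum_(k <oo) \int[nu]_x g k x)%E); last first.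
  apply: lee_nneseries => [k _ _|k _]; last exact: fi.
  by apply: integral_ge0 => x _; exact: f0.
rewrite -integral_nneseries; [|by []|by move=> k; exact: mf|by move=> k x _; exact: f0].
rewrite [leLHS]integral_mkcond; apply: ge0_le_integral => //.
- by move=> x _; rewrite /patch; case: ifPn.
- by apply/(measurable_restrictT _ mC); exact: measurable_funTS.
- by apply: ge0_emeasurable_sum => [k x _ _|k _]; [exact: f0|exact: mf].
move=> x _; rewrite /patch; case: ifPn; last first.
  by move=> _; apply: nneseries_ge0 => k _ _; exact: f0.
rewrite inE => /dbox_dyadic[j [ij xj xj1]].
apply: (@le_trans _ _ (g (j - i)%N x)).
  rewrite /g subnKC// /f indicE mem_set// mule1 lee_fin.
  apply: le_trans (phi_le x) _; apply: vtheta_le => //; last exact: norm_dboxC.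
  by rewrite mulr_ge0 ?exprn_ge0// ltW.
apply: le_trans (nneseries_lim_ge (j - i).+1 _); last by move=> *; exact: f0.
rewrite big_mkord big_ord_recr /=; rewrite leeDr//.
by apply: sume_ge0 => k _; exact: f0.
Qed.

Lemma dbox_fin j : (nu (dbox j) < +oo)%E.
Proof. exact: le_lt_trans (nu_growth j) (ltry _). Qed.

Lemma integral_phi_dbox j : (\int[nu]_(x in dbox j) `|phi x|%:E < +oo)%E.
Proof.
apply: (@le_lt_trans _ _ (\int[nu]_(x in dbox j) (cst (vtheta 0)%:E x))%E).
  apply: ge0_le_integral => //.
  - exact: measurable_dbox.
  - by apply: measurable_funTS; apply/measurable_EFinP; exact: measurableT_comp.
  - move=> x _; rewrite lee_fin; apply: le_trans (phi_le x) _.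
    by apply: vtheta_le => //; exact: sqrtr_ge0.
rewrite integral_cst; last exact: measurable_dbox.
by apply: lte_mul_pinfty; rewrite ?lee_fin ?vtheta_ge0//; exact: dbox_fin.
Qed.

Lemma sum_u_lty : (\sum_(j <oo) (u j)%:E < +oo)%E.
Proof. exact: profile_summable. Qed.

Lemma integral_abs_phi_lty : (\int[nu]_x `|phi x|%:E < +oo)%E.
Proof.
rewrite -(setUCr (dbox 0)) ge0_integral_setU//=.
- apply: lte_add_pinfty; first exact: integral_phi_dbox.
  apply: le_lt_trans (integral_tail 0) _.
  by apply: lte_mul_pinfty; rewrite ?lee_fin//; exact: sum_u_lty.
- exact: measurable_dbox.
- by apply: measurableC; exact: measurable_dbox.
- by apply: measurable_funTS; apply/measurable_EFinP; exact: measurableT_comp.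
- by apply/disj_setPCl.
Qed.

Lemma integrable_phi : nu.-integrable setT (EFin \o phi).
Proof.
apply/integrableP; split; first exact/measurable_EFinP.
exact: integral_abs_phi_lty.
Qed.

End growth.

End approximation.

(** * A grid of tiles and its step functions *)

Section tiles.
Context {R : realType} {d : nat}.
Variables (V : 'M[R]_d).
Hypothesis V_unit : V \in unitmx.

Definition tile (delta : R) (k : 'I_d -> int) : set 'cV[R]_d :=
  vbox V (fun i => delta * (2 * k i - 1)%:~R) (fun i => delta * (2 * k i + 1)%:~R).

Definition tile_center (delta : R) (k : 'I_d -> int) : 'cV[R]_d :=
  V *m \col_i (delta * (2 * k i)%:~R).

Lemma vcoord_tile_center delta k i : vcoord V (tile_center delta k) i = delta * (2 * k i)%:~R.
Proof. by rewrite vcoord_mulV// mxE. Qed.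

Lemma tile_dist delta k x i : tile delta k x ->
  `|tile_center delta k i 0 - x i 0| <= entry_sum V * delta.
Proof.
move=> xk.
have -> : tile_center delta k i 0 - x i 0 = (tile_center delta k - x) i 0 by rewrite !mxE.
apply: vcoord_le_cube => // j.
rewrite vcoordD -[- x]scaleN1r vcoordZ vcoord_tile_center.
have /andP[] := xk j; rewrite ler_norml rmorphB rmorphD /= mulrBr mulrDr mulr1.
by move: (_ * _%:~R) => a H1 H2; apply/andP; split; lra.
Qed.

Variables (K : nat) (L : R).
Hypothesis L0 : 0 < L.
(** Tiles have side 2 delta, so an odd number 2K+1 of them per direction fills [-L, L) exactly, with
    one tile centred at 0. *)
Let delta : R := L / (K.*2.+1)%:R.
Definition grid (k : {ffun 'I_d -> 'I_(K.*2.+1)}) (i : 'I_d) : int := (k i)%:Z - K%:Z.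

Let delta0 : 0 < delta. Proof. by rewrite divr_gt0. Qed.
Let deltaL : delta * (K.*2.+1)%:R = L. Proof. by rewrite divfK// pnatr_eq0. Qed.

Let LE : L = delta * (2 * K%:R + 1).
Proof. by rewrite -deltaL -natr1 -mul2n natrM. Qed.

(** The index of the tile of x is a floor in each direction; existence and uniqueness of the tile
    both follow from this form. *)
Lemma tile_gridP k x : tile delta (grid k) x <->
  forall i, (k i)%:R <= (vcoord V x i + L) / (2 * delta) < (k i).+1%:R.
Proof.
have E i : delta * (2 * grid k i - 1)%:~R = (k i)%:R * (2 * delta) - L.
  by rewrite [X in _ = _ - X]LE /grid rmorphB rmorphM rmorphB /= mulr1z; ring.
have E' i : delta * (2 * grid k i + 1)%:~R = (k i).+1%:R * (2 * delta) - L.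
  by rewrite [X in _ = _ - X]LE /grid rmorphD rmorphM rmorphB /= mulr1z -(natr1 (k i)); ring.
split=> H i; have := H i; rewrite E E' ler_pdivlMr ?ltr_pdivrMr ?mulr_gt0//.
  by rewrite lerBlDr ltrBrDr.
by rewrite lerBlDr ltrBrDr.
Qed.

Lemma tile_grid_cover x : vbox V (fun=> - L) (fun=> L) x -> exists k, tile delta (grid k) x.
Proof.
move=> xL; pose y i := (vcoord V x i + L) / (2 * delta).
have y0 i : 0 <= y i.
  have /andP[H _] := xL i; apply: divr_ge0; first by move: H; lra.
  by rewrite mulr_ge0// ltW.
have yK i : (Num.truncn (y i) < K.*2.+1)%N.
  rewrite truncn_lt_nat// /y ltr_pdivrMr ?mulr_gt0//.
  have -> : (K.*2.+1)%:R * (2 * delta) = 2 * L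
    by rewrite -deltaL; ring.
  by have /andP[_ H] := xL i; move: H; lra.
exists [ffun i => Ordinal (yK i)]; apply/tile_gridP => i.
by rewrite ffunE /=; exact: truncn_itv.
Qed.

Lemma tile_grid_sub k : tile delta (grid k) `<=` vbox V (fun=> - L) (fun=> L).
Proof.
move=> x /tile_gridP xk i; have := xk i; rewrite ler_pdivlMr ?ltr_pdivrMr ?mulr_gt0//.
move=> /andP[H1 H2]; have k1 : (k i).+1%:R <= (K.*2.+1)%:R :> R by rewrite ler_nat ltn_ord.
have H3 : 0 <= (k i)%:R * (2 * delta) by rewrite !mulr_ge0// ltW.
have H4 : (k i).+1%:R * (2 * delta) <= 2 * L.
  have -> : 2 * L = (K.*2.+1)%:R * (2 * delta) by rewrite -deltaL; ring.
  by rewrite ler_wpM2r// mulr_ge0// ltW.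
by apply/andP; split; lra.
Qed.

Lemma tile_grid_inj k k' x : tile delta (grid k) x -> tile delta (grid k') x -> k = k'.
Proof.
move=> /tile_gridP xk /tile_gridP xk'; apply/ffunP => i; apply: val_inj => /=.
by rewrite -(truncn_def (xk i)) -(truncn_def (xk' i)).
Qed.

Definition step (phi : 'cV[R]_d -> R) (x : 'cV[R]_d) : R :=
  \sum_k phi (tile_center delta (grid k)) * \1_(tile delta (grid k)) x.

Lemma step_tile phi k x : tile delta (grid k) x -> step phi x = phi (tile_center delta (grid k)).
Proof.
move=> xk; rewrite /step (bigD1 k)//= indicE mem_set// mulr1 big1 ?addr0// => k' kk'.
rewrite indicE memNset ?mulr0// => xk'.
by move: kk'; rewrite (tile_grid_inj xk' xk) eqxx.
Qed.

Lemma step_out phi x : ~ vbox V (fun=> - L) (fun=> L) x -> step phi x = 0.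
Proof.
move=> xL; rewrite /step big1// => k _; rewrite indicE memNset ?mulr0//.
by move=> /tile_grid_sub.
Qed.

Lemma tile_center_cube k : cube (entry_sum V * L) (tile_center delta (grid k)).
Proof.
move=> i; apply: vcoord_le_cube => // j; rewrite vcoord_tile_center.
have kK : (k j <= K.*2)%N by rewrite -ltnS ltn_ord.
rewrite normrM gtr0_norm// -[leRHS]deltaL ler_pM2l// -intr_norm.
rewrite [leRHS](_ : _ = (K.*2.+1)%:Z%:~R)// ler_int /grid; lia.
Qed.

End tiles.

Lemma integrable_indic_lty dd (T : measurableType dd) (R : realType)
    (nu : {measure set T -> \bar R}) (A : set T) :
  measurable A -> (nu A < +oo)%E -> nu.-integrable setT (fun x => (\1_A x)%:E).
Proof.
move=> mA nuA; apply/integrableP; split; first exact/measurable_EFinP/measurable_indic.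
rewrite (eq_integral (fun x => (\1_A x)%:E)); first by rewrite integral_indic ?setIT.
by move=> t _; rewrite gee0_abs// lee_fin.
Qed.

(** * Riemann sums with an error uniform in the measure *)

Section riemann_sums.
Context {R : realType} {d : nat}.
Hypothesis d_gt0 : (0 < d)%N.
Variables (V : 'M[R]_d).
Hypothesis V_unit : V \in unitmx.
Variables (vtheta : R -> R).
Hypothesis vtheta_ge0 : forall r : R, 0 <= r -> 0 <= vtheta r.
Hypothesis vtheta_meas : measurable_fun `[(0 : R), +oo[ vtheta.
Hypothesis vtheta_nincr : {in `[(0 : R), +oo[ &, {homo vtheta : r s /~ r <= s}}.
Hypothesis vtheta_int : (\int[lebesgue_measure]_(r in `[(0 : R)%R, +oo[)
    (r ^+ d.-1 * vtheta r)%:E < +oo)%E.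
Variable phi : 'cV[R]_d -> R.
Hypothesis phi_cont : continuous phi.
Hypothesis phi_le : forall x, `|phi x| <= vtheta (euclidean_norm x).

Lemma measurable_tile delta k : measurable (tile V delta k).
Proof. exact: measurable_vbox. Qed.

(** Inside the box, x is within r of the centre of its tile in every coordinate; outside, the step
    function vanishes and the whole of |phi| is error. *)
Lemma step_close K (L e r : R) : 0 < L -> 0 < e ->
  (forall x y : 'cV[R]_d, cube (entry_sum V * L) x -> (forall i, `|x i 0 - y i 0| < r) ->
    `|phi x - phi y| < e) ->
  entry_sum V * (L / (K.*2.+1)%:R) < r ->
  forall x, `|phi x - step V K L phi x| <=
    e * \1_(vbox V (fun=> - L) (fun=> L)) x + `|phi x| * \1_(~` vbox V (fun=> - L) (fun=> L)) x.
Proof.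
move=> L0 e0 unif Kr x; rewrite !indicE in_setC.
have [xL|xL] := boolP (x \in _); last first.
  rewrite step_out ?subr0 ?mulr0 ?add0r ?mulr1//.
  by move=> xL'; rewrite mem_set in xL.
rewrite mulr1 mulr0 addr0; move: xL; rewrite inE => /(tile_grid_cover K L0)[k xk].
rewrite (step_tile L0 phi xk) distrC; apply/ltW/unif; first exact: tile_center_cube.
by move=> i; apply: le_lt_trans Kr; exact: tile_dist xk.
Qed.

Lemma integral_step (nu : {measure set 'cV[R]_d -> \bar R}) K (L : R) : 0 < L ->
  (nu (vbox V (fun=> (- L)%R) (fun=> L)) < +oo)%E ->
  nu.-integrable setT (EFin \o step V K L phi) /\
  (\int[nu]_x (step V K L phi x)%:E)%E = EFin
    (\sum_(k : {ffun 'I_d -> 'I_(K.*2.+1)})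
      phi (tile_center V (L / (K.*2.+1)%:R) (grid k)) * fine (nu (tile V (L / (K.*2.+1)%:R) (grid k)))).
Proof.
move=> L0 nuL; set delta := L / _.
have fin k : (nu (tile V delta (@grid d K k)) < +oo)%E.
  apply: le_lt_trans nuL; apply: le_measure; rewrite ?inE; [exact: measurable_vbox..|].
  exact: tile_grid_sub.
have int k : nu.-integrable setT (fun x => (phi (tile_center V delta (@grid d K k)))%:E *
    (\1_(tile V delta (grid k)) x)%:E)%E.
  apply: integrableZl => //; apply: integrable_indic_lty => //; exact: measurable_tile.
have E : EFin \o step V K L phi = (fun x => \sum_(k : {ffun 'I_d -> 'I_(K.*2.+1)})
    (phi (tile_center V delta (grid k)))%:E * (\1_(tile V delta (grid k)) x)%:E)%E.
  by apply/funext => x; rewrite /= /step -sumEFin; apply: eq_bigr => k _; rewrite EFinM.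
split; first by rewrite E; apply: integrable_sum => // k _; exact: int.
rewrite -[X in integral _ _ X]/(EFin \o step V K L phi) E integral_sum//.
rewrite -sumEFin; apply: eq_bigr => k _.
rewrite integralZl//; last by apply: integrable_indic_lty => //; exact: measurable_tile.
rewrite integral_indic ?setIT//; last exact: measurable_tile.
by rewrite EFinM fineK// ge0_fin_numE.
Qed.

(** The quantifier order is the point: the grid depends on [C], [eta] and phi, and the measure comes
    after. The size L is fixed by the tail of the dyadic series, the mesh by uniform continuity of
    phi; each accounts for half of eta. *)
Lemma integral_approx (C eta : R) : 0 <= C -> 0 < eta ->
  exists (K : nat) (L : R), 0 < L /\
    forall nu : {measure set 'cV[R]_d -> \bar R},
    (forall j, nu (dbox V j) <= (C * (2 ^+ j) ^+ d)%:E)%E ->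
    `|fine (\int[nu]_x (phi x)%:E)%E - \sum_(k : {ffun 'I_d -> 'I_(K.*2.+1)})
      phi (tile_center V (L / (K.*2.+1)%:R) (grid k)) *
      fine (nu (tile V (L / (K.*2.+1)%:R) (grid k)))| <= eta.
Proof.
move=> C0 eta0.
pose u j : R := vtheta ((entry_sum (invmx V) + 1)^-1 * 2 ^+ j) * (2 ^+ j.+1) ^+ d.
have u0 j : (0 <= (u j)%:E)%E.
  rewrite lee_fin mulr_ge0 ?exprn_ge0// vtheta_ge0// mulr_ge0 ?exprn_ge0//.
  by rewrite invr_ge0 addr_ge0// entry_sum_ge0.
have su : (\sum_(j <oo) (u j)%:E < +oo)%E by exact: sum_u_lty.
have [i Hi] : exists i, (C%:E * \sum_(i <= j <oo) (u j)%:E <= (eta / 2)%:E)%E.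
  have tail0 := nneseries_tail_cvg su (fun k _ => u0 k).
  have := cvgeZl (isT : C%:E \is a fin_num) tail0.
  rewrite mule0 => /fine_cvgP[fin /cvgrPdist_le/(_ (eta / 2))].
  rewrite divr_gt0// => /(_ isT) H.
  have [N _ HN] := filterI fin H; exists N; have [/= F1 F2] := HN N (leqnn N).
  by rewrite -(fineK F1) lee_fin; move: F2; rewrite sub0r normrN; apply: le_trans (ler_norm _).
pose L : R := 2 ^+ i; have L0 : 0 < L by rewrite exprn_gt0.
pose B := C * L ^+ d; have B0 : 0 <= B by rewrite mulr_ge0// exprn_ge0// ltW.
(* [B] bounds the mass of the box, so an oscillation below e costs at most e B <= eta/2; the added 1
   prevents division by zero. *)
pose e := eta / 2 / (B + 1); have e0 : 0 < e by rewrite !divr_gt0// ltr_wpDl.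
have eB : e * B <= eta / 2.
  rewrite /e mulrAC ler_pdivrMr ?ltr_wpDl// ler_pM2l ?divr_gt0//.
  by rewrite lerDl.
have [r r0 unif] := uniform_continuous_cube (entry_sum V * L) phi_cont e0.
have [K Kr] : exists K : nat, entry_sum V * (L / (K.*2.+1)%:R) < r.
  (* With K the floor of this quotient, K+1 exceeds it, and 2K+1 >= K+1. *)
  exists (Num.truncn (entry_sum V * L / r)); rewrite mulrA ltr_pdivrMr// -ltr_pdivrMl// [X in X < _]mulrC.
  have /andP[_ H] : (Num.truncn (entry_sum V * L / r))%:R <= entry_sum V * L / r <
      (Num.truncn (entry_sum V * L / r)).+1%:R.
    by apply: truncn_itv; rewrite divr_ge0 ?mulr_ge0 ?entry_sum_ge0// ltW.
  by apply: lt_le_trans H _; rewrite ler_nat ltnS -addnn leq_addr.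
exists K, L; split=> // nu growth.
have mphi : measurable_fun setT phi by exact: continuous_measurable_cV.
have nuL : (nu (vbox V (fun=> (- L)%R) (fun=> L)) < +oo)%E by exact: dbox_fin growth i.
have [stepi stepE] := integral_step K L0 nuL.
have phii : nu.-integrable setT (EFin \o phi).
  exact: (integrable_phi d_gt0 vtheta_ge0 vtheta_meas vtheta_nincr vtheta_int C0 growth phi_cont phi_le).
have mstep : measurable_fun setT (step V K L phi) by move/integrableP: stepi => [/measurable_EFinP].
have mbox : measurable (dbox V i) by exact: measurable_dbox.
have mboxC : measurable (~` dbox V i) by exact: measurableC.
have mp : measurable_fun setT (fun x => `|phi x|) by exact: measurableT_comp.
have fint : (\int[nu]_x (phi x)%:E)%E \is a fin_num by exact: integrable_fin_num phii.
set S := \sum_k _.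
have D : (\int[nu]_x ((phi x)%:E - (step V K L phi x)%:E) =
    (fine (\int[nu]_x (phi x)%:E) - S)%:E)%E.
  by rewrite integralB_EFin// stepE EFinB fineK.
have mdiff : measurable_fun setT (fun x => (phi x)%:E - (step V K L phi x)%:E)%E.
  by apply: emeasurable_funB; exact/measurable_EFinP.
have -> : (`|fine (\int[nu]_x (phi x)%:E)%E - S| <= eta) =
    (`| \int[nu]_x ((phi x)%:E - (step V K L phi x)%:E) | <= eta%:E)%E by rewrite D.
apply: le_trans (le_abse_integral nu measurableT mdiff) _.
pose g1 x : \bar R := (e%:E * (\1_(dbox V i) x)%:E)%E.
pose g2 x : \bar R := (`|phi x|%:E * (\1_(~` dbox V i) x)%:E)%E.
have mi (A : set 'cV[R]_d) : measurable A -> measurable_fun setT (fun x => (\1_A x)%:E : \bar R).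
  by move=> mA; apply/measurable_EFinP; exact: measurable_indic.
have mg1 : measurable_fun setT g1 by apply: emeasurable_funM => //; exact: mi.
have mg2 : measurable_fun setT g2.
  by apply: emeasurable_funM; [exact/measurable_EFinP|exact: mi].
have g10 x : (0 <= g1 x)%E by rewrite mule_ge0 ?lee_fin// ltW.
have g20 x : (0 <= g2 x)%E by rewrite mule_ge0 ?lee_fin.
apply: (@le_trans _ _ (\int[nu]_x (g1 x + g2 x))%E).
  apply: ge0_le_integral => //.
  - exact: measurableT_comp.
  - exact: emeasurable_funD.
  - by move=> x _; rewrite lee_fin; exact: (step_close L0 e0 unif Kr).
rewrite ge0_integralD// [eta]splitr EFinD; apply: leeD.
  rewrite /g1 ge0_integralZl//; [|exact: mi|by rewrite lee_fin ltW].
  rewrite integral_indic// setIT; apply: le_trans (lee_wpmul2l _ (growth i)) _.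
    by rewrite lee_fin ltW.
  by rewrite -EFinM lee_fin.
rewrite [leLHS](_ : _ = \int[nu]_(x in ~` dbox V i) `|phi x|%:E)%E; last first.
  rewrite [RHS]integral_mkcond; apply: eq_integral => x _.
  by rewrite /g2 patchE indicE; case: ifPn; rewrite ?mule1 ?mule0.
apply: le_trans Hi.
exact: (integral_tail vtheta_ge0 vtheta_nincr growth phi_cont phi_le).
Qed.

End riemann_sums.

Lemma integral_mscale dd (T : measurableType dd) (R : realType)
    (nu : {measure set T -> \bar R}) (k : {nonneg R}) (f : T -> \bar R) :
  nu.-integrable setT f ->
  (\int[mscale k nu]_x f x = k%:num%:E * \int[nu]_x f x)%E.
Proof.
move=> fi; have mf := measurable_int _ fi.
rewrite [LHS]integralE [in RHS]integralE.
rewrite !ge0_integral_mscale//; [|exact: measurable_funeneg|exact: measurable_funepos].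
by apply/esym/muleBr => //; exact: integrable_add_def.
Qed.

Section scaled_lebesgue.
Context {R : realType} {d : nat} (V : 'M[R]_d).
Hypothesis V_unit : V \in unitmx.

Lemma lebesgue_dbox j :
  lebesgue_cV R d (dbox V j) = ((2 ^+ d * fine (lebesgue_cV R d (cell V))) * (2 ^+ j) ^+ d)%:E.
Proof.
have -> : dbox V j = vbox V (fun=> - 2 ^+ j) (fun=> - 2 ^+ j + 2 * 2 ^+ j).
  by rewrite /dbox; congr vbox; apply/funext => i; ring.
rewrite (lebesgue_vbox V_unit) ?mulr_gt0 ?exprn_gt0//.
rewrite -{1}(@fineK _ (lebesgue_cV R d (cell V))).
  by rewrite -EFinM exprMn mulrAC.
by rewrite ge0_fin_numE// lebesgue_cell_fin.
Qed.

Lemma lebesgue_tile delta k : 0 < delta ->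
  lebesgue_cV R d (tile V delta k) = ((2 * delta) ^+ d * fine (lebesgue_cV R d (cell V)))%:E.
Proof.
move=> delta0; rewrite /tile.
have -> : (fun i : 'I_d => delta * (2 * k i + 1)%:~R) =
    (fun i => delta * (2 * k i - 1)%:~R + 2 * delta).
  by apply/funext => i; rewrite rmorphB rmorphD /=; ring.
rewrite (lebesgue_vbox V_unit) ?mulr_gt0//.
rewrite -{1}(@fineK _ (lebesgue_cV R d (cell V))) ?EFinM//.
by rewrite ge0_fin_numE// lebesgue_cell_fin.
Qed.

End scaled_lebesgue.

(** * Convergence of the rescaled integrals for a single measure *)

Section scaling_integrals.
Context {R : realType} {d : nat}.
Hypothesis d_gt0 : (0 < d)%N.
Variables (V : 'M[R]_d).
Hypothesis V_unit : V \in unitmx.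
Variable nu : {measure set 'cV[R]_d -> \bar R}.
Hypothesis nu_lf : locally_finite nu.
Variable E0 : R.
Hypothesis E0_ge0 : 0 <= E0.
Hypothesis nu_lim : forall p q : 'I_d -> nat, (forall i, 0 < p i)%N -> (forall i, 0 < q i)%N ->
  n.+1%:R ^- d * fine (nu (vbox V (fun i => - (p i * n.+1)%:R) (fun i => (q i * n.+1)%:R)))
    @[n --> \oo] --> (\prod_i (p i + q i)%:R) * E0.
Variables (vtheta : R -> R).
Hypothesis vtheta_ge0 : forall r : R, 0 <= r -> 0 <= vtheta r.
Hypothesis vtheta_meas : measurable_fun `[(0 : R), +oo[ vtheta.
Hypothesis vtheta_nincr : {in `[(0 : R), +oo[ &, {homo vtheta : r s /~ r <= s}}.
Hypothesis vtheta_int : (\int[lebesgue_measure]_(r in `[(0 : R)%R, +oo[)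
    (r ^+ d.-1 * vtheta r)%:E < +oo)%E.
Variable phi : 'cV[R]_d -> R.
Hypothesis phi_cont : continuous phi.
Hypothesis phi_le : forall x, `|phi x| <= vtheta (euclidean_norm x).

Lemma rescale_growth : exists C : R, 0 <= C /\ forall eps j, 0 < eps ->
  (rescale eps nu (dbox V j) <= (C * (1 + eps) ^+ d * (2 ^+ j) ^+ d)%:E)%E.
Proof.
have [C [C0 HC]] := rvol_growth V_unit nu_lf nu_lim.
exists C; split => // eps j e0; rewrite rescale_vbox// lee_fin.
apply: le_trans (HC eps (2 ^+ j) e0 _); last by rewrite exprn_ege1// ler1n.
by rewrite /rvol.
Qed.

Lemma integral_abs_rescale_lty eps : 0 < eps ->
  (\int[rescale eps nu]_x `|phi x|%:E < +oo)%E.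
Proof.
move=> e0; have [C [C0 HC]] := rescale_growth.
(* [rescale] is a measure for positive eps only, hence the packed [PosNum e0]. *)
apply: (integral_abs_phi_lty d_gt0 vtheta_ge0 vtheta_meas vtheta_nincr vtheta_int
  (nu := rescale (PosNum e0)%:num nu) _ (fun j => HC eps j e0) phi_cont phi_le).
by rewrite mulr_ge0// exprn_ge0// addr_ge0// ltW.
Qed.

Let c : R := fine (lebesgue_cV R d (cell V)).

Let c_gt0 : 0 < c.
Proof. by rewrite fine_gt0// lebesgue_cell_gt0//= lebesgue_cell_fin. Qed.

(** The limit is the integral against E0/c times Lebesgue measure, with c the volume of the cell.
    That measure and the rescaled ones obey a common growth bound, so one grid approximates all
    integrals within eta/3, and the finitely many tile masses converge. *)
Lemma integral_rescale_cvg :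
  (\int[rescale eps nu]_x (phi x)%:E)%E @[eps --> 0^'+] -->
  ((c^-1)%:E * E0%:E * \int[lebesgue_cV R d]_x (phi x)%:E)%E.
Proof.
have m0 : 0 <= c^-1 * E0 by rewrite mulr_ge0// invr_ge0 ltW.
pose la : {measure set 'cV[R]_d -> \bar R} := mscale (NngNum m0) (lebesgue_cV R d).
have laM A : la A = ((c^-1 * E0)%:E * lebesgue_cV R d A)%E by [].
have [C0 [C00 HC]] := rescale_growth.
(* The first term covers the rescaled measures, as (1 + eps)^d <= 2^d for eps <= 1; the second is
   the growth constant of the limit measure, since a [dbox j] has side 2 times 2^j. *)
pose C := C0 * 2 ^+ d + 2 ^+ d * E0.
have C_ge0 : 0 <= C by rewrite addr_ge0 ?mulr_ge0// ?exprn_ge0.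
have la_growth j : (la (dbox V j) <= (C * (2 ^+ j) ^+ d)%:E)%E.
  rewrite laM lebesgue_dbox// -EFinM lee_fin mulrA ler_wpM2r ?exprn_ge0//.
  rewrite /C -/c (_ : c^-1 * E0 * (2 ^+ d * c) = 2 ^+ d * E0); last by field; rewrite gt_eqF.
  by rewrite lerDr mulr_ge0// exprn_ge0.
have rescale_le (eps : R) j : 0 < eps <= 1 -> (rescale eps nu (dbox V j) <= (C * (2 ^+ j) ^+ d)%:E)%E.
  move=> /andP[e0 e1]; apply: le_trans (HC eps j e0) _; rewrite lee_fin.
  rewrite ler_wpM2r ?exprn_ge0// /C; apply: (@le_trans _ _ (C0 * 2 ^+ d)).
    by rewrite ler_wpM2l//; apply: lerXn2r; rewrite ?nnegrE//; lra.
  by rewrite lerDl mulr_ge0// exprn_ge0.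
have lphi : (lebesgue_cV R d).-integrable setT (EFin \o phi).
  apply: (integrable_phi d_gt0 vtheta_ge0 vtheta_meas vtheta_nincr vtheta_int
    (V := V) (nu := lebesgue_cV R d) (C := 2 ^+ d * c) _ _ phi_cont phi_le).
    by rewrite mulr_ge0 ?exprn_ge0// ltW.
  by move=> j; move: (lexx (2 ^+ d * c * (2 ^+ j) ^+ d)%:E); rewrite -{1}(lebesgue_dbox V_unit).
have laE : ((c^-1)%:E * E0%:E * \int[lebesgue_cV R d]_x (phi x)%:E =
    (fine (\int[la]_x (phi x)%:E))%:E)%E.
  rewrite /la integral_mscale//= fineK ?EFinM//.
  by rewrite fin_numM// integrable_fin_num.
rewrite laE; apply/fine_cvgP.
pose F eps := fine (\int[rescale eps nu]_x (phi x)%:E)%E.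
have fin : \forall eps \near 0^'+, (\int[rescale eps nu]_x (phi x)%:E)%E \is a fin_num.
  near=> eps; have e0 : 0 < eps by near: eps; exact: nbhs_right_gt.
  have e1 : eps <= 1 by near: eps; exact: nbhs_right_le.
  have H := integrable_phi d_gt0 vtheta_ge0 vtheta_meas vtheta_nincr vtheta_int
    (V := V) (nu := rescale (PosNum e0)%:num nu) C_ge0 _ phi_cont phi_le.
  by apply: (integrable_fin_num measurableT (H _)) => j; apply: rescale_le; rewrite e0.
split => //.
apply/cvgrPdist_le => eta eta0.
have eta3 : 0 < eta / 3 by rewrite divr_gt0.
have [K [L [L0 HKL]]] := integral_approx d_gt0 V_unit vtheta_ge0 vtheta_meas vtheta_nincr vtheta_int
  phi_cont phi_le C_ge0 eta3.
set delta := L / _ in HKL; have delta0 : 0 < delta by rewrite divr_gt0.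
pose S (n : {measure set 'cV[R]_d -> \bar R}) := \sum_(k : {ffun 'I_d -> 'I_(K.*2.+1)})
      phi (tile_center V delta (grid k)) * fine (n (tile V delta (grid k))).
pose T eps := \sum_(k : {ffun 'I_d -> 'I_(K.*2.+1)})
      phi (tile_center V delta (grid k)) * rvol V nu eps (fun i => delta * (2 * grid k i - 1)%:~R)
        (fun i => delta * (2 * grid k i + 1)%:~R).
have Tcvg : T eps @[eps --> 0^'+] --> S la.
  apply: cvg_big => [|k _]; first exact: add_continuous.
  apply: cvgM; first exact: cvg_cst.
  (* A tile is a translate of the cell scaled by 2 delta, so the volume c of the cell cancels
     against the density E0/c. *)
  rewrite [X in _ --> X](_ : _ = (2 * delta) ^+ d * E0); first exact: tile_cvg.
  rewrite laM lebesgue_tile// -EFinM /= -/c; field.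
  by rewrite gt_eqF.
move/cvgrPdist_le/(_ _ eta3) in Tcvg.
near=> eps; have e0 : 0 < eps by near: eps; exact: nbhs_right_gt.
have e1 : eps <= 1 by near: eps; exact: nbhs_right_le.
have H1 : `|F eps - T eps| <= eta / 3.
  have := HKL (rescale (PosNum e0)%:num nu) (fun j => rescale_le eps j _).
  rewrite e0 e1 => /(_ isT).
  rewrite [X in `|_ - X| <= _ -> _](_ : _ = T eps)//.
  by apply: eq_bigr => k _; congr (_ * _); rewrite /tile /= rescale_vbox.
have H2 : `|fine (\int[la]_x (phi x)%:E)%E - S la| <= eta / 3 by exact: HKL la_growth.
have H3 : `|S la - T eps| <= eta / 3 by near: eps; exact: Tcvg.
rewrite -[X in `|_ - X|]/(F eps); move: H1 H2 H3; rewrite !ler_norml => /andP[? ?] /andP[? ?] /andP[? ?].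
by apply/andP; split; lra.
Unshelve. all: by end_near. Qed.

End scaling_integrals.

Theorem theorem3p5 (R : realType) (d : nat) (d_gt0 : (0 < d)%N)
  (dOmega : measure_display) (Omega : measurableType dOmega)
  (P : probability Omega R)
  (G : set 'cV[R]_d) (GE : G = setT \/ G = integer_vectors R d)
  (theta : 'cV[R]_d -> Omega -> Omega) (theta_act : measurable_action G theta)
  (V : 'M[R]_d) (V_unit : V \in unitmx)
  (P_stat : stationary P G theta) (P_erg : ergodic P G theta)
  (mu : Omega -> lfmeasure R d) (mu_meas : measurable_fun setT mu)
  (mu_cov : forall w g, G g -> forall A, measurable A ->
    mu (theta g w) A = tau_measure V g (mu w) A)
  (alpha : R) (alpha_gt1 : 1 < alpha)
  (mu_moment : (\int[P]_w (mu w (cell V) `^ alpha) < +oo)%E)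
  (vtheta : R -> R)
  (vtheta_ge0 : forall r : R, 0 <= r -> 0 <= vtheta r)
  (vtheta_meas : measurable_fun `[(0 : R), +oo[ vtheta)
  (vtheta_nincr : {in `[(0 : R), +oo[ &, {homo vtheta : r s /~ r <= s}})
  (vtheta_convex : exists2 a : R, 0 < a &
    @convex_function R R^o `[a, +oo[ vtheta)
  (vtheta_int : (\int[lebesgue_measure]_(r in `[(0 : R)%R, +oo[)
    (r ^+ d.-1 * vtheta r)%:E < +oo)%E) :
  exists A : set Omega, [/\ invariant_set G theta A, P A = 1%E &
    forall w, A w -> forall phi : 'cV[R]_d -> R, continuous phi ->
      (forall x, `|phi x| <= vtheta (euclidean_norm x)) ->
      (forall eps : R, 0 < eps ->
        (\int[rescale eps (mu w)]_x `|phi x|%:E < +oo)%E) /\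
      ((\int[rescale eps (mu w)]_x (phi x)%:E)%E @[eps --> 0^'+] -->
        (intensity P V mu * \int[lebesgue_cV R d]_x (phi x)%:E)%E)].
Proof.
have [A [invA PA lim]] := box_limits GE theta_act V_unit P_stat P_erg mu_meas mu_cov alpha_gt1 mu_moment.
set E0 := fine _ in lim.
exists A; split=> // w Aw phi phi_cont phi_le.
have E0_ge0 : 0 <= E0 by rewrite fine_ge0// integral_ge0.
have nu_lf : locally_finite (mu w) by exact: lfmeasureP.
have nu_lim (p q : 'I_d -> nat) : (forall i, 0 < p i)%N -> (forall i, 0 < q i)%N ->
    n.+1%:R ^- d * fine (mu w (vbox V (fun i => - (p i * n.+1)%:R) (fun i => (q i * n.+1)%:R)))
    @[n --> \oo] --> (\prod_i (p i + q i)%:R) * E0.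
  move=> p0 q0; have /fine_cvgP[_] := lim w Aw p q p0 q0.
  apply: cvg_trans; apply: near_eq_cvg; apply: nearW => n /=.
  have -> : vbox V (fun i : 'I_d => - (p i * n.+1)%:R) (fun i : 'I_d => (q i * n.+1)%:R : R) =
      vbox V (box_lo R p d n) (box_up R q d n).
    by congr vbox; apply/funext => i; rewrite /box_lo /box_up ltn_ord.
  rewrite /box_avg fineM// ge0_fin_numE//; exact: locally_finite_vbox.
split=> [eps e0|].
  exact: (integral_abs_rescale_lty d_gt0 V_unit nu_lf nu_lim vtheta_ge0 vtheta_meas
    vtheta_nincr vtheta_int phi_cont phi_le e0).
have := integral_rescale_cvg d_gt0 V_unit nu_lf E0_ge0 nu_lim vtheta_ge0 vtheta_meas
  vtheta_nincr vtheta_int phi_cont phi_le.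
have -> // : ((fine (lebesgue_cV R d (cell V)))^-1%:E * E0%:E)%E = intensity P V mu.
rewrite /intensity /E0 fineK// ge0_fin_numE; last exact: integral_ge0.
exact: expectation_cell_fin mu_moment.
Qed.
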